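(* Let $G$ be a finite group. Given $G$-modules $X$ and $X'$ and $r\in\mathbb{Z}$, the following are equivalent. (a) $(X,X')$ is an $r$-encoding pair. (b) If $r\ge 0$, then $X$ is cohomologically equivalent to $X'\otimes_{\mathbb{Z}} I_G^{\otimes r}$. If $r<0$, then $X$ is cohomologically equivalent to $X'\otimes_{\mathbb{Z}}\operatorname{Hom}_{\mathbb{Z}}(I_G^{\otimes (-r)},\mathbb{Z})$. (c) There is $x\in\widehat H^r(G,\operatorname{Hom}_{\mathbb{Z}}(X',X))$ such that the cup product gives a natural isomorphism $$(-\cup x)\colon\widehat H^i(G,\operatorname{Hom}_{\mathbb{Z}}(X,-))\Rightarrow\widehat H^{i+r}(G,\operatorname{Hom}_{\mathbb{Z}}(X',-))$$ for all $i\in\mathbb{Z}$. (d) There are $x\in\widehat H^r(G,\operatorname{Hom}_{\mathbb{Z}}(X',X))$ and $x'\in\widehat H^{-r}(G,\operatorname{Hom}_{\mathbb{Z}}(X,X'))$ such that $x'\cup x=[\operatorname{id}_{X'}]\in\widehat H^0(G,\operatorname{Hom}_{\mathbb{Z}}(X',X'))$ and $x\cup x'=[\operatorname{id}_X]\in\widehat H^0(G,\operatorname{Hom}_{\mathbb{Z}}(X,X))$. If $X$ and $X'$ are finitely generated $G$-modules, then (a) is equivalent to each of the following. (e) For some $i\in\mathbb{Z}$, there is a natural isomorphism $\widehat H^i(G,X'\otimes_{\mathbb{Z}}-)\Rightarrow\widehat H^{i+r}(G,X\otimes_{\mathbb{Z}}-)$. (f) There is $x\in\widehat H^r(G,\operatorname{Hom}_{\mathbb{Z}}(X',X))$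 such that the cup product gives natural isomorphisms $(x\cup-)\colon\widehat H^i(G,X'\otimes_{\mathbb{Z}}-)\Rightarrow\widehat H^{i+r}(G,X\otimes_{\mathbb{Z}}-)$ for all $i\in\mathbb{Z}$. If $X$ is $\mathbb{Z}$-free and $X'=\mathbb{Z}$ (with trivial $G$-action), then (a) is equivalent to (g) $\widehat H^r(G,X)\cong\mathbb{Z}/|G|\mathbb{Z}$ and $\widehat H^0(G,\operatorname{Hom}_{\mathbb{Z}}(X,X))$ is cyclic.
   Context: $\widehat H^\bullet(G,-)$ denotes Tate cohomology (indexed by $\mathbb{Z}$). A $G$-module is a $\mathbb{Z}[G]$-module; $\operatorname{Hom}_{\mathbb{Z}}(X,A)$ carries the action $(gf)(x)=g\,f(g^{-1}x)$ and $\otimes_{\mathbb{Z}}$ the diagonal action. $\mathbb{Z}$-free means free as an abelian group. $I_G\subseteq\mathbb{Z}[G]$ is the augmentation ideal, $I_G^{\otimes r}$ its $r$-fold tensor power over $\mathbb{Z}$, with $I_G^{\otimes 0}=\mathbb{Z}$. Definition. For $r\in\mathbb{Z}$, a pair of $G$-modules $(X,X')$ is an $r$-encoding pair if there is a natural isomorphism of functors (from $G$-modules to abelian groups) $\widehat H^i(G,\operatorname{Hom}_{\mathbb{Z}}(X,-))\simeq\widehat H^{i+r}(G,\operatorname{Hom}_{\mathbb{Z}}(X',-))$ for some $i\in\mathbb{Z}$. Two $G$-modules $X,X'$ are cohomologically equivalent if $(X,X')$ is a $0$-encoding pair. Cup products: for $G$-modules $A,B,C$, the cup product $\widehat H^p(G,\operatorname{Hom}_{\mathbb{Z}}(B,C))\otimes\widehat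 H^q(G,\operatorname{Hom}_{\mathbb{Z}}(A,B))\to\widehat H^{p+q}(G,\operatorname{Hom}_{\mathbb{Z}}(A,C))$ is the usual cup product followed by the map induced by composition $f\otimes\varphi\mapsto f\circ\varphi$. In (f), the cup product is followed by the map induced by evaluation $\operatorname{Hom}_{\mathbb{Z}}(X',X)\otimes_{\mathbb{Z}}(X'\otimes_{\mathbb{Z}}A)\to X\otimes_{\mathbb{Z}}A$, $\varphi\otimes(x'\otimes a)\mapsto\varphi(x')\otimes a$. For a $G$-module homomorphism $f\colon X\to A$, $[f]$ is its class in $\widehat H^0(G,\operatorname{Hom}_{\mathbb{Z}}(X,A))=\operatorname{Hom}_{\mathbb{Z}[G]}(X,A)/N_G\operatorname{Hom}_{\mathbb{Z}}(X,A)$, where $N_G=\sum_{g\in G}g$. *)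

(* Defs.v *)
From HB Require Import structures.
From mathcomp Require Import all_boot all_algebra fingroup.
From mathcomp Require Import boolp functions.
From mathcomp Require Import generic_quotient ring_quotient freeg.
From mathcomp Require Import zify.

Set Implicit Arguments.
Unset Strict Implicit.
Unset Printing Implicit Defensive.

(* G-modules are zmodTypes with a left action of a finite group, the whole of
   a finGroupType gT.  Their carriers are arbitrary, possibly infinite, so the
   subgroups used to form subtypes and quotients are turned into boolean
   predicates by the classical axioms of boolp. *)

Import GRing.Theory.
Local Open Scope ring_scope.
Local Open Scope quotient_scope.

HB.mixin Record Zmodule_isGModule (gT : finGroupType) A of GRing.Zmodule A := {
  gact : gT -> A -> A;
  gact1 : forall x, gact 1%g x = x;
  gactM : forall g h x, gact (g * h)%g x = gact g (gact h x);
  gactB : forall g, zmod_morphism (gact g)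
}.

#[short(type="gmodType")]
HB.structure Definition GModule (gT : finGroupType) :=
  {A of GRing.Zmodule A & Zmodule_isGModule gT A}.

Section GactTheory.
Variables (gT : finGroupType) (A : gmodType gT).

HB.instance Definition _ (g : gT) :=
  GRing.isZmodMorphism.Build A A (@gact gT A g) (@gactB gT A g).

Lemma gactK (g : gT) : cancel (@gact gT A g) (gact g^-1).
Proof. by move=> x; rewrite -gactM mulVg gact1. Qed.

Lemma gactVK (g : gT) : cancel (@gact gT A g^-1) (gact g).
Proof. by move=> x; rewrite -gactM mulgV gact1. Qed.

End GactTheory.

Record ghom (gT : finGroupType) (A B : gmodType gT) := GHom {
  ghom_fun :> A -> B;
  ghomB : zmod_morphism ghom_fun;
  ghomJ : forall g x, ghom_fun (gact g x) = gact g (ghom_fun x)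
}.

HB.instance Definition _ gT A B (f : @ghom gT A B) :=
  GRing.isZmodMorphism.Build A B f (ghomB f).

Definition ghom_id (gT : finGroupType) (A : gmodType gT) : ghom A A :=
  @GHom gT A A id (fun _ _ => erefl) (fun _ _ => erefl).

Section GHomComp.
Variables (gT : finGroupType) (A B C : gmodType gT).
Variables (f : ghom B C) (h : ghom A B).

Fact ghom_comp_subproof : zmod_morphism (f \o h).
Proof. by move=> x y /=; rewrite !raddfB. Qed.

Fact ghom_compJ g x : (f \o h) (gact g x) = gact g ((f \o h) x).
Proof. by rewrite /= !ghomJ. Qed.

Definition ghom_comp : ghom A C := GHom ghom_comp_subproof ghom_compJ.
End GHomComp.

Definition trivZ (gT : finGroupType) : Type := int.
HB.instance Definition _ gT := GRing.Zmodule.on (trivZ gT).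
HB.instance Definition _ (gT : finGroupType) :=
  @Zmodule_isGModule.Build gT (trivZ gT) (fun _ x => x)
    (fun _ => erefl) (fun _ _ _ => erefl) (fun _ _ _ => erefl).

(* Z[G] as a left G-module: a function a : G -> Z stands for \sum_h a(h) h. *)
Definition group_ring (gT : finGroupType) : Type := {ffun gT -> int}.
HB.instance Definition _ gT := GRing.Zmodule.on (group_ring gT).

Section GroupRing.
Variable gT : finGroupType.
Implicit Types (g h : gT) (a : group_ring gT).

Definition gr_act g a : group_ring gT := [ffun h => a (g^-1 * h)%g].

Fact gr_act1 a : gr_act 1%g a = a.
Proof. by apply/ffunP => h; rewrite ffunE invg1 mul1g. Qed.
Fact gr_actM g h a : gr_act (g * h)%g a = gr_act g (gr_act h a).
Proof. by apply/ffunP => k; rewrite !ffunE invMg mulgA. Qed.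
Fact gr_actB g : zmod_morphism (gr_act g).
Proof. by move=> a b; apply/ffunP => k; rewrite !ffunE. Qed.

HB.instance Definition _ :=
  Zmodule_isGModule.Build gT (group_ring gT) gr_act1 gr_actM gr_actB.

Definition aug a : int := \sum_(g : gT) a g.

Fact aug_is_zmod_morphism : zmod_morphism aug.
Proof.
by move=> a b; rewrite /aug -sumrB; apply: eq_bigr => g _; rewrite !ffunE.
Qed.
HB.instance Definition _ :=
  GRing.isZmodMorphism.Build (group_ring gT) int aug aug_is_zmod_morphism.

Definition aug_ker : {pred group_ring gT} := fun a => aug a == 0.

Fact aug_ker_zmod_closed : zmod_closed aug_ker.
Proof.
split=> [|a b]; rewrite !unfold_in ?raddf0 //.
by move=> /eqP a0 /eqP b0; rewrite raddfB /= a0 b0 subr0.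
Qed.
HB.instance Definition _ :=
  GRing.isZmodClosed.Build (group_ring gT) aug_ker aug_ker_zmod_closed.

Record augIdeal := AugIdeal {
  aug_val :> group_ring gT;
  aug_valP : aug_val \in aug_ker
}.
HB.instance Definition _ := [isSub for aug_val].
HB.instance Definition _ := [Choice of augIdeal by <:].
HB.instance Definition _ := [SubChoice_isSubZmodule of augIdeal by <:].

Fact augIdeal_act_subproof g (a : augIdeal) : gact g (val a) \in aug_ker.
Proof.
suff -> : gact g (val a) \in aug_ker = (val a \in aug_ker) by exact: valP.
rewrite !unfold_in /aug [in RHS](reindex_inj (mulgI g^-1%g)) /=.
by congr (_ == _); apply: eq_bigr => h _; rewrite ffunE.
Qed.
Definition augIdeal_act g (a : augIdeal) := AugIdeal (augIdeal_act_subproof g a).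

Fact augIdeal_act1 u : augIdeal_act 1%g u = u.
Proof. by apply: val_inj; rewrite /= gact1. Qed.
Fact augIdeal_actM g h u :
  augIdeal_act (g * h)%g u = augIdeal_act g (augIdeal_act h u).
Proof. by apply: val_inj; rewrite /= gactM. Qed.
Fact augIdeal_actB g : zmod_morphism (augIdeal_act g).
Proof. by move=> u v; apply: val_inj; rewrite /= raddfB. Qed.
HB.instance Definition _ :=
  Zmodule_isGModule.Build gT augIdeal augIdeal_act1 augIdeal_actM augIdeal_actB.
End GroupRing.

Section Hom.
Variables (gT : finGroupType) (X A : gmodType gT).

Definition additive_pred : {pred X -> A} := fun f => `[< zmod_morphism f >].

Fact additive_pred_zmod_closed : zmod_closed additive_pred.
Proof.
split=> [|f h /asboolP fB /asboolP hB]; apply/asboolP => x y.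
  by rewrite subr0.
by rewrite /= !fctE fB hB opprD addrACA -opprD.
Qed.
HB.instance Definition _ :=
  GRing.isZmodClosed.Build (X -> A) additive_pred additive_pred_zmod_closed.

Record homZ := HomZ {
  hom_fun :> X -> A;
  hom_funP : hom_fun \in additive_pred
}.
HB.instance Definition _ := [isSub for hom_fun].
HB.instance Definition _ := [Choice of homZ by <:].
HB.instance Definition _ := [SubChoice_isSubZmodule of homZ by <:].

Lemma homZ_is_zmod_morphism (f : homZ) : zmod_morphism f.
Proof. exact/asboolP/(hom_funP f). Qed.
HB.instance Definition _ (f : homZ) :=
  GRing.isZmodMorphism.Build X A f (homZ_is_zmod_morphism f).

End Hom.
Section HomGModule.
Variables (gT : finGroupType) (X A : gmodType gT).

Fact homZ_act_subproof (g : gT) (f : homZ X A) :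
  (fun x => gact g (f (gact g^-1%g x))) \in @additive_pred gT X A.
Proof. by apply/asboolP => x y; rewrite !raddfB. Qed.
Definition homZ_act g f : homZ X A := HomZ (homZ_act_subproof g f).

Fact homZ_act1 f : homZ_act 1%g f = f.
Proof. by apply/val_inj/funext => x /=; rewrite invg1 !gact1. Qed.
Fact homZ_actM g h f : homZ_act (g * h)%g f = homZ_act g (homZ_act h f).
Proof. by apply/val_inj/funext => x /=; rewrite invMg !gactM. Qed.
Fact homZ_actB g : zmod_morphism (homZ_act g).
Proof. by move=> f h; apply/val_inj/funext => x /=; rewrite !fctE /= raddfB. Qed.
HB.instance Definition _ :=
  Zmodule_isGModule.Build gT (homZ X A) homZ_act1 homZ_actM homZ_actB.

End HomGModule.

Section HomMap.
Variables (gT : finGroupType) (X A B : gmodType gT) (h : ghom A B).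

Fact homZ_map_subproof (f : homZ X A) : h \o f \in @additive_pred gT X B.
Proof. by apply/asboolP => x y /=; rewrite !raddfB. Qed.
Definition homZ_map_fun f : homZ X B := HomZ (homZ_map_subproof f).

Fact homZ_mapB : zmod_morphism homZ_map_fun.
Proof. by move=> f k; apply/val_inj/funext => x /=; rewrite !fctE /= raddfB. Qed.
Fact homZ_mapJ g f : homZ_map_fun (gact g f) = gact g (homZ_map_fun f).
Proof. by apply/val_inj/funext => x /=; rewrite ghomJ. Qed.
Definition homZ_map : ghom (homZ X A) (homZ X B) := GHom homZ_mapB homZ_mapJ.

End HomMap.

Definition biadditive (A B C : zmodType) (f : A -> B -> C) :=
  (forall b, zmod_morphism (f^~ b)) /\ (forall a, zmod_morphism (f a)).

Section Tensor.
Variables (gT : finGroupType) (A B : gmodType gT).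

Inductive tensor_rel : {freeg (A * B) / int} -> Prop :=
  | TensorRel0 : tensor_rel 0
  | TensorRelB u v of tensor_rel u & tensor_rel v : tensor_rel (u - v)
  | TensorRelDl a a' b :
      tensor_rel (<< (a + a', b) >> - << (a, b) >> - << (a', b) >>)
  | TensorRelDr a b b' :
      tensor_rel (<< (a, b + b') >> - << (a, b) >> - << (a, b') >>).

Definition tensor_ker : {pred {freeg (A * B) / int}} :=
  fun u => `[< tensor_rel u >].

Fact tensor_ker_zmod_closed : zmod_closed tensor_ker.
Proof.
split=> [|u v /asboolP uP /asboolP vP]; apply/asboolP.
  exact: TensorRel0.
exact: TensorRelB.
Qed.
HB.instance Definition _ :=
  GRing.isZmodClosed.Build {freeg (A * B) / int} tensor_ker
    tensor_ker_zmod_closed.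

(* The free abelian group on A * B modulo the subgroup tensor_ker generated by
   the biadditivity relations. *)
Definition tensor : Type := Quotient.quot tensor_ker.
HB.instance Definition _ := GRing.Zmodule.on tensor.

Definition tpure (a : A) (b : B) : tensor :=
  \pi_(Quotient.quot tensor_ker) << (a, b) >>.

(* The representative is immaterial when f is biadditive: see tliftE. *)
Definition tlift (C : zmodType) (f : A -> B -> C) (t : tensor) : C :=
  fglift (fun ab => f ab.1 ab.2 : zmodule C) (repr (t : Quotient.quot tensor_ker)).

End Tensor.

Section TensorTheory.
Variables (gT : finGroupType) (A B : gmodType gT).
Local Notation F := {freeg (A * B) / int}.
Local Notation T := (tensor A B).
Local Notation Q := (Quotient.quot (@tensor_ker gT A B)).

Definition tpi (u : F) : T := \pi_Q u.

Fact tpi_is_zmod_morphism : zmod_morphism tpi.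
Proof. by move=> u v; rewrite /tpi raddfB. Qed.
HB.instance Definition _ :=
  GRing.isZmodMorphism.Build F T tpi tpi_is_zmod_morphism.

Lemma tpi_eq0 u : tpi u = 0 <-> tensor_rel u.
Proof.
have -> : (0 : T) = tpi 0 by rewrite raddf0.
split=> [/eqP|uP]; last apply/eqP.
  by rewrite -Quotient.idealrBE subr0 => /asboolP.
by rewrite -Quotient.idealrBE subr0; apply/asboolP.
Qed.

Lemma tpureE (a : A) (b : B) : tpure a b = tpi << (a, b) >>.
Proof. by []. Qed.

Lemma tpureDl (a a' : A) (b : B) :
  tpure (a + a') b = tpure a b + tpure a' b.
Proof.
have /tpi_eq0 := TensorRelDl a a' b; rewrite !raddfB /= => /eqP.
by rewrite !subr_eq add0r [X in _ == X]addrC => /eqP.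
Qed.

Lemma tpureDr (a : A) (b b' : B) :
  tpure a (b + b') = tpure a b + tpure a b'.
Proof.
have /tpi_eq0 := TensorRelDr a b b'; rewrite !raddfB /= => /eqP.
by rewrite !subr_eq add0r [X in _ == X]addrC => /eqP.
Qed.

Lemma tpureBl b : zmod_morphism (fun a : A => tpure a b : T).
Proof.
move=> x y; apply/eqP; rewrite eq_sym subr_eq -tpureDl subrK; exact/eqP.
Qed.

Lemma tpureBr a : zmod_morphism (tpure a : B -> T).
Proof.
move=> x y; apply/eqP; rewrite eq_sym subr_eq -tpureDr subrK; exact/eqP.
Qed.

HB.instance Definition _ (a : A) :=
  GRing.isZmodMorphism.Build B T (tpure a) (tpureBr a).

Lemma tpure0l b : tpure 0 b = 0 :> T.
Proof. by have := tpureBl b 0 0; rewrite !subrr. Qed.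

Lemma tpureNl a b : tpure (- a) b = - tpure a b :> T.
Proof. by have := tpureBl b 0 a; rewrite !sub0r tpure0l sub0r. Qed.

Lemma tpure_suml (I : Type) (r : seq I) (P : pred I) (E : I -> A) (b : B) :
  tpure (\sum_(i <- r | P i) E i) b = \sum_(i <- r | P i) tpure (E i) b.
Proof.
by apply: (big_morph (fun a : A => tpure a b : T)) => [x y|]; rewrite (tpureDl, tpure0l).
Qed.

Lemma tpure_sumr (I : Type) (r : seq I) (P : pred I) (E : I -> B) (a : A) :
  tpure a (\sum_(i <- r | P i) E i) = \sum_(i <- r | P i) tpure a (E i).
Proof. exact: raddf_sum. Qed.

Lemma tensor_ind (P : T -> Prop) :
  P 0 -> (forall u v, P u -> P v -> P (u - v)) ->
  (forall a b, P (tpure a b)) -> forall t, P t.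
Proof.
move=> P0 PB Pp t; rewrite -[t](reprK (t : Q)) -/(tpi _).
have PN u : P u -> P (- u) by move=> Pu; rewrite -sub0r; exact: PB.
have PD u v : P u -> P v -> P (u + v).
  by move=> Pu Pv; rewrite -[v]opprK; apply/PB => //; exact: PN.
have PM u n : P u -> P (u *+ n).
  by move=> Pu; elim: n => [|k IH]; rewrite ?mulr0n ?mulrS //; exact: PD.
rewrite -(freeg_sumE (repr _)) raddf_sum /=; apply: (big_ind P) => //.
move=> [a b] _; rewrite -[X in << X *g _ >>]intz -freegU_mulz raddfMz /=.
by case: (coeff _ _) => n; rewrite ?NegzE ?mulrNz -?pmulrn;
  [|apply: PN]; apply/PM/Pp.
Qed.

Section Lift.
Variables (C : zmodType) (f : A -> B -> C).
Hypothesis fP : biadditive f.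
Let fg := fun ab : A * B => f ab.1 ab.2 : zmodule C.

Let fglift_rel u : tensor_rel u -> fglift fg u = 0.
Proof.
have fgB := lift_is_additive fg.
have fgU a b : fglift fg << (a, b) >> = f a b by rewrite liftU scale1r.
have fg0 : fglift fg 0 = 0 by have := fgB 0 0; rewrite !subrr.
case: fP => fBl fBr.
have fD (h : A -> C) : zmod_morphism h -> {morph h : x y / x + y}.
  by move=> hB x y; apply/eqP; rewrite -subr_eq -hB addrK.
have gD (h : B -> C) : zmod_morphism h -> {morph h : x y / x + y}.
  by move=> hB x y; apply/eqP; rewrite -subr_eq -hB addrK.
elim=> {u} [|u v _ u0 _ v0|a a' b|a b b'] //.
- by rewrite fgB u0 v0 subrr.
- by rewrite !fgB !fgU (fD _ (fBl b)) /= -addrA -opprD subrr.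
- by rewrite !fgB !fgU (gD _ (fBr a)) /= -addrA -opprD subrr.
Qed.

Lemma tlift_tpi u : tlift f (tpi u) = fglift fg u.
Proof.
have fgB := lift_is_additive fg.
apply/eqP; rewrite -subr_eq0 /tlift -/fg -fgB; apply/eqP/fglift_rel.
by apply/tpi_eq0; rewrite raddfB /= /tpi reprK subrr.
Qed.

Lemma tliftE a b : tlift f (tpure a b) = f a b.
Proof. by rewrite tpureE tlift_tpi liftU scale1r. Qed.

Lemma tliftB : zmod_morphism (tlift f).
Proof.
move=> t u; rewrite -[t](reprK (t : Q)) -[u](reprK (u : Q)) -!/(tpi _).
by rewrite -raddfB /= !tlift_tpi (lift_is_additive fg).
Qed.
End Lift.

Lemma tensor_ext (C : zmodType) (f h : T -> C) :
  zmod_morphism f -> zmod_morphism h ->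
  (forall a b, f (tpure a b) = h (tpure a b)) -> f =1 h.
Proof.
move=> fB hB fh; apply: tensor_ind => // [|u v fu fv].
  by have := fB 0 0; have := hB 0 0; rewrite !subrr => -> ->.
by rewrite fB hB fu fv.
Qed.

Definition tact (g : gT) : T -> T :=
  tlift (fun a b => tpure (gact g a) (gact g b)).

Fact tact_biadditive g :
  biadditive (fun a b => tpure (gact g a) (gact g b) : T).
Proof. by split=> [b x y|a x y]; rewrite !raddfB /= ?tpureBl. Qed.

Lemma tactE g a b : tact g (tpure a b) = tpure (gact g a) (gact g b).
Proof. exact/tliftE/tact_biadditive. Qed.

Fact tactB g : zmod_morphism (tact g).
Proof. exact/tliftB/tact_biadditive. Qed.
Fact tact1 t : tact 1%g t = t.
Proof.
by move: t; apply: tensor_ext => // [|a b]; [exact: tactB|rewrite tactE !gact1].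
Qed.
Fact tactM g h t : tact (g * h)%g t = tact g (tact h t).
Proof.
move: t; apply: tensor_ext => [|u v|a b]; first exact: tactB.
  by rewrite !tactB.
by rewrite !tactE !gactM.
Qed.
HB.instance Definition _ := Zmodule_isGModule.Build gT T tact1 tactM tactB.

Lemma gact_tpure g a b :
  gact g (tpure a b : T) = tpure (gact g a) (gact g b).
Proof. exact: tactE. Qed.
End TensorTheory.

Section TensorLiftG.
Variables (gT : finGroupType) (A B C : gmodType gT) (f : A -> B -> C).
Hypothesis fB : biadditive f.
Hypothesis fJ : forall g a b, f (gact g a) (gact g b) = gact g (f a b).

Fact tliftJ g t : tlift f (gact g t) = gact g (tlift f t).
Proof.
move: t; apply: tensor_ext => [u v|u v|a b].
- by rewrite raddfB tliftB.
- by rewrite tliftB // raddfB.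
- by rewrite gact_tpure !tliftE.
Qed.
Definition tlift_ghom : ghom (tensor A B) C := GHom (tliftB fB) tliftJ.
End TensorLiftG.

Section TensorMap.
Variables (gT : finGroupType) (X X' A A' : gmodType gT).

Section Def.
Variables (h : X -> X') (k : A -> A').
Hypotheses (hB : zmod_morphism h) (kB : zmod_morphism k).
Definition tmap : tensor X A -> tensor X' A' :=
  tlift (fun x a => tpure (h x) (k a)).

Lemma tmap_biadditive : biadditive (fun x a => tpure (h x) (k a)).
Proof. by split=> [b x y|a x y]; rewrite (hB, kB) (tpureBl, tpureBr). Qed.

Lemma tmapE x a : tmap (tpure x a) = tpure (h x) (k a).
Proof. exact/tliftE/tmap_biadditive. Qed.

Lemma tmapB : zmod_morphism tmap.
Proof. exact/tliftB/tmap_biadditive. Qed.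
End Def.
End TensorMap.

Section TensorGMap.
Variables (gT : finGroupType) (X A B : gmodType gT) (h : ghom A B).

Fact tensor_mapJ g (t : tensor X A) :
  tmap id h (gact g t) = gact g (tmap id h t : tensor X B).
Proof.
have idB : zmod_morphism (@id X) by [].
have hB := ghomB h.
apply: tliftJ => [|k x a]; first exact: tmap_biadditive.
by rewrite gact_tpure ghomJ.
Qed.
Definition tensor_map : ghom (tensor X A) (tensor X B) :=
  GHom (tmapB (fun _ _ => erefl) (ghomB h)) tensor_mapJ.
End TensorGMap.

Section Composition.
Variables (gT : finGroupType) (A B C : gmodType gT).

Fact hcomp_subproof (f : homZ B C) (h : homZ A B) :
  f \o h \in @additive_pred gT A C.
Proof. by apply/asboolP => x y /=; rewrite !raddfB. Qed.
Definition hcomp (f : homZ B C) (h : homZ A B) : homZ A C :=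
  HomZ (hcomp_subproof f h).

Fact hcomp_biadditive : biadditive hcomp.
Proof.
split=> [h f f'|f h h']; apply/val_inj/funext => x //=.
by rewrite !fctE /= raddfB.
Qed.

Fact hcompJ g f h : hcomp (gact g f) (gact g h) = gact g (hcomp f h).
Proof. by apply/val_inj/funext => x /=; rewrite gactK. Qed.

Definition comp_ghom : ghom (tensor (homZ B C) (homZ A B)) (homZ A C) :=
  tlift_ghom hcomp_biadditive hcompJ.
End Composition.

Section Evaluation.
Variables (gT : finGroupType) (X' X A : gmodType gT).

Definition heval (f : homZ X' X) : tensor X' A -> tensor X A := tmap f id.

Lemma hevalE f x a : heval f (tpure x a) = tpure (f x) a.
Proof. by rewrite /heval tmapE //; exact: homZ_is_zmod_morphism. Qed.

Let hevalBr (f : homZ X' X) : zmod_morphism (heval f).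
Proof. by apply: tmapB => //; exact: homZ_is_zmod_morphism. Qed.

Fact heval_biadditive : biadditive heval.
Proof.
split=> [t f f'|]; last exact: hevalBr.
rewrite -[RHS]/((fun t => heval f t - heval f' t) t); move: t.
apply: tensor_ext => [|u v|x a]; first exact: hevalBr.
  by rewrite !hevalBr opprD addrACA -opprD.
by rewrite !hevalE -tpureBl.
Qed.

Fact hevalJ g f t : heval (gact g f) (gact g t) = gact g (heval f t).
Proof.
move: t; apply: tensor_ext => [u v|u v|x a].
- by rewrite raddfB /= hevalBr.
- by rewrite hevalBr raddfB.
- by rewrite gact_tpure !hevalE gact_tpure /= gactK.
Qed.

Definition eval_ghom :
    ghom (tensor (homZ X' X) (tensor X' A)) (tensor X A) :=
  tlift_ghom heval_biadditive hevalJ.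
End Evaluation.

(* The first power is M (x) Z rather than M itself. *)
Fixpoint tensor_pow (gT : finGroupType) (M : gmodType gT) (n : nat) :
    gmodType gT :=
  if n is k.+1 then tensor M (tensor_pow M k) : gmodType gT
  else trivZ gT : gmodType gT.

Section TateCochain.
Variable gT : finGroupType.
Implicit Types (n p q : int) (s t : seq gT).

(* Tate cohomology is computed with the standard complete resolution P of Z:
     P_n = Z[G^(n+1)] for n >= 0,  P_(-n) = Hom(P_(n-1), Z) = Z[G^n] for n >= 1,
   the basis G^n of P_(-n) being dual to the basis G^n of P_(n-1), with
     d(g_0, ..., g_n) = \sum_i (-1)^i (g_0, ..., ^g_i, ..., g_n)     (n >= 1),
     d(g_0) = \sum_u (u),
     d(g_1, ..., g_n) = \sum_u \sum_(i <= n) (-1)^i (g_1, ..., g_i, u, g_(i+1),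
                                                   ..., g_n)
                                            (from P_(-n) to P_(-n-1), n >= 1).
   A cochain of degree n with values in A is then an equivariant function on
   the sequences of length clen n, and its coboundary is its composite with d;
   note that Negz k is the degree - k.+1. *)
Definition clen n : nat := match n with Posz k => k.+1 | Negz k => k.+1 end.

Section Differential.
Variable A : zmodType.
Implicit Type f : seq gT -> A.

Definition diff_del f s : A :=
  \sum_(i < size s) f (take i s ++ drop i.+1 s) *~ (-1) ^+ i.

Definition diff_ins f s : A :=
  \sum_(i < (size s).+1) \sum_(u : gT) f (take i s ++ u :: drop i s) *~ (-1) ^+ i.

Definition rdiff n f s : A :=
  match n with
  | Posz _ => diff_del f s
  | Negz 0 => \sum_(u : gT) f [:: u]
  | Negz _.+1 => diff_ins f s
  end.

Lemma mulrz_sgnS (x : A) k : x *~ (-1) ^+ k.+1 = - (x *~ (-1) ^+ k).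
Proof. by rewrite exprS mulN1r mulrNz. Qed.

Lemma diff_del_nil f : diff_del f [::] = 0.
Proof. by rewrite /diff_del big_ord0. Qed.

Lemma diff_del_cons f x s :
  diff_del f (x :: s) = f s - diff_del (fun t => f (x :: t)) s.
Proof.
rewrite /diff_del /= big_ord_recl /= drop0 expr0 mulr1z -sumrN; congr (_ + _).
by apply: eq_bigr => i _; rewrite /= mulrz_sgnS.
Qed.

Lemma diff_ins_nil f : diff_ins f [::] = \sum_(u : gT) f [:: u].
Proof.
by rewrite /diff_ins big_ord1; apply: eq_bigr => u _; rewrite mulr1z.
Qed.

Lemma diff_ins_cons f x s :
  diff_ins f (x :: s) =
    \sum_(u : gT) f (u :: x :: s) - diff_ins (fun t => f (x :: t)) s.
Proof.
rewrite /diff_ins /= big_ord_recl /= -sumrN; congr (_ + _).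
apply: eq_bigr => i _; rewrite -sumrN.
by apply: eq_bigr => u _; rewrite /= mulrz_sgnS.
Qed.

Lemma eq_diff_del f h s :
  (forall t, (size t).+1 = size s -> f t = h t) -> diff_del f s = diff_del h s.
Proof.
elim: s f h => [|x s IH] f h fh; first by rewrite !diff_del_nil.
rewrite !diff_del_cons fh //; congr (_ - _); apply: IH => t ts.
by apply: fh; rewrite /= ts.
Qed.

Lemma eq_diff_ins f h s :
  (forall t, size t = (size s).+1 -> f t = h t) -> diff_ins f s = diff_ins h s.
Proof.
elim: s f h => [|x s IH] f h fh.
  by rewrite !diff_ins_nil; apply: eq_bigr => u _; exact: fh.
rewrite !diff_ins_cons; congr (_ - _).
  by apply: eq_bigr => u _; exact: fh.
by apply: IH => t ts; apply: fh; rewrite /= ts.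
Qed.

Lemma diff_del_cat f s t :
  diff_del f (s ++ t) = diff_del (fun s' => f (s' ++ t)) s
                      + diff_del (fun t' => f (s ++ t')) t *~ (-1) ^+ size s.
Proof.
elim: s f => [|x s IH] f; first by rewrite diff_del_nil add0r mulr1z.
rewrite cat_cons !diff_del_cons IH opprD addrA; congr (_ + _).
by rewrite mulrz_sgnS.
Qed.

Lemma diff_ins_cat f s x t :
  diff_ins f (s ++ x :: t) = diff_ins (fun s' => f (s' ++ x :: t)) s
    - diff_ins (fun t' => f (s ++ x :: t')) t *~ (-1) ^+ size s.
Proof.
elim: s f => [|y s IH] f; first by rewrite diff_ins_cons diff_ins_nil mulr1z.
rewrite cat_cons !diff_ins_cons IH opprB addrA mulrz_sgnS opprK /=.
by rewrite -addrA [X in _ + X]addrC addrA.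
Qed.

Lemma diff_del_rev f s :
  diff_del (fun t => f (rev t)) s = - (diff_del f (rev s) *~ (-1) ^+ size s).
Proof.
elim: s f => [|x s IH] f; first by rewrite !diff_del_nil mul0rz oppr0.
rewrite diff_del_cons rev_cons -cats1 diff_del_cat /=.
under eq_diff_del do rewrite rev_cons -cats1.
rewrite (IH (fun t => f (t ++ [:: x]))) mulrz_sgnS !opprK size_rev.
rewrite diff_del_cons diff_del_nil subr0 cats0 mulrzDl addrC; congr (_ + _).
by rewrite -mulrzA -expr2 sqrr_sign mulr1z.
Qed.

Lemma diff_ins_rev f s :
  diff_ins (fun t => f (rev t)) s = diff_ins f (rev s) *~ (-1) ^+ size s.
Proof.
elim: s f => [|x s IH] f; first by rewrite !diff_ins_nil mulr1z.
rewrite diff_ins_cons rev_cons -cats1 diff_ins_cat /=.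
under eq_bigr do rewrite !rev_cons -!cats1 -catA.
under eq_diff_ins do rewrite rev_cons -cats1.
rewrite (IH (fun t => f (t ++ [:: x]))) mulrz_sgnS size_rev.
rewrite diff_ins_nil mulrzBl opprB; congr (_ - _).
by rewrite -mulrzA -expr2 sqrr_sign mulr1z.
Qed.

Lemma rdiff_rev n f s : size s = clen (n + 1) ->
  rdiff n (fun t => f (rev t)) s = rdiff n f (rev s) *~ (-1) ^+ `|n + 1|.
Proof.
case: n => [n|[|n]].
- rewrite -PoszD addn1 => ss; rewrite /= diff_del_rev ss -mulrNz.
  by rewrite [in LHS]exprS mulN1r opprK.
- by rewrite /= expr0 mulr1z => _; apply: eq_bigr.
- rewrite (_ : Negz n.+1 + 1 = Negz n); last lia.
  by move=> /= ss; rewrite diff_ins_rev ss.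
Qed.

Lemma diff_delB f h s :
  diff_del (fun t => f t - h t) s = diff_del f s - diff_del h s.
Proof.
by rewrite /diff_del -sumrB; apply: eq_bigr => i _; rewrite mulrzBl.
Qed.

Lemma diff_insB f h s :
  diff_ins (fun t => f t - h t) s = diff_ins f s - diff_ins h s.
Proof.
rewrite /diff_ins -sumrB; apply: eq_bigr => i _; rewrite -sumrB.
by apply: eq_bigr => u _; rewrite mulrzBl.
Qed.

Lemma diff_ins_sum (F : gT -> seq gT -> A) s :
  diff_ins (fun t => \sum_u F u t) s = \sum_u diff_ins (F u) s.
Proof.
rewrite /diff_ins [RHS]exchange_big; apply: eq_bigr => i _.
rewrite [RHS]exchange_big; apply: eq_bigr => u _; exact: mulrz_suml.
Qed.

Lemma rdiffB n f h s : rdiff n (fun t => f t - h t) s = rdiff n f s - rdiff n h s.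
Proof.
by case: n => [n|[|n]]; [exact: diff_delB|exact: sumrB|exact: diff_insB].
Qed.

Lemma diff_del_sq f s : diff_del (diff_del f) s = 0.
Proof.
elim: s f => [|x s IH] f; first by rewrite diff_del_nil.
rewrite diff_del_cons.
under [X in _ - X]eq_diff_del do rewrite diff_del_cons.
by rewrite diff_delB IH subr0 subrr.
Qed.

Lemma diff_ins_sq f s : diff_ins (diff_ins f) s = 0.
Proof.
have E x t h : \sum_u diff_ins h (u :: x :: t) =
    \sum_u diff_ins (fun v => h (u :: x :: v)) t.
  under eq_bigr do rewrite !diff_ins_cons opprB addrCA.
  rewrite big_split /= -[RHS]addr0; congr (_ + _).
  by rewrite sumrB exchange_big subrr.
elim: s f => [|x s IH] f.
  rewrite diff_ins_nil; under eq_bigr do rewrite diff_ins_cons diff_ins_nil.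
  by rewrite sumrB exchange_big subrr.
rewrite diff_ins_cons E.
under [X in _ - X]eq_diff_ins do rewrite diff_ins_cons.
by rewrite diff_insB IH subr0 diff_ins_sum subrr.
Qed.

Lemma rdiff_sq n f s : size s = clen (n + 2) ->
  rdiff (n + 1) (rdiff n f) s = 0.
Proof.
case: n => [n|[|[|n]]].
- by rewrite -PoszD addn1 => _; exact: diff_del_sq.
- case: s => // x [|y []] // _.
  by rewrite /= !diff_del_cons diff_del_nil subr0 subrr.
- rewrite /= => _; under eq_bigr do rewrite diff_ins_cons diff_ins_nil.
  by rewrite sumrB exchange_big subrr.
- rewrite (_ : Negz n.+2 + 1 = Negz n.+1); last lia.
  by move=> _; exact: diff_ins_sq.
Qed.

End Differential.

Lemma raddf_rdiff (A B : zmodType) (k : {additive A -> B}) n f s :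
  rdiff n (fun t => k (f t)) s = k (rdiff n f s).
Proof.
case: n => [n|[|n]]; rewrite /= raddf_sum //; apply: eq_bigr => i _.
  by rewrite raddfMz.
by rewrite raddf_sum; apply: eq_bigr => u _; rewrite raddfMz.
Qed.

Section TupleSum.
Variable A : zmodType.

Definition tsum k (F : seq gT -> A) : A := \sum_(t : k.-tuple gT) F t.

Lemma tsum0 F : tsum 0 F = F [::].
Proof.
rewrite /tsum (big_pred1 [tuple]) // => t; apply/esym/eqP; exact: tuple0.
Qed.

Lemma tsumS k F : tsum k.+1 F = \sum_(u : gT) tsum k (fun t => F (u :: t)).
Proof.
rewrite /tsum pair_big /=.
rewrite (reindex (fun ut : gT * k.-tuple gT => [tuple of ut.1 :: ut.2])) //=.
exists (fun t : k.+1.-tuple gT => (thead t, [tuple of behead t])) => [[u t]|t] _ /=.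
  by congr (_, _); apply: val_inj.
by rewrite [t in RHS]tuple_eta; apply: val_inj.
Qed.

Lemma eq_tsum k F F' :
  (forall t, size t = k -> F t = F' t) -> tsum k F = tsum k F'.
Proof. by move=> FF'; apply: eq_bigr => t _; rewrite FF' ?size_tuple. Qed.

Lemma tsumB k F F' : tsum k (fun t => F t - F' t) = tsum k F - tsum k F'.
Proof. exact: sumrB. Qed.

Lemma tsumD k F F' : tsum k (fun t => F t + F' t) = tsum k F + tsum k F'.
Proof. exact: big_split. Qed.

Lemma tsumMz k F (z : int) : tsum k (fun t => F t *~ z) = tsum k F *~ z.
Proof. exact: esym (mulrz_suml _ _ _ _). Qed.

Lemma tsum_sum k I (r : seq I) (F : I -> seq gT -> A) :
  tsum k (fun t => \sum_(i <- r) F i t) = \sum_(i <- r) tsum k (F i).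
Proof. exact: exchange_big. Qed.
Lemma tsum_mulg k F (g : gT) :
  tsum k (fun t => F [seq (g * x)%g | x <- t]) = tsum k F.
Proof.
elim: k F => [|k IH] F; first by rewrite !tsum0.
rewrite !tsumS /= [RHS](reindex_inj (mulgI g)) /=.
by apply: eq_bigr => u _; rewrite (IH (fun t => F (_ :: t))).
Qed.
End TupleSum.

Section Cup.
Variables (A B C : zmodType) (m : A -> B -> C).

(* Composition with the Atiyah-Wall complete diagonal approximation
   P_(p+q) -> P_p (x) P_q (Cassels-Froehlich, Algebraic Number Theory, IV.7);
   s has length clen (p + q) > 0, so that head and last do not use their
   default.  The Leibniz rule is rcup_leibniz. *)
Definition rcup p q (f : seq gT -> A) (h : seq gT -> B) s : C :=
  match p, q with
  | Posz a, Posz b => m (f (take a.+1 s)) (h (drop a s))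
  | Negz a, Negz b => m (f (take a.+1 s)) (h (drop a.+1 s))
  | Posz a, Negz b =>
      if (b < a)%N then \sum_(t : b.+1.-tuple gT) m (f (s ++ t)) (h (rev t))
      else \sum_(t : a.-tuple gT) m (f (head 1%g s :: t)) (h (rev t ++ s))
  | Negz a, Posz b =>
      if (a < b)%N then \sum_(t : a.+1.-tuple gT) m (f t) (h (rev t ++ s))
      else \sum_(t : b.-tuple gT) m (f (s ++ t)) (h (rcons (rev t) (last 1%g s)))
  end.
End Cup.

Lemma last_rev (T : Type) (x : T) (r : seq T) : last x (rev r) = head x r.
Proof. by case: r => //= y r; rewrite rev_cons last_rcons. Qed.

Lemma head_rev (T : Type) (x : T) (r : seq T) : head x (rev r) = last x r.
Proof. by rewrite -last_rev revK. Qed.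

Lemma rcup_rev (A B C : zmodType) (m : A -> B -> C) p q f h s :
  size s = clen (p + q) ->
  rcup m p q f h s =
  rcup (fun x y => m y x) q p (fun t => h (rev t)) (fun t => f (rev t)) (rev s).
Proof.
case: p q => [a|a] [b|b] /= ss.
- rewrite take_rev drop_rev !revK ss.
  by congr (m (f (take _ _)) (h (drop _ _))); lia.
- case: ifP => _; apply: eq_bigr => t _.
    by rewrite rev_cat !revK.
  by rewrite rev_cat rev_rcons !revK last_rev.
- case: ifP => _; apply: eq_bigr => t _.
    by rewrite rev_cat !revK.
  by rewrite rev_cat rev_cons !revK head_rev.
- rewrite take_rev drop_rev !revK ss.
  by congr (m (f (take _ _)) (h (drop _ _))); lia.
Qed.

Section Leibniz.
Variables (A B C : zmodType) (m : A -> B -> C).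
Hypotheses (mBl : forall y, zmod_morphism (m^~ y))
           (mBr : forall x, zmod_morphism (m x)).
Implicit Types (f : seq gT -> A) (h : seq gT -> B).

Let ml x : {additive B -> C} :=
  HB.pack (m x) (GRing.isZmodMorphism.Build B C (m x) (mBr x)).
Let mr y : {additive A -> C} :=
  HB.pack (m^~ y) (GRing.isZmodMorphism.Build A C (m^~ y) (mBl y)).

Let mNr x y : m x (- y) = - m x y. Proof. exact: (raddfN (ml x)). Qed.
Let mBr' x y z : m x (y - z) = m x y - m x z.
Proof. exact: (raddfB (ml x)). Qed.
Let mDr x y z : m x (y + z) = m x y + m x z.
Proof. exact: (raddfD (ml x)). Qed.
Let mNl x y : m (- x) y = - m x y. Proof. exact: (raddfN (mr y)). Qed.
Let mBl' x y z : m (x - y) z = m x z - m y z.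
Proof. exact: (raddfB (mr z)). Qed.
Let mDl x y z : m (x + y) z = m x z + m y z.
Proof. exact: (raddfD (mr z)). Qed.
Let mMl x y (k : int) : m (x *~ k) y = m x y *~ k.
Proof. exact: (raddfMz (mr y)). Qed.
Let mMr x y (k : int) : m x (y *~ k) = m x y *~ k.
Proof. exact: (raddfMz (ml x)). Qed.

Let m_suml (I : Type) (r : seq I) (E : I -> A) y :
  m (\sum_(i <- r) E i) y = \sum_(i <- r) m (E i) y.
Proof. exact: (raddf_sum (mr y)). Qed.
Let m_sumr (I : Type) (r : seq I) (E : I -> B) x :
  m x (\sum_(i <- r) E i) = \sum_(i <- r) m x (E i).
Proof. exact: (raddf_sum (ml x)). Qed.

Let m_diff_del_l f s y : m (diff_del f s) y = diff_del (fun t => m (f t) y) s.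
Proof. by rewrite /diff_del m_suml; apply: eq_bigr => i _; rewrite mMl. Qed.
Let m_diff_del_r h s x : m x (diff_del h s) = diff_del (fun t => m x (h t)) s.
Proof. by rewrite /diff_del m_sumr; apply: eq_bigr => i _; rewrite mMr. Qed.
Let m_diff_ins_l f s y : m (diff_ins f s) y = diff_ins (fun t => m (f t) y) s.
Proof.
rewrite /diff_ins m_suml; apply: eq_bigr => i _; rewrite m_suml.
by apply: eq_bigr => u _; rewrite mMl.
Qed.
Let m_diff_ins_r h s x : m x (diff_ins h s) = diff_ins (fun t => m x (h t)) s.
Proof.
rewrite /diff_ins m_sumr; apply: eq_bigr => i _; rewrite m_sumr.
by apply: eq_bigr => u _; rewrite mMr.
Qed.

Let contract b f h :
  tsum b.+1 (fun t => m (diff_del f t) (h (rev t))) =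
  tsum b (fun t => m (f t) (diff_ins h (rev t))) *~ (-1) ^+ b.
Proof.
elim: b f h => [|b IH] f h.
  rewrite tsumS tsum0 diff_ins_nil m_sumr mulr1z.
  apply: eq_bigr => u _; rewrite tsum0.
  by rewrite diff_del_cons diff_del_nil subr0.
transitivity (\sum_u (tsum b.+1 (fun t => m (f t) (h (rcons (rev t) u)))
  - tsum b (fun t => m (f (u :: t)) (diff_ins (fun v => h (v ++ [:: u])) (rev t)))
    *~ (-1) ^+ b)).
  rewrite tsumS; apply: eq_bigr => u _; rewrite -IH -tsumB.
  apply: eq_tsum => t _.
  by rewrite diff_del_cons mBl' rev_cons cats1.
rewrite [in RHS]tsumS sumrB.
transitivity ((\sum_u tsum b (fun t =>
    m (f (u :: t)) (diff_ins (fun v => h (v ++ [:: u])) (rev t))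
  - m (f (u :: t)) (\sum_v h (rev (u :: t) ++ [:: v])) *~ (-1) ^+ b))
    *~ (-1) ^+ b.+1); last first.
  congr (_ *~ _); apply: eq_bigr => u _; apply: eq_tsum => t tb.
  rewrite rev_cons -cats1 diff_ins_cat mBr' diff_ins_nil mMr size_rev tb.
  by congr (_ - m _ _ *~ _); apply: eq_bigr => v _; rewrite -catA.
under [in RHS]eq_bigr do rewrite tsumB tsumMz.
rewrite !sumrB -!mulrz_suml
  mulrzBl !mulrz_sgnS.
rewrite -mulrzA -expr2 sqrr_sign mulr1z opprK [RHS]addrC; congr (_ - _).
rewrite -tsum_sum.
rewrite -(tsumS _ (fun t => m (f t) (\sum_v h (rev t ++ [:: v])))).
apply: eq_tsum => t _; rewrite m_sumr.
by apply: eq_bigr => u _; rewrite cats1.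
Qed.

Let tsum_diff_del k (F : seq gT -> seq gT -> C) s :
  tsum k (fun t => diff_del (F t) s) = diff_del (fun v => tsum k (F^~ v)) s.
Proof.
by rewrite /diff_del tsum_sum; apply: eq_bigr => i _; rewrite tsumMz.
Qed.

Let tsum_diff_ins k (F : seq gT -> seq gT -> C) s :
  tsum k (fun t => diff_ins (F t) s) = diff_ins (fun v => tsum k (F^~ v)) s.
Proof.
rewrite /diff_ins tsum_sum; apply: eq_bigr => i _.
by rewrite tsum_sum; apply: eq_bigr => u _; rewrite tsumMz.
Qed.

Let leibniz_del b f h s :
  diff_del (fun v => tsum b.+1 (fun t => m (f (v ++ t)) (h (rev t)))) s =
  tsum b.+1 (fun t => m (diff_del f (s ++ t)) (h (rev t)))
  - tsum b (fun t => m (f (s ++ t)) (diff_ins h (rev t)))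
      *~ (-1) ^+ (size s + b).
Proof.
apply/eqP; rewrite eq_sym subr_eq; apply/eqP.
rewrite exprD mulrC mulrzA -(contract b (fun t => f (s ++ t))) -tsumMz.
rewrite -tsum_diff_del -tsumD; apply: eq_tsum => t _.
by rewrite diff_del_cat mDl mMl m_diff_del_l.
Qed.

Let leibniz_ins a f h x s :
  diff_ins (fun v => tsum a (fun t => m (f (head 1%g v :: t)) (h (rev t ++ v))))
    (x :: s) =
  tsum a.+1 (fun t => m (diff_del f (x :: t)) (h (rev t ++ x :: s)))
  + tsum a (fun t => m (f (x :: t)) (diff_ins h (rev t ++ x :: s)))
      *~ (-1) ^+ a.
Proof.
rewrite diff_ins_cons /= -tsum_diff_ins.
transitivity (tsum a.+1 (fun t => m (f t) (h (rev t ++ x :: s)))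
  - tsum a.+1 (fun t => m (diff_del (fun t' => f (x :: t')) t)
                          (h (rev t ++ x :: s)))
  + (tsum a (fun t => m (f (x :: t))
               (diff_ins (fun v => h (v ++ x :: s)) (rev t)))
    - tsum a (fun t => m (f (x :: t))
               (diff_ins (fun v => h (rev t ++ x :: v)) s)) *~ (-1) ^+ a)
     *~ (-1) ^+ a); last first.
  rewrite -tsumB -tsumMz -tsumB; congr (_ + _ *~ _); apply: eq_tsum => t ta.
    by rewrite diff_del_cons mBl'.
  by rewrite diff_ins_cat mBr' mMr size_rev ta.
rewrite (contract a (fun t => f (x :: t)) (fun v => h (v ++ x :: s))).
rewrite mulrzBl -mulrzA -expr2 sqrr_sign mulr1z addrA subrK; congr (_ - _).
  rewrite tsumS; apply: eq_bigr => u _; apply: eq_tsum => t _.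
  by rewrite rev_cons cat_rcons.
by apply: eq_tsum => t _; rewrite m_diff_ins_r.
Qed.

Let leibniz_pp (a b : nat) f h s : size s = (a + b).+2 ->
  diff_del (rcup m a b f h) s =
  rcup m a.+1 b (diff_del f) h s + rcup m a b.+1 f (diff_del h) s *~ (-1) ^+ a.
Proof.
move=> ss; rewrite -[s](cat_take_drop a.+1).
have : size (drop a.+1 s) = b.+1 by rewrite size_drop ss; lia.
have : size (take a.+1 s) = a.+1 by rewrite size_takel // ss; lia.
move: (take _ _) (drop _ _) => v w sv sw {ss}.
case: (lastP v) sv => // v0 y; rewrite size_rcons => -[sv0].
case: w sw => // z w0 [sw0].
rewrite diff_del_cat /= size_rcons sv0.
under eq_diff_del => t.
  rewrite size_rcons => -[]; rewrite sv0 => ts.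
  have -> : take a.+1 (t ++ z :: w0) = t ++ [:: z].
    by rewrite -cat_rcons -cats1 takel_cat ?take_oversize ?size_cat /= ?ts ?addn1.
  rewrite drop_size_cat //.
over.
rewrite -(m_diff_del_l (fun t => f (t ++ [:: z]))).
under [X in _ + X *~ _]eq_diff_del => t _.
  rewrite take_size_cat ?size_rcons ?sv0 // cat_rcons drop_size_cat //.
over.
rewrite -(m_diff_del_r (fun t => h (y :: t))).
have -> : take a.+2 (rcons v0 y ++ z :: w0) = rcons v0 y ++ [:: z].
  rewrite -cat_rcons -cats1 takel_cat ?take_oversize ?size_cat ?size_rcons /=;
  by rewrite ?sv0 ?addn1.
rewrite diff_del_cat (diff_del_cons _ z [::]) diff_del_nil subr0 cats0.
rewrite size_rcons sv0 drop_size_cat ?size_rcons ?sv0 //.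
rewrite take_size_cat ?size_rcons ?sv0 // cat_rcons drop_size_cat //.
rewrite (diff_del_cons h) mDl mBr' mMl mulrzBl !mulrz_sgnS.
by rewrite addrA subrK.
Qed.

Let leibniz_nn (a b : nat) f h s : size s = (a + b).+1 ->
  diff_ins (rcup m (Negz a) (Negz b) f h) s =
  m (diff_ins f (take a s)) (h (drop a s)) +
  m (f (take a.+1 s)) (diff_ins h (drop a.+1 s)) *~ (-1) ^+ a.+1.
Proof.
move=> ss; rewrite -[s](cat_take_drop a).
have : size (drop a s) = b.+1 by rewrite size_drop ss; lia.
have : size (take a s) = a by rewrite size_takel // ss; lia.
move: (take _ _) (drop _ _) => v w sv sw {ss}.
case: w sw => // x w0 [sw0].
rewrite diff_ins_cat /= sv take_size_cat // drop_size_cat // mulrz_sgnS.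
under eq_diff_ins => t.
  rewrite sv => ts; rewrite take_size_cat // drop_size_cat //.
over.
rewrite -m_diff_ins_l; congr (_ - _ *~ _).
have sx : size (rcons v x) = a.+1 by rewrite size_rcons sv.
rewrite -cat_rcons take_size_cat // drop_size_cat //.
under eq_diff_ins do rewrite -cat_rcons take_size_cat // drop_size_cat //.
by rewrite -m_diff_ins_r.
Qed.

Let rcup_pn (a b : nat) f h s :
  rcup m a (Negz b) f h s =
  if (b < a)%N then tsum b.+1 (fun t => m (f (s ++ t)) (h (rev t)))
  else tsum a (fun t => m (f (head 1%g s :: t)) (h (rev t ++ s))).
Proof. by []. Qed.

Let PoszS (a : nat) : (a : int) + 1 = a.+1. Proof. lia. Qed.
Let NegzS (a : nat) : Negz a.+1 + 1 = Negz a. Proof. lia. Qed.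

Lemma leibniz_posneg (a b : nat) f h s : size s = clen (a%:Z + Negz b + 1) ->
  rdiff (a%:Z + Negz b) (rcup m a (Negz b) f h) s =
  rcup m (a%:Z + 1) (Negz b) (rdiff a f) h s
  + rcup m a (Negz b + 1) f (rdiff (Negz b) h) s *~ (-1) ^+ a.
Proof.
rewrite PoszS.
have rhs2 t : (b <= a)%N -> size t = (a - b).+1 ->
    rcup m a (Negz b + 1) f (rdiff (Negz b) h) t =
    tsum b (fun v => m (f (t ++ v)) (diff_ins h (rev v))).
  case: b => [|b] ba st.
    rewrite /= take_oversize ?st ?subn0 // tsum0 cats0.
    by rewrite diff_ins_nil.
  by rewrite NegzS rcup_pn ba.
have [ba|ab|ab] := ltngtP b a.
- rewrite (_ : a%:Z + Negz b = (a - b.+1)%N); last lia.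
  rewrite PoszS => ss; rewrite rcup_pn ltnS (ltnW ba) rhs2 ?(ltnW ba) //; last first.
    by rewrite ss /=; lia.
  rewrite [LHS](_ : _ = diff_del
    (fun v => tsum b.+1 (fun t => m (f (v ++ t)) (h (rev t)))) s); last first.
    by apply: eq_diff_del => t _; rewrite rcup_pn ba.
  rewrite leibniz_del -mulrNz; congr (_ + _ *~ _).
  rewrite ss /= (_ : ((a - b.+1).+2 + b)%N = a.+1); last lia.
  by rewrite exprS mulN1r opprK.
- rewrite (_ : a%:Z + Negz b = Negz (b - a)%N); last lia.
  have [c bE] : exists c, b = (a + c).+1 by exists (b - a).-1; lia.
  rewrite (_ : (_ - a)%N = c.+1); last lia.
  rewrite NegzS => ss; case: s ss => // x s [ss].
  rewrite [LHS](_ : _ = diff_ins (fun v =>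
    tsum a (fun t => m (f (head 1%g v :: t)) (h (rev t ++ v)))) (x :: s));
    last first.
    by apply: eq_diff_ins => t _; rewrite rcup_pn ltnNge (ltnW ab).
  rewrite leibniz_ins rcup_pn ltnS leqNgt ab bE NegzS rcup_pn.
  by rewrite ltnNge leq_addr.
- subst a; rewrite (_ : b%:Z + Negz b = -1); last lia.
  rewrite addNr => ss; case: s ss => // x [] // ss.
  rewrite rcup_pn ltnS leqnn rhs2 ?subnn //.
  have := leibniz_del b f h [:: x].
  rewrite diff_del_cons diff_del_nil subr0 add1n -mulrNz exprS mulN1r opprK.
  move=> <-; rewrite [RHS]tsumS; apply: eq_bigr => u _.
  rewrite rcup_pn ltnn; apply: eq_tsum => t _.
  by rewrite rev_cons cats1.
Qed.

Lemma leibniz_pospos (a b : nat) f h s : size s = clen (a%:Z + b + 1) ->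
  rdiff (a%:Z + b) (rcup m a b f h) s =
  rcup m (a%:Z + 1) b (rdiff a f) h s
  + rcup m a (b%:Z + 1) f (rdiff b h) s *~ (-1) ^+ a.
Proof.
rewrite -PoszD !PoszS => ss; exact: leibniz_pp.
Qed.

Lemma leibniz_negneg (a b : nat) f h s :
  size s = clen (Negz a + Negz b + 1) ->
  rdiff (Negz a + Negz b) (rcup m (Negz a) (Negz b) f h) s =
  rcup m (Negz a + 1) (Negz b) (rdiff (Negz a) f) h s
  + rcup m (Negz a) (Negz b + 1) f (rdiff (Negz b) h) s *~ (-1) ^+ a.+1.
Proof.
rewrite (_ : Negz a + Negz b = Negz (a + b).+1); last lia.
rewrite NegzS => ss; rewrite [LHS]leibniz_nn //; congr (_ + _ *~ _).
  case: a ss => [|a] ss; last by rewrite NegzS.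
  rewrite rcup_pn ltn0 tsum0 take0 drop0 /=.
  by rewrite diff_ins_nil.
case: b ss => [|b] ss; last by rewrite NegzS.
rewrite /= -/(tsum 0 (fun t => m (f (s ++ t)) _)) tsum0 cats0.
by rewrite take_oversize ?drop_oversize ?ss /= ?addn0 // diff_ins_nil.
Qed.

End Leibniz.

Lemma eq_rdiff (A : zmodType) n (f h : seq gT -> A) s :
  (forall t, size t = clen n -> f t = h t) -> size s = clen (n + 1) ->
  rdiff n f s = rdiff n h s.
Proof.
case: n => [n|[|n]] fh ss.
- apply: eq_diff_del => t; rewrite ss => ts; apply: fh.
  by move: ts; rewrite -PoszD addn1 => -[].
- by apply: eq_bigr => u _; exact: fh.
- apply: eq_diff_ins => t; rewrite ss => ts; apply: fh; rewrite ts.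
  by rewrite (_ : Negz n.+1 + 1 = Negz n) //; lia.
Qed.

Lemma eq_rcup (A B C : zmodType) (m : A -> B -> C) p q f f' h h' s :
  (forall t, size t = clen p -> f t = f' t) ->
  (forall t, size t = clen q -> h t = h' t) -> size s = clen (p + q) ->
  rcup m p q f h s = rcup m p q f' h' s.
Proof.
case: p q => [a|a] [b|b] ff hh ss.
- have {}ss : size s = (a + b).+1 by [].
  by rewrite /= ff ?hh //= ?size_drop ?size_takel ?ss //; lia.
- rewrite /=; case: ifP => ab.
    have {}ss : size s = (a - b.+1).+1.
      by rewrite ss (_ : a%:Z + Negz b = (a - b.+1)%N) //; lia.
    apply: eq_bigr => t _.
    by rewrite ff ?hh // ?size_rev ?size_cat size_tuple ?ss /=; lia.
  have {}ss : size s = (b - a).+1.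
    by rewrite ss (_ : a%:Z + Negz b = Negz (b - a)) //; lia.
  apply: eq_bigr => t _.
  by rewrite ff ?hh //= ?size_cat ?size_rev size_tuple ?ss /=; lia.
- rewrite /=; case: ifP => ab.
    have {}ss : size s = (b - a.+1).+1.
      by rewrite ss (_ : Negz a + b = (b - a.+1)%N) //; lia.
    apply: eq_bigr => t _.
    by rewrite ff ?hh // ?size_cat ?size_rev size_tuple ?ss /=; lia.
  have {}ss : size s = (a - b).+1.
    by rewrite ss (_ : Negz a + b = Negz (a - b)) //; lia.
  apply: eq_bigr => t _.
  by rewrite ff ?hh //= ?size_cat ?size_rcons ?size_rev size_tuple ?ss /=; lia.
- have {}ss : size s = (a + b).+2.
    by rewrite ss (_ : Negz a + Negz b = Negz (a + b).+1) //; lia.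
  by rewrite /= ff ?hh //= ?size_drop ?size_takel ?ss //; lia.
Qed.

Lemma rcupBl (A B C : zmodType) (m : A -> B -> C) p q f f' h s :
  biadditive m ->
  rcup m p q (fun t => f t - f' t) h s =
  rcup m p q f h s - rcup m p q f' h s.
Proof.
case=> mB _; case: p q => [a|a] [b|b] /=; try exact: mB.
  by case: ifP => _; rewrite -sumrB; apply: eq_bigr => t _; exact: mB.
by case: ifP => _; rewrite -sumrB; apply: eq_bigr => t _; exact: mB.
Qed.

Lemma rcupBr (A B C : zmodType) (m : A -> B -> C) p q f h h' s :
  biadditive m ->
  rcup m p q f (fun t => h t - h' t) s =
  rcup m p q f h s - rcup m p q f h' s.
Proof.
case=> _ mB; case: p q => [a|a] [b|b] /=; try exact: mB.
  by case: ifP => _; rewrite -sumrB; apply: eq_bigr => t _; exact: mB.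
by case: ifP => _; rewrite -sumrB; apply: eq_bigr => t _; exact: mB.
Qed.

Lemma rcup0l (A B C : zmodType) (m : A -> B -> C) p q h s :
  biadditive m -> rcup m p q (fun=> 0) h s = 0.
Proof.
move=> mP; have := rcupBl p q (fun=> 0) (fun=> 0) h s mP.
by rewrite subrr subr0.
Qed.

Lemma rcup0r (A B C : zmodType) (m : A -> B -> C) p q f s :
  biadditive m -> rcup m p q f (fun=> 0) s = 0.
Proof.
move=> mP; have := rcupBr p q f (fun=> 0) (fun=> 0) s mP.
by rewrite subrr subr0.
Qed.

Lemma rcup_sgnl (A B C : zmodType) (m : A -> B -> C) p q f h s k :
  biadditive m ->
  rcup m p q (fun t => f t *~ (-1) ^+ k) h s = rcup m p q f h s *~ (-1) ^+ k.
Proof.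
move=> mP; rewrite -signr_odd; case: odd; rewrite (expr0, expr1).
  rewrite mulrN1z -[RHS]sub0r -(rcup0l p q h s mP) -rcupBl //.
  by congr rcup; apply/funext => t; rewrite mulrN1z sub0r.
by rewrite mulr1z; congr rcup; apply/funext => t; rewrite mulr1z.
Qed.

Lemma rcup_sgnr (A B C : zmodType) (m : A -> B -> C) p q f h s k :
  biadditive m ->
  rcup m p q f (fun t => h t *~ (-1) ^+ k) s = rcup m p q f h s *~ (-1) ^+ k.
Proof.
move=> mP; rewrite -signr_odd; case: odd; rewrite (expr0, expr1).
  rewrite mulrN1z -[RHS]sub0r -(rcup0r p q f s mP) -rcupBr //.
  by congr rcup; apply/funext => t; rewrite mulrN1z sub0r.
by rewrite mulr1z; congr rcup; apply/funext => t; rewrite mulr1z.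
Qed.

Lemma sgn_eq k l : odd k = odd l -> (-1) ^+ k = (-1) ^+ l :> int.
Proof. by move=> kl; rewrite -signr_odd kl signr_odd. Qed.

Lemma rcup_leibniz (A B C : zmodType) (m : A -> B -> C) :
  biadditive m -> forall p q f h s, size s = clen (p + q + 1) ->
  rdiff (p + q) (rcup m p q f h) s =
  rcup m (p + 1) q (rdiff p f) h s
  + rcup m p (q + 1) f (rdiff q h) s *~ (-1) ^+ `|p|%N.
Proof.
move=> mP; have [mBl mBr] := mP; case=> [a|a] [b|b] f h s ss.
- exact: leibniz_pospos.
- exact: leibniz_posneg.
- pose m' y x := m x y; have m'P : biadditive m' by split.
  have mBl' : forall x, zmod_morphism (m'^~ x) by exact: mBr.
  have mBr' : forall y, zmod_morphism (m' y) by exact: mBl.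
  set p := Negz a; set q := Posz b.
  have ss1 : size s = clen (p + 1 + q) by rewrite addrAC.
  have ss2 : size s = clen (p + (q + 1)) by rewrite addrA.
  rewrite (eq_rdiff (h := fun t => rcup m' q p (fun u => h (rev u))
    (fun u => f (rev u)) (rev t))) //; last by move=> t; exact: rcup_rev.
  rewrite rdiff_rev // (addrC p q) leibniz_posneg //; last first.
    by rewrite size_rev ss (addrC p q).
  rewrite (rcup_rev _ _ _ ss1) (rcup_rev _ _ _ ss2).
  rewrite (eq_rcup m' (p := q + 1) (f' := fun t => rdiff q h (rev t) *~
    (-1) ^+ `|q + 1|) (h' := fun u => f (rev u))) //; first last.
  + by rewrite size_rev ss2 addrC.
  + by move=> t; exact: rdiff_rev.
  rewrite (eq_rcup m' (q := p + 1) (f' := fun t => h (rev t)) (h' := fun u => 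
    rdiff p f (rev u) *~ (-1) ^+ `|p + 1|)) //; first last.
  + by rewrite size_rev ss1 addrC.
  + by move=> t; exact: rdiff_rev.
  rewrite rcup_sgnl // rcup_sgnr // [RHS]addrC mulrzDl -!mulrzA.
  congr (_ *~ _ + _).
    by rewrite -exprD; apply: sgn_eq; lia.
  rewrite -[RHS]mulr1z; congr (_ *~ _).
  by rewrite -!exprD -[RHS](expr0 (-1)); apply: sgn_eq; lia.
- exact: leibniz_negneg.
Qed.

End TateCochain.

Section TateCohomology.
Variable gT : finGroupType.
Implicit Types (n p q : int) (s t : seq gT).

Section Defs.
Variables (n : int) (A : gmodType gT).

Definition tdiff m (f : seq gT -> A) s : A :=
  if size s == clen (m + 1) then rdiff m f s else 0.

(* Cochains of degree m are extended by 0 to sequences of other lengths, so that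
   a cochain is determined by its values on sequences of length clen m. *)
Definition cochain m (f : seq gT -> A) : Prop :=
  (forall s, size s != clen m -> f s = 0) /\
  (forall g s, f [seq (g * x)%g | x <- s] = gact g (f s)).

Definition cocycle : {pred seq gT -> A} :=
  fun f => `[< cochain n f /\ tdiff n f = 0 >].

Lemma tdiffB m f h : tdiff m (f - h) = tdiff m f - tdiff m h.
Proof.
apply/funext => s; rewrite !fctE /tdiff; case: ifP => _; last by rewrite subr0.
exact: rdiffB.
Qed.

Lemma cochainB m f h : cochain m f -> cochain m h -> cochain m (f - h).
Proof.
move=> [f0 fJ] [h0 hJ]; split=> [s ss|g s]; rewrite !fctE.
  by rewrite f0 // h0 // subr0.
by rewrite fJ hJ raddfB.
Qed.

Lemma cochain0 m : cochain m 0.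
Proof. by split=> // g s; rewrite raddf0. Qed.

Lemma tdiff0 m : tdiff m 0 = 0.
Proof. by rewrite -[0 in LHS](subrr 0) tdiffB subrr. Qed.

Lemma tdiff_sq m f : tdiff (m + 1) (tdiff m f) = 0.
Proof.
apply/funext => s; rewrite /tdiff; case: ifP => // /eqP ss.
rewrite (eq_rdiff (h := rdiff m f)) //; last by move=> t ->; rewrite eqxx.
by rewrite rdiff_sq // ss -addrA.
Qed.

Lemma cochain_tdiff m f : cochain m f -> cochain (m + 1) (tdiff m f).
Proof.
move=> [_ fJ]; split=> [s /negPf ss|g s]; rewrite /tdiff ?ss //.
rewrite size_map; case: ifP => _; last by rewrite raddf0.
case: m => [m|[|m]]; rewrite /= raddf_sum.
- rewrite /diff_del size_map; apply: eq_bigr => i _.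
  by rewrite -map_take -map_drop -map_cat fJ raddfMz.
- by rewrite (reindex_inj (mulgI g)); apply: eq_bigr => u _; exact: (fJ g [:: u]).
- rewrite /diff_ins size_map; apply: eq_bigr => i _.
  rewrite raddf_sum (reindex_inj (mulgI g)); apply: eq_bigr => u _.
  by rewrite raddfMz -map_take -map_drop -(map_cons (mulg g)) -map_cat fJ.
Qed.

Fact cocycle_zmod_closed : zmod_closed cocycle.
Proof.
split=> [|f h /asboolP[fC f0] /asboolP[hC h0]]; apply/asboolP; split.
- exact: cochain0.
- exact: tdiff0.
- exact: cochainB.
- by rewrite tdiffB f0 h0 subrr.
Qed.
HB.instance Definition _ :=
  GRing.isZmodClosed.Build (seq gT -> A) cocycle cocycle_zmod_closed.

Lemma tdiff_cocycle h : cochain (n - 1) h -> tdiff (n - 1) h \in cocycle.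
Proof.
move=> hC; apply/asboolP; have := tdiff_sq (n - 1) h.
by have := cochain_tdiff hC; rewrite subrK.
Qed.

Record tate_cocycle := TateCocycle {
  cocycle_fun :> seq gT -> A;
  cocycle_funP : cocycle_fun \in cocycle
}.
HB.instance Definition _ := [isSub for cocycle_fun].
HB.instance Definition _ := [Choice of tate_cocycle by <:].
HB.instance Definition _ := [SubChoice_isSubZmodule of tate_cocycle by <:].

Definition coboundary : {pred tate_cocycle} :=
  fun z => `[< exists2 h, cochain (n - 1) h & val z = tdiff (n - 1) h >].

Fact coboundary_zmod_closed : zmod_closed coboundary.
Proof.
split=> [|z w /asboolP[f fC zE] /asboolP[h hC wE]]; apply/asboolP.
  by exists 0; [exact: cochain0|rewrite tdiff0].
by exists (f - h); [exact: cochainB|rewrite tdiffB -zE -wE].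
Qed.
HB.instance Definition _ :=
  GRing.isZmodClosed.Build tate_cocycle coboundary coboundary_zmod_closed.

Definition tateH : Type := Quotient.quot coboundary.
HB.instance Definition _ := GRing.Zmodule.on tateH.

Definition tclass (z : tate_cocycle) : tateH := \pi_(Quotient.quot coboundary) z.
Definition trepr (x : tateH) : tate_cocycle := repr (x : Quotient.quot coboundary).

Lemma treprK : cancel trepr tclass.
Proof. exact: reprK. Qed.

Fact tclass_is_zmod_morphism : zmod_morphism tclass.
Proof. by move=> z w; rewrite /tclass raddfB. Qed.
HB.instance Definition _ :=
  GRing.isZmodMorphism.Build tate_cocycle tateH tclass tclass_is_zmod_morphism.

Lemma tclass_eq z w : tclass z = tclass w <->
  exists2 h, cochain (n - 1) h & (z : seq gT -> A) - w = tdiff (n - 1) h.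
Proof.
split=> [/eqP|E]; last apply/eqP; rewrite -Quotient.idealrBE.
  by move=> /asboolP.
exact/asboolP.
Qed.

Lemma cocycleP (z : tate_cocycle) : cochain n z /\ tdiff n z = 0.
Proof. exact/asboolP/(cocycle_funP z). Qed.

End Defs.

Section Map.
Variables (n : int) (A B : gmodType gT) (k : ghom A B).

Lemma tdiff_ghom m (f : seq gT -> A) : tdiff m (k \o f) = k \o tdiff m f.
Proof.
apply/funext => s; rewrite /tdiff /=; case: ifP => _; last by rewrite raddf0.
exact: (raddf_rdiff k).
Qed.

Lemma cochain_ghom m (f : seq gT -> A) : cochain m f -> cochain m (k \o f).
Proof.
move=> [f0 fJ]; split=> [s ss|g s] /=; first by rewrite f0 // raddf0.
by rewrite fJ ghomJ.
Qed.

Fact cocycle_map_subproof (z : tate_cocycle n A) : k \o z \in @cocycle n B.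
Proof.
have [zC z0] := cocycleP z; apply/asboolP; split; first exact: cochain_ghom.
by rewrite tdiff_ghom z0; apply/funext => s /=; rewrite raddf0.
Qed.
Definition cocycle_map z : tate_cocycle n B := TateCocycle (cocycle_map_subproof z).

(* Independent of the representative by tate_mapE. *)
Definition tate_map (x : tateH n A) : tateH n B := tclass (cocycle_map (trepr x)).

Lemma tate_mapE z : tate_map (tclass z) = tclass (cocycle_map z).
Proof.
have /tclass_eq[h hC E] := treprK (tclass z).
apply/tclass_eq; exists (k \o h); first exact: cochain_ghom.
by rewrite tdiff_ghom -E; apply/funext => s /=; rewrite !fctE /= raddfB.
Qed.

Fact tate_mapB : zmod_morphism tate_map.
Proof.
move=> x y; rewrite -[x]treprK -[y]treprK -raddfB !tate_mapE -raddfB.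
by congr tclass; apply/val_inj/funext => s /=; rewrite !fctE /= raddfB.
Qed.
HB.instance Definition _ :=
  GRing.isZmodMorphism.Build (tateH n A) (tateH n B) tate_map tate_mapB.
End Map.

Lemma tate_map_id n (A : gmodType gT) : tate_map (n := n) (ghom_id A) =1 id.
Proof.
move=> x; rewrite -[x]treprK tate_mapE.
by congr tclass; exact/val_inj.
Qed.

Lemma tate_map_comp n (A B C : gmodType gT) (k : ghom B C) (l : ghom A B) :
  tate_map (n := n) (ghom_comp k l) =1 tate_map k \o tate_map l.
Proof.
move=> x; rewrite -[x]treprK /= !tate_mapE.
by congr tclass; exact/val_inj.
Qed.

Definition tate_cast (A : gmodType gT) n n' (e : n = n') :
  tateH n A -> tateH n' A := let: erefl := e in id.

Section ZeroClass.
Variables (X A : gmodType gT) (f : ghom X A).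

Fact ghom_homZ_subproof : (f : X -> A) \in @additive_pred gT X A.
Proof. by apply/asboolP; exact: ghomB. Qed.
Definition ghom_homZ : homZ X A := HomZ ghom_homZ_subproof.

Lemma ghom_homZ_inv g : gact g ghom_homZ = ghom_homZ.
Proof. by apply/val_inj/funext => x /=; rewrite -ghomJ gactVK. Qed.

(* H^0(G, M) is M^G / N_G M by evaluation of cocycles at a sequence of length
   one: degree 0 cocycles are the constant functions with value in M^G. For
   M = Hom(X, A) the class [f] is that of the constant function f; see
   ghom_class_eq0 for its vanishing. *)
Fact ghom_cocycle_subproof :
  (fun s : seq gT => if size s == 1%N then ghom_homZ else 0)
    \in @cocycle 0 (homZ X A).
Proof.
apply/asboolP; split; first split=> [s /negPf->|g s] //.
  by rewrite size_map; case: ifP; rewrite (ghom_homZ_inv, raddf0).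
apply/funext => s; rewrite /tdiff; case: ifP => //.
case: s => // x [|y []] // _.
by rewrite /= !diff_del_cons diff_del_nil subr0 subrr.
Qed.

Definition ghom_class : tateH 0 (homZ X A) :=
  tclass (TateCocycle ghom_cocycle_subproof).

Lemma ghom_class_eq0 : ghom_class = 0 <->
  exists k : homZ X A, ghom_homZ = \sum_(g : gT) gact g k.
Proof.
have -> : (0 : tateH 0 (homZ X A)) = tclass 0 by rewrite raddf0.
split.
  case/tclass_eq => h [h0 hJ] /(congr1 (fun k => k [:: 1%g])).
  rewrite !fctE /= subr0 /tdiff /= => ->; exists (h [:: 1%g]).
  by apply: eq_bigr => g _; rewrite -hJ /= mulg1.
case=> k kE; apply/tclass_eq.
exists (fun s => if s is [:: x] then gact x k else 0).
  split=> [[|x []] //|g [|x []]] /=; rewrite ?raddf0 //.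
  by rewrite gactM.
rewrite [X in _ - X](_ : _ = 0) // subr0.
by apply/funext => s; rewrite /tdiff /= kE.
Qed.
End ZeroClass.

Section Cup.
Variables (A B : gmodType gT).

Fact tpure_biadditive : biadditive (@tpure gT A B).
Proof. by split=> [b|a]; [exact: tpureBl|exact: tpureBr]. Qed.

Definition cochain_cup p q (f : seq gT -> A) (h : seq gT -> B) s : tensor A B :=
  if size s == clen (p + q) then rcup (@tpure gT A B) p q f h s else 0.

Lemma clen_gt0 n : (0 < clen n)%N.
Proof. by case: n. Qed.

Lemma cochain_cupP p q f h : cochain p f -> cochain q h ->
  cochain (p + q) (cochain_cup p q f h).
Proof.
move=> [_ fJ] [_ hJ]; split=> [s /negPf|g s]; rewrite /cochain_cup.
  by move=> ->.
rewrite size_map; case: ifP => [/eqP ss|_]; last by rewrite raddf0.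
have s0 : (0 < size s)%N by rewrite ss clen_gt0.
have hd : head 1%g [seq (g * x)%g | x <- s] = (g * head 1 s)%g by case: s s0 {ss}.
have lt : last 1%g [seq (g * x)%g | x <- s] = (g * last 1 s)%g.
  by case: s s0 {ss hd} => //= x s _; rewrite (last_map (mulg g)).
case: p q {ss} => [a|a] [b|b]; rewrite /= ?raddf_sum.
- by rewrite -map_take -map_drop fJ hJ -?gact_tpure.
- case: ifP => _; rewrite raddf_sum.
    rewrite -[LHS](tsum_mulg _ (fun t => tpure (f ([seq (g * x)%g | x <- s] ++ t)) (h (rev t))) g); apply: eq_bigr => t _.
    by rewrite -map_cat -map_rev fJ hJ -?gact_tpure.
  rewrite -[LHS](tsum_mulg _ (fun t => tpure (f (head 1%g [seq (g * x)%g | x <- s] :: t)) (h (rev t ++ [seq (g * x)%g | x <- s]))) g); apply: eq_bigr => t _.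
  by rewrite hd -map_rev -map_cat -(map_cons (mulg g)) fJ hJ -?gact_tpure.
- case: ifP => _; rewrite raddf_sum.
    rewrite -[LHS](tsum_mulg _ (fun t => tpure (f t) (h (rev t ++ [seq (g * x)%g | x <- s]))) g); apply: eq_bigr => t _.
    by rewrite -map_rev -map_cat fJ hJ -?gact_tpure.
  rewrite -[LHS](tsum_mulg _ (fun t => tpure (f ([seq (g * x)%g | x <- s] ++ t)) (h (rcons (rev t) (last 1%g [seq (g * x)%g | x <- s])))) g); apply: eq_bigr => t _.
  by rewrite lt -map_rev -map_rcons -map_cat fJ hJ -?gact_tpure.
- by rewrite -map_take -map_drop fJ hJ -?gact_tpure.
Qed.

Lemma tdiff_cup p q f h :
  tdiff (p + q) (cochain_cup p q f h) =
  cochain_cup (p + 1) q (tdiff p f) h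
  + (fun s => cochain_cup p (q + 1) f (tdiff q h) s *~ (-1) ^+ `|p|%N).
Proof.
apply/funext => s; rewrite !fctE /tdiff /cochain_cup addrA (addrAC p 1).
case: ifP => [/eqP ss|_]; last by rewrite mul0rz addr0.
rewrite (eq_rdiff (h := rcup (@tpure gT A B) p q f h)) //; last first.
  by move=> t ->; rewrite eqxx.
rewrite rcup_leibniz //; last exact: tpure_biadditive.
congr (_ + _ *~ _); apply: eq_rcup => //.
- by move=> t ->; rewrite eqxx.
- by rewrite ss; congr clen; lia.
- by move=> t ->; rewrite eqxx.
- by rewrite ss; congr clen; lia.
Qed.

Lemma cochain_cup0l p q h : cochain_cup p q 0 h = 0.
Proof.
apply/funext => s; rewrite /cochain_cup; case: ifP => // _.
exact/rcup0l/tpure_biadditive.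
Qed.

Lemma cochain_cup0r p q f : cochain_cup p q f 0 = 0.
Proof.
apply/funext => s; rewrite /cochain_cup; case: ifP => // _.
exact/rcup0r/tpure_biadditive.
Qed.

Lemma cochain_cupBl p q f f' h :
  cochain_cup p q (f - f') h = cochain_cup p q f h - cochain_cup p q f' h.
Proof.
apply/funext => s; rewrite !fctE /cochain_cup.
case: ifP => _; last by rewrite subr0.
exact/rcupBl/tpure_biadditive.
Qed.

Lemma cochain_cupBr p q f h h' :
  cochain_cup p q f (h - h') = cochain_cup p q f h - cochain_cup p q f h'.
Proof.
apply/funext => s; rewrite !fctE /cochain_cup.
case: ifP => _; last by rewrite subr0.
exact/rcupBr/tpure_biadditive.
Qed.

Fact cocycle_cup_subproof p q (z : tate_cocycle p A) (w : tate_cocycle q B) :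
  cochain_cup p q z w \in @cocycle (p + q) (tensor A B).
Proof.
have [[zC z0] [wC w0]] := (cocycleP z, cocycleP w).
apply/asboolP; split; first exact: cochain_cupP.
rewrite tdiff_cup z0 w0 cochain_cup0l cochain_cup0r add0r.
by apply/funext => s; rewrite mul0rz.
Qed.
Definition cocycle_cup p q z w : tate_cocycle (p + q) (tensor A B) :=
  TateCocycle (@cocycle_cup_subproof p q z w).

(* Independent of the representatives by cupE. *)
Definition cup p q (x : tateH p A) (y : tateH q B) : tateH (p + q) (tensor A B) :=
  tclass (cocycle_cup (trepr x) (trepr y)).

Lemma cupE p q (z : tate_cocycle p A) (w : tate_cocycle q B) :
  cup (tclass z) (tclass w) = tclass (cocycle_cup z w).
Proof.
rewrite /cup; set z' := trepr _; set w' := trepr _.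
transitivity (tclass (cocycle_cup z' w)); apply/tclass_eq.
  have /tclass_eq[h hC E] := treprK (tclass w).
  exists (fun s => cochain_cup p (q - 1) z' h s *~ (-1) ^+ `|p|%N).
    have [] := cochain_cupP (cocycleP z').1 hC; rewrite addrA => c0 cJ.
    split=> [s ss|g s]; first by rewrite c0 // mul0rz.
    by rewrite cJ raddfMz.
  rewrite -cochain_cupBr E; apply/funext => s.
  have := congr1 (fun f => f s) (tdiff_cup p (q - 1) z' h).
  rewrite !fctE (cocycleP z').2 cochain_cup0l add0r subrK addrA.
  rewrite /tdiff; case: ifP => ss.
    move=> H.
    have -> : rdiff (p + q - 1) (fun t => cochain_cup p (q - 1) z' h t *~ (-1) ^+ `|p|%N) s
      = rdiff (p + q - 1) (cochain_cup p (q - 1) z' h) s *~ (-1) ^+ `|p|%N.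
      have mB : zmod_morphism (fun x : tensor A B => x *~ (-1) ^+ `|p|%N).
        by move=> x y; rewrite mulrzBl.
      pose mH := GRing.isZmodMorphism.Build _ _ _ mB.
      pose mA : {additive tensor A B -> tensor A B} := HB.pack (fun x : tensor A B => x *~ (-1) ^+ `|p|%N) mH.
      exact: (raddf_rdiff mA).
    by rewrite H -mulrzA -expr2 sqrr_sign mulr1z.
  by rewrite subrK in ss *; rewrite /cochain_cup ss.
have /tclass_eq[h hC E] := treprK (tclass z).
exists (cochain_cup (p - 1) q h w).
  by have := cochain_cupP hC (cocycleP w).1; rewrite addrAC.
rewrite -cochain_cupBl E.
have := tdiff_cup (p - 1) q h w.
rewrite (cocycleP w).2 cochain_cup0r subrK (addrAC p) => ->.
by apply/funext => s; rewrite !fctE mul0rz addr0.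
Qed.

Lemma cupBl p q (y : tateH q B) : zmod_morphism (fun x : tateH p A => cup x y).
Proof.
move=> x x'; rewrite -[x]treprK -[x']treprK -[y]treprK -raddfB !cupE -raddfB.
by congr tclass; apply/val_inj; exact: cochain_cupBl.
Qed.

Lemma cupBr p q (x : tateH p A) : zmod_morphism (cup x : tateH q B -> _).
Proof.
move=> y y'; rewrite -[x]treprK -[y]treprK -[y']treprK -raddfB !cupE -raddfB.
by congr tclass; apply/val_inj; exact: cochain_cupBr.
Qed.
End Cup.
End TateCohomology.

Section Functors.
Variable gT : finGroupType.

Record ab_functor := AbFunctor {
  fobj :> gmodType gT -> zmodType;
  fmap : forall A B : gmodType gT, ghom A B -> fobj A -> fobj B;
  fmapB : forall (A B : gmodType gT) (k : ghom A B), zmod_morphism (fmap k);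
  fmap_id : forall A : gmodType gT, fmap (ghom_id A) =1 id;
  fmap_comp : forall (A B C : gmodType gT) (k : ghom B C) (l : ghom A B),
    fmap (ghom_comp k l) =1 fmap k \o fmap l
}.

Definition is_nat_iso (F F' : ab_functor) (phi : forall A, F A -> F' A) : Prop :=
  [/\ forall A, zmod_morphism (phi A),
      forall A, bijective (phi A)
    & forall (A B : gmodType gT) (k : ghom A B) (x : F A),
        phi B (fmap k x) = fmap k (phi A x)].

Lemma eq_tate_map n (A B : gmodType gT) (k l : ghom A B) :
  k =1 l -> tate_map (n := n) k =1 tate_map l.
Proof.
move=> kl x; congr tclass; apply/val_inj/funext => s; exact: kl.
Qed.

Section HomTate.
Variables (n : int) (X : gmodType gT).

Fact homTate_id (A : gmodType gT) :
  tate_map (n := n) (homZ_map X (ghom_id A)) =1 id.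
Proof.
move=> x; rewrite -[RHS](tate_map_id x); apply: eq_tate_map => f.
exact/val_inj.
Qed.

Fact homTate_comp (A B C : gmodType gT) (k : ghom B C) (l : ghom A B) :
  tate_map (n := n) (homZ_map X (ghom_comp k l)) =1
  tate_map (homZ_map X k) \o tate_map (homZ_map X l).
Proof.
move=> x; rewrite -[RHS](tate_map_comp _ _ x); apply: eq_tate_map => f.
exact/val_inj.
Qed.

Definition homTate : ab_functor :=
  @AbFunctor (fun A => tateH n (homZ X A))
    (fun A B k => tate_map (homZ_map X k))
    (fun A B k => tate_mapB (homZ_map X k)) homTate_id homTate_comp.
End HomTate.

Section TensorTate.
Variables (n : int) (X : gmodType gT).

Fact tensorTate_id (A : gmodType gT) :
  tate_map (n := n) (tensor_map X (ghom_id A)) =1 id.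
Proof.
move=> x; rewrite -[RHS](tate_map_id x); apply: eq_tate_map.
by apply: tensor_ext => // [|a b]; [exact: ghomB|rewrite /= tmapE].
Qed.

Fact tensorTate_comp (A B C : gmodType gT) (k : ghom B C) (l : ghom A B) :
  tate_map (n := n) (tensor_map X (ghom_comp k l)) =1
  tate_map (tensor_map X k) \o tate_map (tensor_map X l).
Proof.
move=> x; rewrite -[RHS](tate_map_comp _ _ x); apply: eq_tate_map.
have [kB lB] := (ghomB k, ghomB l).
apply: tensor_ext => [||a b]; [exact: ghomB|exact: ghomB|].
by rewrite /= !tmapE //; exact: (ghomB (ghom_comp k l)).
Qed.

Definition tensorTate : ab_functor :=
  @AbFunctor (fun A => tateH n (tensor X A))
    (fun A B k => tate_map (tensor_map X k))
    (fun A B k => tate_mapB (tensor_map X k)) tensorTate_id tensorTate_comp.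
End TensorTate.

Definition encoding_pair (r : int) (X X' : gmodType gT) : Prop :=
  exists (i : int) (phi : forall A, homTate i X A -> homTate (i + r) X' A),
    is_nat_iso phi.

Definition cohom_equiv (X X' : gmodType gT) : Prop := encoding_pair 0 X X'.

Definition cup_comp (A B C : gmodType gT) (p q : int)
    (x : tateH p (homZ B C)) (y : tateH q (homZ A B)) :
    tateH (p + q) (homZ A C) :=
  tate_map (comp_ghom A B C) (cup x y).

Definition cup_eval (X' X A : gmodType gT) (p q : int)
    (x : tateH p (homZ X' X)) (y : tateH q (tensor X' A)) :
    tateH (p + q) (tensor X A) :=
  tate_map (eval_ghom X' X A) (cup x y).

(* Generated by finitely many elements over Z[G]. *)
Definition fin_gen (X : gmodType gT) : Prop :=
  exists s : seq X, forall x : X, exists c : nat -> gT -> int,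
    x = \sum_(j < size s) \sum_(g : gT) gact g s`_j *~ c j g.

End Functors.

Definition zmod_iso (U V : zmodType) : Prop :=
  exists2 phi : U -> V, zmod_morphism phi & bijective phi.

Definition Zfree (V : zmodType) : Prop :=
  exists I : choiceType, zmod_iso {freeg I / int} V.

Definition cyclic_zmod (V : zmodType) : Prop :=
  exists c : V, forall x, exists k : int, x = c *~ k.

(* Z/nZ for n > 0.  Unlike 'Z_n, this is the trivial group when n = 1. *)
Definition Zmod (n : nat) : zmodType := 'I_n.-1.+1.

(* Main.v *)
(* G-modules form a graded category with Hom^n(A, B) = H^n(G, Hom(A, B)) and the
   cup product as composition. In it the class w in H^1(G, I_G) of the cocycle
   (g, h) |-> h - g and the class w' in H^-1(G, Hom(I_G, Z)) of the cocycle
   g |-> (coefficient of g) are mutually inverse: w' w = 1 - |G|, which is 1 modulo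
   |G|, and w w' = id already on cochains. Hence A and I_G (x) A, and A and
   Hom(I_G, A), are isomorphic up to a shift by 1 and -1.

   Shifting moves a natural isomorphism to degree 0, where H^0(G, Hom(X, -)) is
   represented by [id_X]; Yoneda's lemma then gives the class x of (c), and its
   bijectivity in all degrees the inverse x' of (d).

   For (e), shift to degree -1, where H^-1(G, M) = ker N_G / I_G M. If X is
   generated by x_1, ..., x_n, the functor A |-> H^-1(G, X (x) A) has a weakly
   universal element sum_j x_j (x) a_j over the module U generated by the a_j
   together with finitely many elements that force its norm to vanish. Right
   exactness of the tensor product shows that every natural transformation to
   H^-1(G, B (x) -) is induced by a homomorphism X -> B, unique up to norms.

   For (g), shift to degree 0. A generator of H^0(G, Y) of order |G| defines a
   character of Y^G / N_G Y; extend it to Y by divisibility of Q/Z and lift it to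
   l : Y -> Q, which is possible since X is free. Then y |-> l(N_G y) is an
   invariant functional to Z giving a left inverse of x, and x x' = id follows from
   the cyclicity of H^0(G, Hom(X, X)). *)

From mathcomp Require classical_sets.
Require Import Defs.
From HB Require Import structures.
From mathcomp Require Import all_boot all_algebra fingroup.
From mathcomp Require Import boolp functions.
From mathcomp Require Import generic_quotient ring_quotient freeg.
From mathcomp Require Import zify.

Set Implicit Arguments.
Unset Strict Implicit.
Unset Printing Implicit Defensive.

Import GRing.Theory.
Local Open Scope ring_scope.

(** * Cup products along a pairing *)

(** The obstacle is associativity: w' has degree -1, and in mixed degrees the cup product is
    associative only up to coboundaries, with no convenient formula for them. Each degree is
    therefore lowered, starting from nonnegative ones, along 0 -> I_G (x) A -> Z[G] (x) A -> A -> 0,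
    whose middle term is acyclic. Degree shifts act on the variable A and not on X, so one argument
    serves Hom(X, -) and X (x) - alike; the price is a composition in swapped order, whose inverses
    carry other signs. Degree -1 suits (e) because a surjection M -> N maps I_G M onto I_G N, which
    agrees with the right exactness of X (x) -. In (g) the shift replaces X by another module Y, so
    the property carried along is not freeness but the existence of rational lifts of characters to
    Q/Z, which passes to retracts of finite powers. *)

Section Cochains.
Variable gT : finGroupType.
Implicit Types (A B C D E : gmodType gT) (n p q r : int).

(** Stated for bare functions: equations between degrees are then used by rewriting, with no
    transport of bundled cocycles. *)
Definition is_cocycle A n (f : seq gT -> A) := cochain n f /\ tdiff n f = 0.

Definition cohomologous A n (f h : seq gT -> A) : Prop :=
  exists2 c, cochain (n - 1) c & f - h = tdiff (n - 1) c.

Lemma cochain_sgn A n (f : seq gT -> A) k :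
  cochain n f -> cochain n (fun s => f s *~ (-1) ^+ k).
Proof.
by move=> [f0 fJ]; split=> [s /f0->|g s]; rewrite ?mul0rz // fJ raddfMz.
Qed.

Lemma tdiff_sgn A n (f : seq gT -> A) k :
  tdiff n (fun s => f s *~ (-1) ^+ k) = (fun s => tdiff n f s *~ (-1) ^+ k).
Proof.
rewrite -signr_odd; case: odd; rewrite (expr0, expr1).
  transitivity (- tdiff n f); last by apply/funext => s; rewrite mulrN1z.
  rewrite -[RHS]sub0r -(@tdiff0 _ A n) -tdiffB sub0r; congr tdiff.
by apply/funext => s; rewrite mulr1z; congr tdiff; apply/funext => t; rewrite mulr1z.
Qed.

Lemma cohomologous_sgn A n (f h : seq gT -> A) k :
  cohomologous n f h ->
  cohomologous n (fun s => f s *~ (-1) ^+ k) (fun s => h s *~ (-1) ^+ k).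
Proof.
move=> [c cC E]; exists (fun s => c s *~ (-1) ^+ k); first exact: cochain_sgn.
rewrite tdiff_sgn -E; apply/funext => s; by rewrite !fctE mulrzBl.
Qed.

End Cochains.

(** Composition, evaluation and the right action on tensor products are all instances, so
    associativity of the cup product is proved only once. *)
Record pairing (gT : finGroupType) (A B C : gmodType gT) := Pairing {
  pair_fun :> A -> B -> C;
  pair_biadd : biadditive pair_fun;
  pairJ : forall g a b,
    pair_fun (gact g a) (gact g b) = gact g (pair_fun a b)
}.

Section Pairings.
Variables (gT : finGroupType) (A B C : gmodType gT) (m : pairing A B C).

Lemma pairBl a a' b : m (a - a') b = m a b - m a' b.
Proof. exact: (pair_biadd m).1. Qed.
Lemma pairBr a b b' : m a (b - b') = m a b - m a b'.
Proof. exact: (pair_biadd m).2. Qed.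

HB.instance Definition _ a := GRing.isZmodMorphism.Build B C (m a) ((pair_biadd m).2 a).

Definition pair_swap b a := m a b.
Lemma pair_swapB b : zmod_morphism (pair_swap b).
Proof. by move=> a a'; exact: pairBl. Qed.
HB.instance Definition _ b := GRing.isZmodMorphism.Build A C (pair_swap b) (pair_swapB b).

Lemma pair0r a : m a 0 = 0. Proof. exact: raddf0. Qed.
Lemma pair0l b : m 0 b = 0. Proof. exact: (raddf0 (pair_swap b)). Qed.
Lemma pairNr a b : m a (- b) = - m a b.
Proof. exact: raddfN. Qed.
Lemma pair_suml (I : Type) (r : seq I) (P : pred I) (F : I -> A) b :
  m (\sum_(i <- r | P i) F i) b = \sum_(i <- r | P i) m (F i) b.
Proof. exact: (raddf_sum (pair_swap b)). Qed.
Lemma pair_sumr (I : Type) (r : seq I) (P : pred I) (F : I -> B) a :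
  m a (\sum_(i <- r | P i) F i) = \sum_(i <- r | P i) m a (F i).
Proof. exact: raddf_sum. Qed.
Lemma pairMzl a b k : m (a *~ k) b = m a b *~ k.
Proof. exact: (raddfMz (pair_swap b)). Qed.
Lemma pairMzr a b k : m a (b *~ k) = m a b *~ k.
Proof. exact: raddfMz. Qed.

Definition pair_ghom : ghom (tensor A B) C := tlift_ghom (pair_biadd m) (pairJ m).

Lemma pair_ghomE a b : pair_ghom (tpure a b) = m a b.
Proof. exact/tliftE/pair_biadd. Qed.

End Pairings.

Definition tensor_pairing (gT : finGroupType) (A B : gmodType gT) :
    pairing A B (tensor A B) :=
  Pairing (@tpure_biadditive gT A B) (fun g a b => esym (gact_tpure g a b)).

Lemma raddf_rcup (gT : finGroupType) (A B C D : zmodType) (k : {additive C -> D})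
    (m : A -> B -> C) p q (f : seq gT -> A) (h : seq gT -> B) s :
  k (rcup m p q f h s) = rcup (fun a b => k (m a b)) p q f h s.
Proof.
by case: p q => [a|a] [b|b] //=; case: ifP => _; rewrite raddf_sum.
Qed.

Section RawCup.
Variable gT : finGroupType.
Implicit Types (A B C D E F : gmodType gT) (n p q r : int).

Definition mcup A B C (m : pairing A B C) p q f h (s : seq gT) : C :=
  if size s == clen (p + q) then rcup m p q f h s else 0.

(** Every pairing factors through the tensor product; the equivariance and the Leibniz rule of
    [cochain_cup] carry over along this factorization. *)
Lemma mcup_tensor A B C (m : pairing A B C) p q f h :
  mcup m p q f h = pair_ghom m \o cochain_cup p q f h.
Proof.
apply/funext => s; rewrite -[RHS]/(pair_ghom m _) /mcup /cochain_cup.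
case: ifP => _; last first.
  by rewrite (raddf0 (pair_ghom m)).
rewrite (raddf_rcup (pair_ghom m)); congr (rcup _ p q f h s).
by apply/funext => a; apply/funext => b; rewrite -(pair_ghomE m).
Qed.

Lemma mcup_cochain A B C (m : pairing A B C) p q f h :
  cochain p f -> cochain q h -> cochain (p + q) (mcup m p q f h).
Proof.
by move=> fC hC; rewrite mcup_tensor; apply/cochain_ghom/cochain_cupP.
Qed.

Lemma tdiff_mcup A B C (m : pairing A B C) p q f h :
  tdiff (p + q) (mcup m p q f h) =
  mcup m (p + 1) q (tdiff p f) h
  + (fun s => mcup m p (q + 1) f (tdiff q h) s *~ (-1) ^+ `|p|%N).
Proof.
rewrite !mcup_tensor; move: (pair_ghom m) => k.
rewrite tdiff_ghom tdiff_cup; apply/funext => s.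
by rewrite !fctE /= raddfD raddfMz.
Qed.

Lemma mcup0l A B C (m : pairing A B C) p q h : mcup m p q 0 h = 0.
Proof.
rewrite mcup_tensor cochain_cup0l; move: (pair_ghom m) => k.
by apply/funext => s; rewrite !fctE /= raddf0.
Qed.

Lemma mcup0r A B C (m : pairing A B C) p q h : mcup m p q h 0 = 0.
Proof.
rewrite mcup_tensor cochain_cup0r; move: (pair_ghom m) => k.
by apply/funext => s; rewrite !fctE /= raddf0.
Qed.

Lemma mcup_cocycle A B C (m : pairing A B C) p q f h :
  is_cocycle p f -> is_cocycle q h -> is_cocycle (p + q) (mcup m p q f h).
Proof.
move=> [fC f0] [hC h0]; split; first exact: mcup_cochain.
rewrite tdiff_mcup f0 h0 mcup0l mcup0r add0r.
by apply/funext => s; rewrite mul0rz.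
Qed.

(** [a] and [b] are plain functions, since [rcup] only evaluates the cochains and takes its sums
    after the pairing, in [C]. *)
Lemma mcup_comp A B C A' B' C' (m : pairing A B C) (m' : pairing A' B' C')
    (a : A -> A') (b : B -> B') (c : ghom C C') p q f h :
  (forall x y, c (m x y) = m' (a x) (b y)) ->
  c \o mcup m p q f h = mcup m' p q (a \o f) (b \o h).
Proof.
move=> H; apply/funext => s; rewrite /mcup /=; case: ifP => _; last by rewrite raddf0.
rewrite raddf_rcup; have -> : (fun x y => c (m x y)) = (fun x y => m' (a x) (b y)).
  by apply/funext => x; apply/funext => y.
by case: p q => [i|i] [j|j].
Qed.

Lemma tdiff_mcup_cocycler A B C (m : pairing A B C) p q f h : tdiff q h = 0 ->
  tdiff (p + q) (mcup m p q f h) = mcup m (p + 1) q (tdiff p f) h.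
Proof.
move=> h0; rewrite tdiff_mcup h0 mcup0r -[RHS]addr0; congr (_ + _).
by apply/funext => s; rewrite mul0rz.
Qed.

Lemma tdiff_mcup_cocyclel A B C (m : pairing A B C) p q f h : tdiff p f = 0 ->
  tdiff (p + q) (mcup m p q f h) =
  (fun s => mcup m p (q + 1) f (tdiff q h) s *~ (-1) ^+ `|p|%N).
Proof. by move=> f0; rewrite tdiff_mcup f0 mcup0l add0r. Qed.

Lemma mcup_sgnl A B C (m : pairing A B C) p q f h k :
  mcup m p q (fun s => f s *~ (-1) ^+ k) h =
  (fun s => mcup m p q f h s *~ (-1) ^+ k).
Proof.
apply/funext => s; rewrite /mcup; case: ifP => _; last by rewrite mul0rz.
exact/rcup_sgnl/pair_biadd.
Qed.

Lemma mcup_sgnr A B C (m : pairing A B C) p q f h k :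
  mcup m p q f (fun s => h s *~ (-1) ^+ k) =
  (fun s => mcup m p q f h s *~ (-1) ^+ k).
Proof.
apply/funext => s; rewrite /mcup; case: ifP => _; last by rewrite mul0rz.
exact/rcup_sgnr/pair_biadd.
Qed.

End RawCup.

(* The coinduced module Z[G] (x) A, written as functions from G to A. *)
Definition coind (gT : finGroupType) (A : gmodType gT) : Type := {ffun gT -> A}.
HB.instance Definition _ gT A := GRing.Zmodule.on (@coind gT A).

Section Coind.
Variables (gT : finGroupType) (A : gmodType gT).
Implicit Types (f : coind A) (g : gT).

Definition coind_act g f : coind A := [ffun h => gact g (f (g^-1 * h)%g)].

Fact coind_act1 f : coind_act 1%g f = f.
Proof. by apply/ffunP => h; rewrite ffunE invg1 mul1g gact1. Qed.
Fact coind_actM g h f : coind_act (g * h)%g f = coind_act g (coind_act h f).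
Proof. by apply/ffunP => k; rewrite !ffunE invMg mulgA gactM. Qed.
Fact coind_actB g : zmod_morphism (coind_act g).
Proof. by move=> f h; apply/ffunP => k; rewrite !ffunE raddfB. Qed.
HB.instance Definition _ :=
  Zmodule_isGModule.Build gT (coind A) coind_act1 coind_actM coind_actB.

Definition coind_sum f : A := \sum_g f g.
Fact coind_sumB : zmod_morphism coind_sum.
Proof. by move=> f h; rewrite /coind_sum -sumrB; apply: eq_bigr => g _; rewrite !ffunE. Qed.
Fact coind_sumJ g f : coind_sum (gact g f) = gact g (coind_sum f).
Proof.
rewrite /coind_sum raddf_sum (reindex_inj (mulgI g)) /=.
by apply: eq_bigr => h _; rewrite ffunE mulKg.
Qed.
Definition coind_sum_ghom : ghom (coind A) A := GHom coind_sumB coind_sumJ.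

Definition coind_ker : {pred coind A} := fun f => coind_sum f == 0.
Fact coind_ker_closed : zmod_closed coind_ker.
Proof.
have s0 : coind_sum 0 = 0 by rewrite -(subrr 0) coind_sumB subrr.
split=> [|f h]; rewrite !unfold_in ?s0 // => /eqP f0 /eqP h0.
by rewrite coind_sumB f0 h0 subrr.
Qed.
HB.instance Definition _ :=
  GRing.isZmodClosed.Build (coind A) coind_ker coind_ker_closed.

(** This is I_G (x) A, as the kernel of Z[G] (x) A -> A; functions of sum zero make its elements and
    its action explicit. *)
Record coind0 := Coind0 { coind0_val :> coind A; coind0P : coind0_val \in coind_ker }.
HB.instance Definition _ := [isSub for coind0_val].
HB.instance Definition _ := [Choice of coind0 by <:].
HB.instance Definition _ := [SubChoice_isSubZmodule of coind0 by <:].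

Fact coind0_act_subproof g (u : coind0) : gact g (val u) \in coind_ker.
Proof.
have /eqP f0 := coind0P u.
by rewrite unfold_in coind_sumJ f0 raddf0.
Qed.
Definition coind0_act g u := Coind0 (coind0_act_subproof g u).

Fact coind0_act1 u : coind0_act 1%g u = u.
Proof. by apply: val_inj; rewrite /= gact1. Qed.
Fact coind0_actM g h u : coind0_act (g * h)%g u = coind0_act g (coind0_act h u).
Proof. by apply: val_inj; rewrite /= gactM. Qed.
Fact coind0_actB g : zmod_morphism (coind0_act g).
Proof. by move=> u v; apply: val_inj; rewrite /= raddfB. Qed.
HB.instance Definition _ :=
  Zmodule_isGModule.Build gT coind0 coind0_act1 coind0_actM coind0_actB.

Definition coind0_incl : ghom coind0 (coind A) :=
  @GHom gT coind0 (coind A) val (raddfB val) (fun _ _ => erefl).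

Definition to_coind0 f : coind0 := insubd 0 f.

Lemma to_coind0K f : coind_sum f = 0 -> coind0_incl (to_coind0 f) = f.
Proof. by move=> f0; rewrite /= val_insubd unfold_in f0 eqxx. Qed.

End Coind.

(** * Acyclicity of coinduced modules *)

Section Acyclic.
Variables (gT : finGroupType) (A : gmodType gT).
Implicit Types (n : int) (f z : seq gT -> A).

(* Contracting homotopy of the standard complete resolution as a complex of
   abelian groups. *)
Definition cone n f (t : seq gT) : A :=
  match n with
  | Posz _.+1 => f (1%g :: t)
  | _ => if t is y :: t' then (if y == 1%g then f (if n is Posz _ then [:: 1%g] else t') else 0) else 0
  end.

Lemma cone_rdiff n f s : size s = clen n ->
  (forall t, size t = clen (n + 1) -> rdiff n f t = 0) ->
  rdiff (n - 1) (cone n f) s = f s.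
Proof.
have sum1 (F : gT -> A) : \sum_u (if u == 1%g then F u else 0) = F 1%g.
  by rewrite -big_mkcond big_pred1_eq.
case: n => [[|n]|n] /=.
- case: s => // x [] // _ H; rewrite sum1.
  have := H [:: x; 1%g] erefl; rewrite !diff_del_cons diff_del_nil subr0.
  by move/subr0_eq => ->.
- move=> ss H; have := H (1%g :: s); rewrite /= ss addn1 => /(_ erefl).
  by rewrite diff_del_cons => /subr0_eq ->.
(* What remains is f (x :: s) minus, if x = 1, a value of [diff_ins f] at s, which vanishes by
   hypothesis. In degree -1 the list s is empty, and the hypothesis is read at a list of length
   [clen 0] = 1 instead. *)
- case: s => // x s [ss] H /=; rewrite diff_ins_cons /= sum1.
  case: eqP => [->|_]; last first.
    rewrite [diff_ins _ _](_ : _ = 0) ?subr0 //.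
    by rewrite /diff_ins big1 // => i _; rewrite big1 // => u _; rewrite mul0rz.
  rewrite [X in _ - X](_ : _ = 0) ?subr0 //.
  case: n ss H => [|n] ss H.
    by case: s ss => // _; rewrite diff_ins_nil; exact: (H [:: 1%g]).
  by apply: H; rewrite ss (_ : Negz n.+1 + 1 = Negz n) //; lia.
Qed.
End Acyclic.

Section CoindAcyclic.
Variables (gT : finGroupType) (A : gmodType gT).

Let eval (h : gT) (a : coind A) : A := a h.
Fact evalB h : zmod_morphism (eval h).
Proof. by move=> a b; rewrite /eval !ffunE. Qed.

(** Shapiro's argument: evaluation at 1 turns equivariant cochains with values in [coind A] into
    arbitrary cochains with values in A. The contracting homotopy, which is not equivariant, applies
    to these, and [c] is the equivariant extension of the primitive [c0]. *)
Lemma coind_acyclic n (z : seq gT -> coind A) : is_cocycle n z ->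
  exists2 c, cochain (n - 1) c & z = tdiff (n - 1) c.
Proof.
move=> [[z0 zJ] dz].
pose ev h : {additive coind A -> A} :=
  HB.pack (eval h) (GRing.isZmodMorphism.Build _ _ _ (evalB h)).
pose act g : {additive A -> A} := gact g.
pose c0 := cone n (fun s => z s 1%g).
have c0P s : size s = clen n -> rdiff (n - 1) c0 s = z s 1%g.
  move=> ss; apply: cone_rdiff => // t ts.
  rewrite -[LHS]/(rdiff n (fun t => ev 1%g (z t)) t) raddf_rdiff.
  have := congr1 (fun k => k t) dz; rewrite /tdiff ts eqxx => ->.
  exact: raddf0.
pose c (s : seq gT) : coind A := if size s == clen (n - 1) then
  [ffun h => gact h (c0 [seq (h^-1 * x)%g | x <- s])] else 0.
have zE h s : z s h = gact h (z [seq (h^-1 * x)%g | x <- s] 1%g).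
  by rewrite zJ ffunE invgK mulg1 gactVK.
have map_rdiff m (F : seq gT -> A) h s :
    rdiff m (fun t => F [seq (h * x)%g | x <- t]) s = rdiff m F [seq (h * x)%g | x <- s].
  case: m => [m|[|m]] /=.
  - rewrite /diff_del size_map; apply: eq_bigr => i _.
    by rewrite map_cat map_take map_drop.
  - by rewrite [RHS](reindex_inj (mulgI h)).
  - rewrite /diff_ins size_map; apply: eq_bigr => i _.
    rewrite [RHS](reindex_inj (mulgI h)) /=; apply: eq_bigr => u _.
    by rewrite map_cat map_take /= map_drop.
exists c.
  split=> [s /negPf sN|g s]; rewrite /c ?sN // size_map.
  case: ifP => _; last by rewrite raddf0.
  apply/ffunP => h; rewrite !ffunE invMg invgK -gactM mulKVg; congr (gact _ (c0 _)).
  by rewrite -map_comp; apply: eq_map => x /=; rewrite mulgA.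
apply/funext => s; rewrite /tdiff subrK; case: ifP => [/eqP ss|/negbT/z0 //].
apply/ffunP => h; rewrite zE -c0P ?size_map //.
rewrite -map_rdiff -(raddf_rdiff (act h)).
rewrite -[RHS]/(ev h _) -raddf_rdiff; apply: eq_rdiff; last by rewrite subrK.
by move=> t ts; rewrite /= /eval /c ts eqxx ffunE.
Qed.
End CoindAcyclic.

(** * Connecting maps for coinduced modules and their behaviour under pairings *)

Section Shift.
Variable gT : finGroupType.
Implicit Types (A B C D E : gmodType gT) (n p q r : int).

(** Subtracting a primitive c of L' - R' makes Lh - Rh a cocycle with values in the acyclic module
    [coind E]. A primitive of that cocycle, summed to E, is a primitive of L - R, because c has sum
    zero. *)
Lemma cohomologous_shift E n (L R : seq gT -> E) (L' R' : seq gT -> coind0 E)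
    (Lh Rh : seq gT -> coind E) :
  cochain n Lh -> cochain n Rh ->
  coind_sum_ghom E \o Lh = L -> coind_sum_ghom E \o Rh = R ->
  tdiff n Lh = coind0_incl E \o L' -> tdiff n Rh = coind0_incl E \o R' ->
  cohomologous (n + 1) L' R' -> cohomologous n L R.
Proof.
move=> LC RC <- <- dL dR [c]; rewrite addrK => cC E'.
have zP : is_cocycle n (Lh - Rh - (coind0_incl E \o c)).
  split; first by apply: cochainB; [exact: cochainB|exact: cochain_ghom].
  rewrite !tdiffB tdiff_ghom -E' dL dR.
  move: (coind0_incl E) => k; apply/funext => s.
  by rewrite !fctE /= raddfB subrr.
have [e eC eE] := coind_acyclic zP.
exists (coind_sum_ghom E \o e); first exact: cochain_ghom.
rewrite tdiff_ghom -eE.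
have kc : coind_sum_ghom E \o (coind0_incl E \o c) = 0.
  by apply/funext => s; apply/eqP; exact: (coind0P (c s)).
apply/funext => s; have := congr1 (fun h => h s) kc.
move: (coind_sum_ghom E) (coind0_incl E) => k i.
by rewrite !fctE /= !raddfB /= => ->; rewrite subr0.
Qed.

Section Lift.
Variables (A : gmodType gT) (p : int) (f : seq gT -> A).
Hypothesis fP : is_cocycle p f.

(** Summation has no equivariant section in general; placing f s at the first entry of s makes the
    lift equivariant. The default of [head] is harmless, as no degree has length 0 and f vanishes on
    the empty sequence. *)
Definition coind_lift (s : seq gT) : coind A :=
  [ffun h => if h == head 1%g s then f s else 0].

Lemma coind_sum_lift : coind_sum_ghom A \o coind_lift = f.
Proof.
apply/funext => s; rewrite /= /coind_sum /coind_lift.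
under eq_bigr do rewrite ffunE.
by rewrite -big_mkcond big_pred1_eq.
Qed.

Lemma coind_lift_cochain : cochain p coind_lift.
Proof.
case: fP => -[f0 fJ] _; split=> [s ss|g s]; apply/ffunP => h; rewrite !ffunE.
  by rewrite f0 // if_same.
case: s => [|x s] /=; first by rewrite f0 ?if_same ?raddf0 //; case: p.
rewrite (fJ g (x :: s)) -(inj_eq (mulgI g) _ x) mulKVg.
by case: ifP => _; rewrite ?raddf0.
Qed.

Definition coind_delta (s : seq gT) : coind0 A := to_coind0 (tdiff p coind_lift s).

Lemma coind_deltaE : tdiff p coind_lift = coind0_incl A \o coind_delta.
Proof.
apply/funext => s; rewrite /comp to_coind0K //.
have := congr1 (fun h => h s) (tdiff_ghom (coind_sum_ghom A) p coind_lift).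
by rewrite coind_sum_lift fP.2 => /esym.
Qed.

Lemma coind_delta_cocycle : is_cocycle (p + 1) coind_delta.
Proof.
have [d0 dJ] := cochain_tdiff coind_lift_cochain.
have valE s : val (coind_delta s) = tdiff p coind_lift s by rewrite coind_deltaE.
split; first split=> [s ss|g s]; try apply: val_inj.
- by rewrite valE d0.
- by rewrite valE dJ [RHS]/= valE.
apply/funext => s; apply: val_inj.
have := congr1 (fun h => h s) (tdiff_ghom (coind0_incl A) (p + 1) coind_delta).
by rewrite -coind_deltaE tdiff_sq => /esym.
Qed.
End Lift.

Section PairingLift.
Variables (A B C : gmodType gT) (m : pairing A B C).

Definition coind_pairl_fun (f : coind A) b : coind C := [ffun h => m (f h) b].
Definition coind_pairr_fun a (f : coind B) : coind C := [ffun h => m a (f h)].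

Fact coind_pairl_biadd : biadditive coind_pairl_fun.
Proof.
split=> [b f f'|f b b']; apply/ffunP => h; rewrite !ffunE; [exact: pairBl|exact: pairBr].
Qed.
Fact coind_pairr_biadd : biadditive coind_pairr_fun.
Proof.
split=> [b f f'|f b b']; apply/ffunP => h; rewrite !ffunE; [exact: pairBl|exact: pairBr].
Qed.
Fact coind_pairlJ g f b :
  coind_pairl_fun (gact g f) (gact g b) = gact g (coind_pairl_fun f b).
Proof. by apply/ffunP => h; rewrite !ffunE pairJ. Qed.
Fact coind_pairrJ g f b :
  coind_pairr_fun (gact g f) (gact g b) = gact g (coind_pairr_fun f b).
Proof. by apply/ffunP => h; rewrite !ffunE pairJ. Qed.
Definition coind_pairl := Pairing coind_pairl_biadd coind_pairlJ.
Definition coind_pairr := Pairing coind_pairr_biadd coind_pairrJ.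

Lemma coind_sum_pairl f b : coind_sum (coind_pairl f b) = m (coind_sum f) b.
Proof. by rewrite /coind_sum pair_suml; apply: eq_bigr => h _; rewrite ffunE. Qed.
Lemma coind_sum_pairr a f : coind_sum (coind_pairr a f) = m a (coind_sum f).
Proof. by rewrite /coind_sum pair_sumr; apply: eq_bigr => h _; rewrite ffunE. Qed.

(** The default 0 of [to_coind0] is never reached: a pairing, being additive, sends functions of sum
    zero to functions of sum zero. *)
Definition coind0_pairl_fun (f : coind0 A) b : coind0 C := to_coind0 (coind_pairl (val f) b).
Definition coind0_pairr_fun a (f : coind0 B) : coind0 C := to_coind0 (coind_pairr a (val f)).

Lemma coind0_pairl_val f b : val (coind0_pairl_fun f b) = coind_pairl (val f) b.
Proof.
have /eqP f0 := coind0P f.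
by rewrite -[LHS]/(coind0_incl C _) to_coind0K // coind_sum_pairl f0 pair0l.
Qed.
Lemma coind0_pairr_val a f : val (coind0_pairr_fun a f) = coind_pairr a (val f).
Proof.
have /eqP f0 := coind0P f.
by rewrite -[LHS]/(coind0_incl C _) to_coind0K // coind_sum_pairr f0 pair0r.
Qed.

Fact coind0_pairl_biadd : biadditive coind0_pairl_fun.
Proof.
by split=> [b f f'|f b b']; apply: val_inj; rewrite raddfB /= !coind0_pairl_val
  ?raddfB ?pairBl ?pairBr.
Qed.
Fact coind0_pairr_biadd : biadditive coind0_pairr_fun.
Proof.
by split=> [b f f'|f b b']; apply: val_inj; rewrite raddfB /= !coind0_pairr_val
  ?raddfB ?pairBl ?pairBr.
Qed.
Fact coind0_pairlJ g f b :
  coind0_pairl_fun (gact g f) (gact g b) = gact g (coind0_pairl_fun f b).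
Proof. by apply: val_inj; rewrite /= !coind0_pairl_val -pairJ. Qed.
Fact coind0_pairrJ g f b :
  coind0_pairr_fun (gact g f) (gact g b) = gact g (coind0_pairr_fun f b).
Proof. by apply: val_inj; rewrite /= !coind0_pairr_val -pairJ. Qed.
Definition coind0_pairl := Pairing coind0_pairl_biadd coind0_pairlJ.
Definition coind0_pairr := Pairing coind0_pairr_biadd coind0_pairrJ.

Lemma coind0_pairlE f b : val (coind0_pairl f b) = coind_pairl (val f) b.
Proof. exact: coind0_pairl_val. Qed.
Lemma coind0_pairrE a f : val (coind0_pairr a f) = coind_pairr a (val f).
Proof. exact: coind0_pairr_val. Qed.

End PairingLift.
End Shift.

(** * Associativity of the cup product *)

Section Associativity.
Variable gT : finGroupType.
Implicit Types (n p q r : int).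

(** Quantified over all modules and pairings, because lowering a degree replaces one of the modules
    by its [coind0]. *)
Definition cup_assoc_at p q r : Prop :=
  forall (A B C D E F : gmodType gT) (m1 : pairing A B D) (m2 : pairing D C E)
    (n1 : pairing B C F) (n2 : pairing A F E) f g h,
  (forall a b c, m2 (m1 a b) c = n2 a (n1 b c)) ->
  is_cocycle p f -> is_cocycle q g -> is_cocycle r h ->
  cohomologous (p + q + r) (mcup m2 (p + q) r (mcup m1 p q f g) h)
    (mcup n2 p (q + r) f (mcup n1 q r g h)).

(* The diagonal approximation is strictly coassociative in degrees >= 0 only. *)
Lemma mcupA_nat (p q r : nat) : cup_assoc_at p q r.
Proof.
move=> A B C D E F m1 m2 n1 n2 f g h mn _ _ _.
exists 0; first exact: cochain0.
rewrite tdiff0; apply/eqP; rewrite subr_eq0; apply/eqP/funext => s.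
rewrite /mcup -!PoszD addnA; case: eqP => //= ss.
rewrite size_takel ?ss ?ltnS ?leq_addr // eqxx size_drop ss.
rewrite -!addnS -addnA addKn eqxx -mn.
have -> : take p.+1 (take (p + q.+1) s) = take p.+1 s.
  by rewrite -take_min; congr take; lia.
by rewrite drop_drop take_drop addnC (addnC q p).
Qed.

Lemma ghom_comp_sgn (A B : gmodType gT) (k : ghom A B) (f : seq gT -> A) j :
  k \o (fun s => f s *~ (-1) ^+ j) = (fun s => (k \o f) s *~ (-1) ^+ j).
Proof. by apply/funext => s; rewrite /= raddfMz. Qed.

(* Connecting maps of the sequence 0 -> coind0 A -> coind A -> A -> 0 commute
   with cup products and are injective, which lowers each degree in turn. *)
Lemma cup_assoc_downl p q r : cup_assoc_at (p + 1) q r -> cup_assoc_at p q r.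
Proof.
move=> IH A B C D E F m1 m2 n1 n2 f g h mn fP gP hP.
have [[lC gC] hC] := (coind_lift_cochain fP, gP.1, hP.1).
have [dl0 dlP] := (coind_deltaE fP, coind_delta_cocycle fP).
refine (@cohomologous_shift gT E _ _ _
  (mcup (coind0_pairl m2) (p + 1 + q) r
     (mcup (coind0_pairl m1) (p + 1) q (coind_delta p f) g) h)
  (mcup (coind0_pairl n2) (p + 1) (q + r) (coind_delta p f) (mcup n1 q r g h))
  (mcup (coind_pairl m2) (p + q) r
     (mcup (coind_pairl m1) p q (coind_lift f) g) h)
  (mcup (coind_pairl n2) p (q + r) (coind_lift f) (mcup n1 q r g h)) _ _ _ _ _ _ _).
- by apply: mcup_cochain => //; exact: mcup_cochain.
- by rewrite -addrA; apply: mcup_cochain => //; exact: mcup_cochain.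
- rewrite (mcup_comp (m' := m2) (a := coind_sum_ghom D) (b := id) (c := coind_sum_ghom E));
    last by move=> *; exact: coind_sum_pairl.
  rewrite (mcup_comp (m' := m1) (a := coind_sum_ghom A) (b := id) (c := coind_sum_ghom D));
    last by move=> *; exact: coind_sum_pairl.
  by rewrite coind_sum_lift.
- rewrite (mcup_comp (m' := n2) (a := coind_sum_ghom A) (b := id) (c := coind_sum_ghom E));
    last by move=> *; exact: coind_sum_pairl.
  by rewrite coind_sum_lift.
- rewrite tdiff_mcup_cocycler ?hP.2 // tdiff_mcup_cocycler ?gP.2 //.
  rewrite (mcup_comp (m' := coind_pairl m2) (a := coind0_incl D) (b := id) (c := coind0_incl E));
    last by move=> *; exact: coind0_pairlE.
  rewrite (mcup_comp (m' := coind_pairl m1) (a := coind0_incl A) (b := id) (c := coind0_incl D));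
    last by move=> *; exact: coind0_pairlE.
  by rewrite -dl0 addrAC.
- rewrite -addrA tdiff_mcup_cocycler; last exact: (mcup_cocycle _ gP hP).2.
  rewrite (mcup_comp (m' := coind_pairl n2) (a := coind0_incl A) (b := id) (c := coind0_incl E));
    last by move=> *; exact: coind0_pairlE.
  by rewrite -dl0.
- rewrite (_ : p + q + r + 1 = p + 1 + q + r); last by lia.
  apply: IH => // a b c; apply: val_inj.
  rewrite !coind0_pairlE; apply/ffunP => x; rewrite !ffunE.
by rewrite -mn.
Qed.

Lemma cup_assoc_downm p q r : cup_assoc_at p (q + 1) r -> cup_assoc_at p q r.
Proof.
move=> IH A B C D E F m1 m2 n1 n2 f g h mn fP gP hP.
have [[lC fC] hC] := (coind_lift_cochain gP, fP.1, hP.1).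
have [dl0 dlP] := (coind_deltaE gP, coind_delta_cocycle gP).
refine (@cohomologous_shift gT E _ _ _
  (fun s => mcup (coind0_pairl m2) (p + (q + 1)) r
     (mcup (coind0_pairr m1) p (q + 1) f (coind_delta q g)) h s *~ (-1) ^+ `|p|%N)
  (fun s => mcup (coind0_pairr n2) p (q + 1 + r) f
     (mcup (coind0_pairl n1) (q + 1) r (coind_delta q g) h) s *~ (-1) ^+ `|p|%N)
  (mcup (coind_pairl m2) (p + q) r
     (mcup (coind_pairr m1) p q f (coind_lift g)) h)
  (mcup (coind_pairr n2) p (q + r) f (mcup (coind_pairl n1) q r (coind_lift g) h)) _ _ _ _ _ _ _).
- by apply: mcup_cochain => //; exact: mcup_cochain.
- by rewrite -addrA; apply: mcup_cochain => //; exact: mcup_cochain.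
- rewrite (mcup_comp (m' := m2) (a := coind_sum_ghom D) (b := id) (c := coind_sum_ghom E));
    last by move=> *; exact: coind_sum_pairl.
  rewrite (mcup_comp (m' := m1) (a := id) (b := coind_sum_ghom B) (c := coind_sum_ghom D));
    last by move=> *; exact: coind_sum_pairr.
  by rewrite coind_sum_lift.
- rewrite (mcup_comp (m' := n2) (a := id) (b := coind_sum_ghom F) (c := coind_sum_ghom E));
    last by move=> *; exact: coind_sum_pairr.
  rewrite (mcup_comp (m' := n1) (a := coind_sum_ghom B) (b := id) (c := coind_sum_ghom F));
    last by move=> *; exact: coind_sum_pairl.
  by rewrite coind_sum_lift.
(* The differential moves past f and picks up the sign (-1)^|p|; the other bracketing acquires the
   same one. *)
- rewrite tdiff_mcup_cocycler ?hP.2 // tdiff_mcup_cocyclel ?fP.2 // mcup_sgnl.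
  rewrite dl0 addrA ghom_comp_sgn.
  rewrite (mcup_comp (m' := coind_pairl m2) (a := coind0_incl D) (b := id) (c := coind0_incl E));
    last by move=> *; exact: coind0_pairlE.
  rewrite (mcup_comp (m' := coind_pairr m1) (a := id) (b := coind0_incl B) (c := coind0_incl D)) //.
  by move=> *; exact: coind0_pairrE.
- rewrite -addrA tdiff_mcup_cocyclel ?fP.2 // tdiff_mcup_cocycler ?hP.2 //.
  rewrite dl0 (addrAC q) ghom_comp_sgn.
  rewrite (mcup_comp (m' := coind_pairr n2) (a := id) (b := coind0_incl F) (c := coind0_incl E));
    last by move=> *; exact: coind0_pairrE.
  rewrite (mcup_comp (m' := coind_pairl n1) (a := coind0_incl B) (b := id) (c := coind0_incl F)) //.
  by move=> *; exact: coind0_pairlE.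
- apply: cohomologous_sgn; rewrite (_ : p + q + r + 1 = p + (q + 1) + r); last by lia.
  apply: IH => // a b c; apply: val_inj.
  rewrite coind0_pairlE coind0_pairrE; apply/ffunP => x; rewrite !ffunE.
  by rewrite coind0_pairrE coind0_pairlE !ffunE mn.
Qed.

Lemma cup_assoc_downr p q r : cup_assoc_at p q (r + 1) -> cup_assoc_at p q r.
Proof.
move=> IH A B C D E F m1 m2 n1 n2 f g h mn fP gP hP.
have [[lC fC] gC] := (coind_lift_cochain hP, fP.1, gP.1).
have [dl0 dlP] := (coind_deltaE hP, coind_delta_cocycle hP).
refine (@cohomologous_shift gT E _ _ _
  (fun s => mcup (coind0_pairr m2) (p + q) (r + 1)
     (mcup m1 p q f g) (coind_delta r h) s *~ (-1) ^+ absz (p + q))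
  (fun s => mcup (coind0_pairr n2) p (q + (r + 1)) f
     (mcup (coind0_pairr n1) q (r + 1) g (coind_delta r h)) s *~ (-1) ^+ absz (p + q))
  (mcup (coind_pairr m2) (p + q) r (mcup m1 p q f g) (coind_lift h))
  (mcup (coind_pairr n2) p (q + r) f (mcup (coind_pairr n1) q r g (coind_lift h))) _ _ _ _ _ _ _).
- by apply: mcup_cochain => //; exact: mcup_cochain.
- by rewrite -addrA; apply: mcup_cochain => //; exact: mcup_cochain.
- rewrite (mcup_comp (m' := m2) (a := id) (b := coind_sum_ghom C) (c := coind_sum_ghom E));
    last by move=> *; exact: coind_sum_pairr.
  by rewrite coind_sum_lift.
- rewrite (mcup_comp (m' := n2) (a := id) (b := coind_sum_ghom F) (c := coind_sum_ghom E));
    last by move=> *; exact: coind_sum_pairr.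
  rewrite (mcup_comp (m' := n1) (a := id) (b := coind_sum_ghom C) (c := coind_sum_ghom F));
    last by move=> *; exact: coind_sum_pairr.
  by rewrite coind_sum_lift.
- rewrite tdiff_mcup_cocyclel; last exact: (mcup_cocycle _ fP gP).2.
  rewrite dl0 ghom_comp_sgn.
  rewrite (mcup_comp (m' := coind_pairr m2) (a := id) (b := coind0_incl C) (c := coind0_incl E)) //.
  by move=> *; exact: coind0_pairrE.
- rewrite -addrA tdiff_mcup_cocyclel ?fP.2 // tdiff_mcup_cocyclel ?gP.2 // mcup_sgnr.
  rewrite dl0 addrA ghom_comp_sgn.
  (* Moving past f and then past g gives the signs of |p| and |q| separately; |p| + |q| and |p + q|
     agree only in parity. *)
  rewrite (@sgn_eq (absz (p + q)) (absz q + absz p)%N); last by lia.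
  rewrite (mcup_comp (m' := coind_pairr n2) (a := id) (b := coind0_incl F) (c := coind0_incl E));
    last by move=> *; exact: coind0_pairrE.
  rewrite (mcup_comp (m' := coind_pairr n1) (a := id) (b := coind0_incl C) (c := coind0_incl F));
    last by move=> *; exact: coind0_pairrE.
  by apply/funext => s; rewrite exprD mulrzA.
- apply: cohomologous_sgn; rewrite -(addrA _ r 1).
  apply: IH => // a b c; apply: val_inj.
  rewrite !coind0_pairrE; apply/ffunP => x; rewrite !ffunE.
by rewrite mn.
Qed.

Lemma int_down_ind (P : int -> Prop) :
  (forall k : nat, P k) -> (forall n, P (n + 1) -> P n) -> forall n, P n.
Proof.
move=> P0 PS [k|k] //; elim: k => [|k IH]; apply: PS; first exact: (P0 0%N).
by rewrite (_ : Negz k.+1 + 1 = Negz k) //; lia.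
Qed.

Lemma mcupA p q r : cup_assoc_at p q r.
Proof.
move: p q r; apply: int_down_ind => [p q|p IH q r]; last exact/cup_assoc_downl.
move: q; apply: int_down_ind => [q|q IH r]; last exact/cup_assoc_downm.
by apply: int_down_ind => [r|r]; [exact: mcupA_nat|exact: cup_assoc_downr].
Qed.

End Associativity.

(** * Cohomology classes *)

Section CupClass.
Variable gT : finGroupType.
Implicit Types (A B C D E F : gmodType gT) (n p q r : int).

Lemma tate_cocycleP A n (z : tate_cocycle n A) : is_cocycle n z.
Proof. exact: cocycleP. Qed.

Lemma tateP A n (x : tateH n A) : exists z, x = tclass z.
Proof. by exists (trepr x); rewrite treprK. Qed.

Lemma tclass_cohomologous A n (z w : tate_cocycle n A) :
  cohomologous n z w -> tclass z = tclass w.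
Proof. by move=> H; apply/tclass_eq; exact: H. Qed.

Definition mk_cocycle A n f (fP : is_cocycle n f) : tate_cocycle n A :=
  TateCocycle (introT (asboolP _) fP).

(* The degree of the product is a parameter, so that associativity and unit
   laws need no transport between the groups H^(p + q). *)
Definition pcup A B C (m : pairing A B C) p q n (e : p + q = n)
    (x : tateH p A) (y : tateH q B) : tateH n C :=
  tate_cast e (tate_map (pair_ghom m) (cup x y)).

Lemma pcupE A B C (m : pairing A B C) p q n (e : p + q = n)
    (z : tate_cocycle p A) (w : tate_cocycle q B) (u : tate_cocycle n C) :
  (u : seq gT -> C) = mcup m p q z w -> pcup m e (tclass z) (tclass w) = tclass u.
Proof.
case: n / e u => u uE; rewrite /pcup /= cupE tate_mapE; congr tclass.
by apply/val_inj; rewrite -[RHS]/(cocycle_fun u) uE mcup_tensor.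
Qed.

Lemma pcupEx A B C (m : pairing A B C) p q n (e : p + q = n)
    (z : tate_cocycle p A) (w : tate_cocycle q B) :
  exists2 u : tate_cocycle n C, (u : seq gT -> C) = mcup m p q z w &
    pcup m e (tclass z) (tclass w) = tclass u.
Proof.
have uP : is_cocycle n (mcup m p q z w).
  by rewrite -e; exact: mcup_cocycle (tate_cocycleP z) (tate_cocycleP w).
by exists (mk_cocycle uP) => //; exact: pcupE.
Qed.

Lemma pcupBl A B C (m : pairing A B C) p q n (e : p + q = n) y :
  zmod_morphism (fun x => pcup m e x y).
Proof. by case: n / e => x x'; rewrite /pcup /= cupBl tate_mapB. Qed.

Lemma pcupBr A B C (m : pairing A B C) p q n (e : p + q = n) x :
  zmod_morphism (pcup m e x).
Proof. by case: n / e => y y'; rewrite /pcup /= cupBr tate_mapB. Qed.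
HB.instance Definition _ A B C (m : pairing A B C) p q n (e : p + q = n) x :=
  GRing.isZmodMorphism.Build _ _ (pcup m e x) (pcupBr m e x).

Definition pcup_swap A B C (m : pairing A B C) p q n (e : p + q = n) y x :=
  pcup m e x y.
HB.instance Definition _ A B C (m : pairing A B C) p q n (e : p + q = n) y :=
  GRing.isZmodMorphism.Build _ _ (pcup_swap m e y) (pcupBl m e y).

Lemma pcup0r A B C (m : pairing A B C) p q n (e : p + q = n) x : pcup m e x 0 = 0.
Proof. exact: raddf0. Qed.
Lemma pcup0l A B C (m : pairing A B C) p q n (e : p + q = n) y : pcup m e 0 y = 0.
Proof. exact: (raddf0 (pcup_swap m e y)). Qed.
Lemma pcupNr A B C (m : pairing A B C) p q n (e : p + q = n) x y :
  pcup m e x (- y) = - pcup m e x y.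
Proof. exact: raddfN. Qed.
Lemma pcupNl A B C (m : pairing A B C) p q n (e : p + q = n) x y :
  pcup m e (- x) y = - pcup m e x y.
Proof. exact: (raddfN (pcup_swap m e y)). Qed.
Lemma pcupMzr A B C (m : pairing A B C) p q n (e : p + q = n) x y k :
  pcup m e x (y *~ k) = pcup m e x y *~ k.
Proof. exact: raddfMz. Qed.
Lemma pcupMzl A B C (m : pairing A B C) p q n (e : p + q = n) x y k :
  pcup m e (x *~ k) y = pcup m e x y *~ k.
Proof. exact: (raddfMz (pcup_swap m e y)). Qed.

Lemma pcupA A B C D E F (m1 : pairing A B D) (m2 : pairing D C E)
    (n1 : pairing B C F) (n2 : pairing A F E) p q r pq qr n
    (e1 : p + q = pq) (e2 : pq + r = n) (e3 : q + r = qr) (e4 : p + qr = n) x y z :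
  (forall a b c, m2 (m1 a b) c = n2 a (n1 b c)) ->
  pcup m2 e2 (pcup m1 e1 x y) z = pcup n2 e4 x (pcup n1 e3 y z).
Proof.
move=> mn; have [[[f ->] [g ->]] [h ->]] := (tateP x, tateP y, tateP z).
have [u uE ->] := pcupEx m1 e1 f g; have [v vE ->] := pcupEx n1 e3 g h.
have [s sE ->] := pcupEx m2 e2 u h; have [t tE ->] := pcupEx n2 e4 f v.
apply: tclass_cohomologous; rewrite sE tE uE vE -e2 -e1 -e3.
exact: mcupA mn (tate_cocycleP f) (tate_cocycleP g) (tate_cocycleP h).
Qed.

Lemma pcup_map A B C A' B' C' (m : pairing A B C) (m' : pairing A' B' C')
    (a : ghom A A') (b : ghom B B') (c : ghom C C') p q n (e : p + q = n) x y :
  (forall u v, c (m u v) = m' (a u) (b v)) ->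
  tate_map c (pcup m e x y) = pcup m' e (tate_map a x) (tate_map b y).
Proof.
move=> H; have [[f ->] [g ->]] := (tateP x, tateP y).
have [u uE ->] := pcupEx m e f g; rewrite !tate_mapE.
by apply/esym/pcupE; rewrite -(mcup_comp _ _ _ _ H) /= uE.
Qed.

Lemma tate_map_pcup A B C C' (m : pairing A B C) (m' : pairing A B C')
    (k : ghom C C') p q n (e : p + q = n) x y :
  (forall a b, k (m a b) = m' a b) -> tate_map k (pcup m e x y) = pcup m' e x y.
Proof.
move=> H; rewrite (pcup_map (m' := m') (a := ghom_id A) (b := ghom_id B)) //.
by rewrite !tate_map_id.
Qed.

Lemma pcup_mapl A A' B C (m : pairing A' B C) (m' : pairing A B C)
    (k : ghom A A') p q n (e : p + q = n) x y :
  (forall a b, m (k a) b = m' a b) -> pcup m e (tate_map k x) y = pcup m' e x y.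
Proof.
move=> H; rewrite -[RHS](tate_map_id (pcup m' e x y)).
by rewrite (pcup_map (m' := m) (a := k) (b := ghom_id B)) ?tate_map_id.
Qed.

Lemma pcup_mapr A B B' C (m : pairing A B' C) (m' : pairing A B C)
    (k : ghom B B') p q n (e : p + q = n) x y :
  (forall a b, m a (k b) = m' a b) -> pcup m e x (tate_map k y) = pcup m' e x y.
Proof.
move=> H; rewrite -[RHS](tate_map_id (pcup m' e x y)).
by rewrite (pcup_map (m' := m) (a := ghom_id A) (b := k)) ?tate_map_id.
Qed.

End CupClass.

(** * Degree zero: invariants modulo norms *)

Section DegreeZero.
Variable gT : finGroupType.
Implicit Types (A B C : gmodType gT) (n p q : int).

Definition invariant A (a : A) := forall g : gT, gact g a = a.

Lemma invariantB A (a b : A) : invariant a -> invariant b -> invariant (a - b).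
Proof. by move=> aI bI g; rewrite raddfB /= aI bI. Qed.
Lemma invariantN A (a : A) : invariant a -> invariant (- a).
Proof. by move=> aI g; rewrite raddfN /= aI. Qed.
Lemma invariantMz A (a : A) k : invariant a -> invariant (a *~ k).
Proof. by move=> aI g; rewrite raddfMz /= aI. Qed.
Lemma invariant_ghom A B (k : ghom A B) a : invariant a -> invariant (k a).
Proof. by move=> aI g; rewrite -ghomJ aI. Qed.
Lemma invariant_norm A (a : A) : invariant (\sum_(g : gT) gact g a).
Proof.
move=> h; rewrite raddf_sum [RHS](reindex_inj (mulgI h)) /=.
by apply: eq_bigr => g _; rewrite gactM.
Qed.
Lemma invariant_ghom_homZ A B (k : ghom A B) : invariant (ghom_homZ k).
Proof. by move=> g; exact: ghom_homZ_inv. Qed.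

Definition const_cochain A (a : A) (s : seq gT) : A := if size s == 1%N then a else 0.

Lemma const_cochainP A (a : A) : invariant a -> is_cocycle 0 (const_cochain a).
Proof.
move=> aI; split; first split=> [s /negPf|g s]; rewrite /const_cochain ?size_map.
- by move=> ->.
- by case: ifP => _; rewrite (aI, raddf0).
apply/funext => s; rewrite /tdiff; case: ifP => //.
case: s => // x [|y []] // _.
by rewrite /= !diff_del_cons diff_del_nil subr0 /const_cochain subrr.
Qed.

(* The class of an invariant element; of junk value 0 on other elements. *)
Definition cls0 A (a : A) : tateH 0 A :=
  tclass (insubd (0 : tate_cocycle 0 A) (const_cochain a)).

Lemma cls0E A (a : A) (z : tate_cocycle 0 A) :
  invariant a -> (z : seq gT -> A) = const_cochain a -> cls0 a = tclass z.
Proof.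
move=> aI zE; congr tclass; apply: val_inj.
have aP : const_cochain a \in @cocycle gT 0 A by exact/asboolP/const_cochainP.
by rewrite val_insubd aP -zE.
Qed.

Lemma cls0Ex A (a : A) : invariant a ->
  exists2 z : tate_cocycle 0 A, (z : seq gT -> A) = const_cochain a &
    cls0 a = tclass z.
Proof.
move=> aI; exists (mk_cocycle (const_cochainP aI)) => //.
exact: cls0E.
Qed.

Lemma tclass0E A (z : tate_cocycle 0 A) :
  invariant (z [:: 1%g]) /\ tclass z = cls0 (z [:: 1%g]).
Proof.
have [[z0 zJ] dz] := tate_cocycleP z.
have zE g : z [:: g] = z [:: 1%g].
  have := congr1 (fun f => f [:: 1%g; g]) dz.
  by rewrite /tdiff /= !diff_del_cons diff_del_nil subr0 => /subr0_eq.
have aI : invariant (z [:: 1%g]) by move=> g; rewrite -zJ /= zE.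
split=> //; apply/esym/cls0E => //.
apply/funext => s; rewrite /const_cochain; case: eqP => [|/eqP/z0 //].
by case: s => // x0 [].
Qed.

Lemma cls0P A (x : tateH 0 A) : exists2 a, invariant a & x = cls0 a.
Proof. by have [z ->] := tateP x; have [zI ->] := tclass0E z; exists (z [:: 1%g]). Qed.

Lemma cls0B A (a b : A) : invariant a -> invariant b ->
  cls0 (a - b) = cls0 a - cls0 b.
Proof.
move=> aI bI; have [z zE ->] := cls0Ex aI; have [w wE ->] := cls0Ex bI.
rewrite -raddfB; apply: cls0E; first exact: invariantB.
rewrite [LHS](_ : _ = (z : seq gT -> A) - (w : seq gT -> A)) // zE wE; apply/funext => s.
by rewrite !fctE /const_cochain; case: ifP; rewrite ?subr0.
Qed.

Lemma cls0_0 A : cls0 (0 : A) = 0.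
Proof.
have i0 : invariant (0 : A) by move=> g; rewrite raddf0.
by rewrite -[X in cls0 X](subrr 0) cls0B // subrr.
Qed.

Lemma cls0N A (a : A) : invariant a -> cls0 (- a) = - cls0 a.
Proof.
have i0 : invariant (0 : A) by move=> g; rewrite raddf0.
by move=> aI; rewrite -sub0r cls0B // cls0_0 sub0r.
Qed.

Lemma cls0Mz A (a : A) k : invariant a -> cls0 (a *~ k) = cls0 a *~ k.
Proof.
move=> aI; have N (n : nat) : cls0 (a *~ n) = cls0 a *~ n.
  elim: n => [|n IH]; first by rewrite !mulr0z cls0_0.
  rewrite intS !mulrzDr !mulr1z -IH -[a *~ n in LHS]opprK cls0B ?cls0N ?opprK //.
    exact: invariantMz.
  exact/invariantN/invariantMz.
case: k => n; first exact: N.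
by rewrite NegzE !mulrNz cls0N ?N //; exact: invariantMz.
Qed.

Lemma cls0_eq0 A (a : A) : invariant a ->
  (cls0 a = 0 <-> exists k : A, a = \sum_(g : gT) gact g k).
Proof.
move=> aI; have [z zE ->] := cls0Ex aI.
have -> : (0 : tateH 0 A) = tclass 0 by rewrite raddf0.
split.
  case/tclass_eq => h [h0 hJ] /(congr1 (fun k => k [:: 1%g])).
  rewrite zE !fctE /const_cochain /= subr0 /tdiff /= => ->; exists (h [:: 1%g]).
  by apply: eq_bigr => g _; rewrite -hJ /= mulg1.
case=> k kE; apply/tclass_eq.
exists (fun s => if s is [:: x] then gact x k else 0).
  split=> [[|x []] //|g [|x []]] /=; rewrite ?raddf0 //.
  by rewrite gactM.
rewrite zE [X in _ - X](_ : _ = 0) // subr0.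
by apply/funext => s; rewrite /const_cochain /tdiff /= kE.
Qed.

Lemma cls0_norm A (a : A) : cls0 (\sum_(g : gT) gact g a) = 0.
Proof. by apply/cls0_eq0; [exact: invariant_norm|exists a]. Qed.

Lemma cls0_card A (a : A) : invariant a -> cls0 (a *~ #|gT|%:Z) = 0.
Proof.
move=> aI; rewrite -[RHS](cls0_norm a); congr cls0.
by under eq_bigr do rewrite aI; rewrite sumr_const -pmulrn.
Qed.

Lemma tate_map_cls0 A B (k : ghom A B) a : invariant a ->
  tate_map k (cls0 a) = cls0 (k a).
Proof.
move=> aI; have [z zE ->] := cls0Ex aI; rewrite tate_mapE; apply/esym/cls0E.
  exact: invariant_ghom.
apply/funext => s; rewrite /= zE /const_cochain; case: ifP => // _.
by rewrite raddf0.
Qed.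

Lemma ghom_classE A B (k : ghom A B) : ghom_class k = cls0 (ghom_homZ k).
Proof. by apply/esym/cls0E => //; exact: invariant_ghom_homZ. Qed.

(** The equality already holds on cochains: for negative q, the sum in [rcup] runs over the empty
    tuple alone. *)
Lemma pcup_cls0l A B C (m : pairing A B C) q (e : 0 + q = q) a (k : ghom B C) y :
  invariant a -> (forall b, m a b = k b) -> pcup m e (cls0 a) y = tate_map k y.
Proof.
move=> aI mk; have [w ->] := tateP y; have [z zE ->] := cls0Ex aI.
rewrite tate_mapE; apply: pcupE; apply/funext => s; rewrite /= /mcup zE e.
case: eqP => [ss|/eqP ss]; last by rewrite (cocycleP w).1.1 // raddf0.
case: q e y w ss => [q|q] e y w ss.
  by rewrite /= drop0 /const_cochain size_takel ?ss // mk.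
by rewrite /= -[RHS]/(tsum 0 (fun t => m (const_cochain a (head 1%g s :: t)) (w (rev t ++ s)))) tsum0 /= mk.
Qed.

Lemma pcup_cls0r A B C (m : pairing A B C) p (e : p + 0 = p) b (k : ghom A C) x :
  invariant b -> (forall a, m a b = k a) -> pcup m e x (cls0 b) = tate_map k x.
Proof.
move=> bI mk; have [w ->] := tateP x; have [z zE ->] := cls0Ex bI.
rewrite tate_mapE; apply: pcupE; apply/funext => s; rewrite /= /mcup zE e.
case: eqP => [ss|/eqP ss]; last by rewrite (cocycleP w).1.1 // raddf0.
case: p e x w ss => [p|p] e x w ss.
  by rewrite /= take_oversize ?ss // /const_cochain size_drop ss subSn // subnn mk.
by rewrite /= -[RHS]/(tsum 0 (fun t => m (w (s ++ t)) (const_cochain b (rcons (rev t) (last 1%g s))))) tsum0 /= cats0 mk.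
Qed.

End DegreeZero.

(** * The classes of the augmentation ideal *)

Section HomPairings.
Variable gT : finGroupType.
Implicit Types (A B C X : gmodType gT).

Lemma homZ_ext A B (f h : homZ A B) : f =1 h -> f = h.
Proof. by move=> fh; apply/val_inj/funext. Qed.

Lemma homZ_sumE A B (I : Type) (r : seq I) (P : pred I) (F : I -> homZ A B) x :
  (\sum_(i <- r | P i) F i) x = \sum_(i <- r | P i) F i x.
Proof.
by apply: (big_morph (fun f : homZ A B => f x)) => [f h|]; rewrite // -[_ x]/((val _) x) raddfD.
Qed.

Lemma homZMzE A B (f : homZ A B) k x : (f *~ k) x = f x *~ k.
Proof.
have eB : zmod_morphism (fun f : homZ A B => f x) by [].
pose e : {additive homZ A B -> B} :=
  HB.pack (fun f : homZ A B => f x) (GRing.isZmodMorphism.Build _ _ _ eB).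
exact: (raddfMz e).
Qed.

Definition idZ A : homZ A A := ghom_homZ (ghom_id A).

Lemma hcomp1l A B (f : homZ A B) : hcomp (idZ B) f = f.
Proof. exact: homZ_ext. Qed.
Lemma hcomp1r A B (f : homZ A B) : hcomp f (idZ A) = f.
Proof. exact: homZ_ext. Qed.

Definition comp_pairing A B C : pairing (homZ B C) (homZ A B) (homZ A C) :=
  Pairing (@hcomp_biadditive gT A B C) (@hcompJ gT A B C).

Definition eval_pairing X' X A :
    pairing (homZ X' X) (tensor X' A) (tensor X A) :=
  Pairing (@heval_biadditive gT X' X A) (@hevalJ gT X' X A).

Section Swap.
Variables (A B C : gmodType gT) (m : pairing A B C).
Fact swap_biadd : biadditive (fun b a => m a b).
Proof. by split=> [a b b'|b a a']; [exact: pairBr|exact: pairBl]. Qed.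
Definition swap_pairing : pairing B A C :=
  Pairing swap_biadd (fun g b a => pairJ m g a b).

Fact curry_subproof a : (m a : B -> C) \in @additive_pred gT B C.
Proof. by apply/asboolP => b b'; exact: pairBr. Qed.
Definition curry_fun a : homZ B C := HomZ (curry_subproof a).
Fact curryB : zmod_morphism curry_fun.
Proof. by move=> a a'; apply: homZ_ext => b /=; rewrite pairBl. Qed.
Fact curryJ g a : curry_fun (gact g a) = gact g (curry_fun a).
Proof. by apply: homZ_ext => b /=; rewrite -pairJ gactVK. Qed.
Definition curry : ghom A (homZ B C) := GHom curryB curryJ.
End Swap.

Definition map_pairing A' B' A B C (m : pairing A B C) (a : ghom A' A) (b : ghom B' B) :
    pairing A' B' C.
Proof.
exists (fun x y => m (a x) (b y)).
- by split=> [y x x'|x y y']; rewrite raddfB (pairBl, pairBr).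
- by move=> g x y; rewrite !ghomJ pairJ.
Defined.

Fact homZ_eval_biadd A B : biadditive (fun (f : homZ A B) x => f x).
Proof. by split=> [x f h|f x y] //; rewrite raddfB. Qed.
Fact homZ_evalJ A B g (f : homZ A B) x : gact g f (gact g x) = gact g (f x).
Proof. by rewrite /= gactK. Qed.
Definition homZ_eval A B : pairing (homZ A B) A B :=
  Pairing (@homZ_eval_biadd A B) (@homZ_evalJ A B).

Fact scal_biadd A : biadditive (fun (n : trivZ gT) (a : A) => a *~ n).
Proof. by split=> [a m n|n a b]; [rewrite mulrzBr|rewrite mulrzBl]. Qed.
Fact scalJ A g (n : trivZ gT) (a : A) : gact g a *~ (gact g n) = gact g (a *~ n).
Proof. by rewrite raddfMz. Qed.
Definition scal_pairing A : pairing (trivZ gT) A A :=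
  Pairing (@scal_biadd A) (@scalJ A).

Definition hom_tens_fun X A B (t : tensor X A) (f : homZ A B) : tensor X B := tmap id f t.

Fact hom_tens_biadd X A B : biadditive (@hom_tens_fun X A B).
Proof.
have tB (f : homZ A B) : zmod_morphism (fun t : tensor X A => hom_tens_fun t f).
  by apply: tmapB => //; exact: homZ_is_zmod_morphism.
split=> // t f h; rewrite -[RHS]/((fun t => hom_tens_fun t f - hom_tens_fun t h) t).
move: t; apply: tensor_ext => [|u v|x a]; first exact: tB.
  by rewrite !tB opprD addrACA -opprD.
by rewrite /hom_tens_fun !tmapE //; try exact: homZ_is_zmod_morphism; rewrite -tpureBr.
Qed.
Lemma hom_tensE X A B x a (f : homZ A B) :
  hom_tens_fun (tpure x a : tensor X A) f = tpure x (f a).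
Proof. by rewrite /hom_tens_fun tmapE //; exact: homZ_is_zmod_morphism. Qed.
Fact hom_tensJ X A B g (t : tensor X A) (f : homZ A B) :
  hom_tens_fun (gact g t) (gact g f) = gact g (hom_tens_fun t f).
Proof.
have [tB _] := @hom_tens_biadd X A B.
move: t; apply: tensor_ext => [u v|u v|x a].
- by rewrite raddfB tB.
- by rewrite tB raddfB.
- by rewrite gact_tpure !hom_tensE gact_tpure /= gactK.
Qed.
Definition hom_tens X A B : pairing (tensor X A) (homZ A B) (tensor X B) :=
  Pairing (@hom_tens_biadd X A B) (@hom_tensJ X A B).

Lemma hom_tens_comp X A B C t (f : homZ A B) (h : homZ B C) :
  hom_tens X B C (hom_tens X A B t f) h = hom_tens X A C t (hcomp h f).
Proof.
move: t; apply: tensor_ext => [u v|u v|x a]; rewrite ?pairBl //.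
by rewrite /= !hom_tensE.
Qed.

Lemma hom_tens_id X A (t : tensor X A) : hom_tens X A A t (idZ A) = t.
Proof.
move: t; apply: tensor_ext => [u v|u v|x a]; rewrite ?pairBl //.
by rewrite /= hom_tensE.
Qed.

End HomPairings.

Section AugIdealClasses.
Variable gT : finGroupType.
Local Notation I := (augIdeal gT).
Local Notation Z := (trivZ gT).
Implicit Types (A B C P Q : gmodType gT) (x y u g : gT).

Definition gr_delta x : group_ring gT := [ffun h => (h == x)%:Z].

Lemma aug_delta x : aug (gr_delta x) = 1.
Proof.
rewrite /aug; under eq_bigr do rewrite ffunE.
by rewrite (bigD1 x) //= eqxx big1 ?addr0 // => h /negPf ->.
Qed.

Lemma gact_delta g x : gact g (gr_delta x) = gr_delta (g * x)%g.
Proof.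
by apply/ffunP => h; rewrite !ffunE -(inj_eq (mulgI g)) mulKVg.
Qed.

Fact aug_diff_subproof x y : gr_delta y - gr_delta x \in @aug_ker gT.
Proof. by rewrite unfold_in raddfB /= !aug_delta subrr. Qed.
Definition aug_diff x y : I := AugIdeal (aug_diff_subproof x y).

Lemma gact_aug_diff g x y : gact g (aug_diff x y) = aug_diff (g * x)%g (g * y)%g.
Proof. by apply: val_inj; rewrite /= raddfB /= !gact_delta. Qed.

Lemma aug_diffN x y : aug_diff x y = - aug_diff y x.
Proof. by apply: val_inj; rewrite raddfN /= opprB. Qed.

Lemma aug_diff_trans x y z : aug_diff x y + aug_diff y z = aug_diff x z.
Proof. by apply: val_inj; rewrite raddfD /= addrC addrA subrK. Qed.

Fact coef_subproof u : (fun a : I => val a u : Z) \in @additive_pred gT I Z.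
Proof. by apply/asboolP => a b; rewrite raddfB /= !ffunE. Qed.
Definition coef u : homZ I Z := HomZ (coef_subproof u).

Lemma gact_coef g u : gact g (coef u) = coef (g * u)%g.
Proof. by apply: homZ_ext => a /=; rewrite ffunE invgK. Qed.

Lemma sum_coef : \sum_u coef u = 0.
Proof.
apply: homZ_ext => a; rewrite homZ_sumE; apply/eqP; exact: (aug_valP a).
Qed.

(** Replacing u by u - 1 changes the expansion of a by the sum of its coefficients, which is 0 on
    I_G. This identity makes w w' = id exact on cochains. *)
Lemma aug_expand (a : I) : \sum_u aug_diff 1 u *~ (coef u a) = a.
Proof.
have vB : zmod_morphism (val : I -> group_ring gT) by exact: raddfB.
apply: val_inj; rewrite raddf_sum; apply/ffunP => h.
rewrite sum_ffunE.
transitivity (\sum_u ((h == u)%:Z - (h == 1%g)%:Z) * coef u a).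
  apply: eq_bigr => u _; rewrite raddfMz.
  have eB : zmod_morphism (fun b : group_ring gT => b h : int).
    by move=> b c; rewrite !ffunE.
  pose e : {additive group_ring gT -> int} :=
    HB.pack (fun b : group_ring gT => b h : int) (GRing.isZmodMorphism.Build _ _ _ eB).
  by rewrite -[LHS]/(e _) raddfMz /= !ffunE -mulrzr intz.
under eq_bigr do rewrite mulrBl.
rewrite sumrB (bigD1 h) //= eqxx mul1r big1 ?addr0 => [|u /negPf]; last first.
  by rewrite eq_sym => ->; rewrite mul0r.
rewrite -mulr_sumr; have /eqP := aug_valP a; rewrite /aug => H.
by rewrite [X in _ * X]H mulr0 subr0.
Qed.

(** By [aug_expand] this is the trace of the identity of I_G, hence its rank. *)
Lemma sum_coef_diff : \sum_u coef u (aug_diff 1 u) = #|gT|%:Z - 1.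
Proof.
rewrite /=; under eq_bigr do rewrite !ffunE eqxx.
rewrite sumrB sumr_const -[1 *+ _]/(#|gT|%:R) natz; congr (_ - _).
by rewrite (bigD1 1%g) //= eqxx big1 ?addr0 // => h /negPf ->.
Qed.

Definition aug_cochain (s : seq gT) : I := if s is [:: x; y] then aug_diff x y else 0.
Definition coef_cochain (s : seq gT) : homZ I Z := if s is [:: x] then coef x else 0.

Lemma aug_cochainP : is_cocycle 1 aug_cochain.
Proof.
split; first split.
- by case=> // x [|y []].
- by move=> g [|x [|y []]] /=; rewrite ?raddf0 ?gact_aug_diff.
apply/funext => s; rewrite /tdiff; case: ifP => //.
case: s => // x [|y [|z []]] // _.
rewrite [LHS]/= !diff_del_cons diff_del_nil subr0 /=.
by rewrite -(aug_diff_trans x y z) (addrC _ (aug_diff y z)) addrK subrr.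
Qed.

Lemma coef_cochainP : is_cocycle (-1) coef_cochain.
Proof.
split; first split.
- by case=> // x [].
- by move=> g [|x []] /=; rewrite ?raddf0 ?gact_coef.
apply/funext => s; rewrite /tdiff; case: ifP => //.
case: s => // x [] // _; exact: sum_coef.
Qed.

Definition aug_class : tateH 1 I := tclass (mk_cocycle aug_cochainP).
Definition coef_class : tateH (-1) (homZ I Z) := tclass (mk_cocycle coef_cochainP).

(** Here u is the first entry of the pair given to [aug_cochain], while in [cup_aug_coef] it is the
    second. As [aug_diff] is antisymmetric, this asymmetry is the source of the signs of the
    inverses below. *)
Lemma cup_coef_aug C (m : pairing (homZ I Z) I C) (e : -1 + 1 = 0) :
  pcup m e coef_class aug_class = cls0 (\sum_u m (coef u) (aug_diff u 1)).
Proof.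
have [z zE ->] := pcupEx m e (mk_cocycle coef_cochainP) (mk_cocycle aug_cochainP).
rewrite (tclass0E z).2 zE /mcup /=; congr cls0.
rewrite -[LHS]/(tsum 1 (fun t => m (coef_cochain t) (aug_cochain (rev t ++ [:: 1%g])))).
by rewrite tsumS; apply: eq_bigr => u _; rewrite tsum0.
Qed.

Lemma cup_aug_coef C (m : pairing I (homZ I Z) C) (e : 1 + -1 = 0) :
  pcup m e aug_class coef_class = cls0 (\sum_u m (aug_diff 1 u) (coef u)).
Proof.
have [z zE ->] := pcupEx m e (mk_cocycle aug_cochainP) (mk_cocycle coef_cochainP).
rewrite (tclass0E z).2 zE /mcup /=; congr cls0.
rewrite -[LHS]/(tsum 1 (fun t => m (aug_cochain ([:: 1%g] ++ t)) (coef_cochain (rev t)))).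
by rewrite tsumS; apply: eq_bigr => u _; rewrite tsum0.
Qed.

End AugIdealClasses.

(** * The graded category of G-modules *)

Lemma int_step_ind (P : int -> Prop) i : P i ->
  (forall n, P n -> P (n + 1)) -> (forall n, P n -> P (n - 1)) -> forall n, P n.
Proof.
move=> Pi PS PP n; rewrite -(subrK i n); case: (n - i) => k.
  elim: k => [|k IH]; first by rewrite add0r.
  by rewrite (_ : k.+1%:Z + i = k%:Z + i + 1); [exact: PS|lia].
elim: k => [|k IH]; first by rewrite (_ : Negz 0 + i = i - 1); [exact: PP|lia].
by rewrite (_ : Negz k.+1 + i = Negz k + i - 1); [exact: PP|lia].
Qed.

Section Graded.
Variable gT : finGroupType.
Local Notation I := (augIdeal gT).
Local Notation Z := (trivZ gT).
Implicit Types (A B C D M P Q : gmodType gT) (n p q r : int).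

Definition gcomp A B C p q n (e : p + q = n) x y := pcup (comp_pairing A B C) e x y.
(* The pairing is swapped but the cup product is not: no Koszul sign appears. *)
Definition gcomp_op A B C p q n (e : p + q = n) x y :=
  pcup (swap_pairing (comp_pairing A B C)) e x y.
Definition idc A : tateH 0 (homZ A A) := cls0 (idZ A).

Lemma invariant_idZ A : invariant (idZ A).
Proof. exact: invariant_ghom_homZ. Qed.

Lemma gcompA A B C D p q r pq qr n (e1 : p + q = pq) (e2 : pq + r = n)
    (e3 : q + r = qr) (e4 : p + qr = n) x y z :
  gcomp e2 (@gcomp B C D p q pq e1 x y) z = gcomp e4 x (@gcomp A B C q r qr e3 y z).
Proof. by apply: pcupA => a b c; exact: homZ_ext. Qed.

Lemma gcomp1l A B q (e : 0 + q = q) (y : tateH q (homZ A B)) : gcomp e (idc B) y = y.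
Proof.
rewrite /gcomp (pcup_cls0l _ (k := ghom_id (homZ A B))) ?tate_map_id //.
  exact: invariant_idZ.
by move=> b; exact: hcomp1l.
Qed.

Lemma gcomp1r A B q (e : q + 0 = q) (y : tateH q (homZ A B)) : gcomp e y (idc A) = y.
Proof.
rewrite /gcomp (pcup_cls0r _ (k := ghom_id (homZ A B))) ?tate_map_id //.
  exact: invariant_idZ.
by move=> b; exact: hcomp1r.
Qed.

(** The degree r' is a variable subject to equations and not the term - r, so that an inverse in a
    degree only provably equal to - r can be used as it stands. *)
Definition inverse_classes A B r r' (z : tateH r (homZ A B)) (z' : tateH r' (homZ B A)) :=
  exists (e : r + r' = 0) (e' : r' + r = 0),
    gcomp e' z' z = idc A /\ gcomp e z z' = idc B.

(* Condition (d), for X' = A and X = B. *)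
Definition shift_iso r A B := exists r' z z', @inverse_classes A B r r' z z'.

Lemma shift_isoP r A B : shift_iso r A B <->
  exists (z : tateH r (homZ A B)) (z' : tateH (- r) (homZ B A)), inverse_classes z z'.
Proof.
split=> [[r' [z [z' H]]]|[z [z' H]]]; last by exists (- r), z, z'.
have [e _] := H; have E : - r = r' by lia.
by case: r' / E z' H {e} => z' H; exists z, z'.
Qed.

Lemma shift_iso_sym r A B : shift_iso r A B -> shift_iso (- r) B A.
Proof.
case/shift_isoP=> z [z' [e [e' [H1 H2]]]].
by exists r, z', z, e', e.
Qed.

Lemma shift_iso_trans r s t A B C : r + s = t ->
  shift_iso r A B -> shift_iso s B C -> shift_iso t A C.
Proof.
move=> rst /shift_isoP[z [z' [e1 [e1' [H1 H1']]]]] /shift_isoP[y [y' [e2 [e2' [H2 H2']]]]].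
have st : s + r = t by lia.
have st' : - r - s = - t by lia.
have [et et'] : t - t = 0 /\ - t + t = 0 by lia.
have [er es] : - s + t = r /\ r - t = - s by lia.
have [r0 s0] : 0 + r = r /\ 0 - s = - s by lia.
exists (- t), (gcomp st y z), (gcomp st' z' y'), et, et'; split.
  rewrite (gcompA _ _ er e1') -(gcompA e2' r0 st er) H2 gcomp1l; exact: H1.
rewrite (gcompA _ _ es e2) -(gcompA e1 s0 st' es) H1' gcomp1l; exact: H2'.
Qed.

Lemma shift_iso_ghom A B (k : ghom A B) (l : ghom B A) :
  cancel k l -> cancel l k -> shift_iso 0 A B.
Proof.
move=> kl lk; have e : 0 + 0 = 0 :> int by [].
have comp_cls0 C D E (f : ghom D E) (h : ghom C D) :
    gcomp e (cls0 (ghom_homZ f)) (cls0 (ghom_homZ h)) = cls0 (hcomp (ghom_homZ f) (ghom_homZ h)).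
  rewrite /gcomp (pcup_cls0l _ (k := homZ_map C f)).
  - by rewrite tate_map_cls0; [congr cls0; exact: homZ_ext|exact: invariant_ghom_homZ].
  - exact: invariant_ghom_homZ.
  - by move=> b; exact: homZ_ext.
exists 0, (cls0 (ghom_homZ k)), (cls0 (ghom_homZ l)), e, e.
by rewrite !comp_cls0; split; congr cls0; apply: homZ_ext => x /=.
Qed.

(** Modelled on P = A and Q = I_G (x) A: the two conditions are contraction and expansion over the
    dual families u - 1 and [coef u], and they make the images of w and w' mutually inverse. With t
    and t' abstract, the functors X (x) - and Hom(-, D) can be applied to them. *)
Definition upshift P Q (t : ghom I (homZ P Q)) (t' : ghom (homZ I Z) (homZ Q P)) :=
  (forall f b, hcomp (t' f) (t b) = idZ P *~ (f b)) /\
  \sum_u hcomp (t (aug_diff 1 u)) (t' (coef u)) = idZ Q.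

Definition downshift P Q (t : ghom (homZ I Z) (homZ P Q)) (t' : ghom I (homZ Q P)) :=
  (forall f b, hcomp (t' b) (t f) = idZ P *~ (f b)) /\
  \sum_u hcomp (t (coef u)) (t' (aug_diff 1 u)) = idZ Q.

Lemma cls0_sum_coef_diff A :
  cls0 (\sum_(u : gT) idZ A *~ coef u (aug_diff 1 u)) = - idc A.
Proof.
rewrite -mulrz_sumr sum_coef_diff mulrzBr mulr1z cls0B ?cls0_card ?sub0r //.
- exact: invariant_idZ.
- exact/invariantMz/invariant_idZ.
- exact: invariant_idZ.
Qed.

Lemma invariant_idZ_sum A :
  invariant (\sum_(u : gT) idZ A *~ coef u (aug_diff 1 u)).
Proof. by rewrite -mulrz_sumr; exact/invariantMz/invariant_idZ. Qed.

Section Up.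
Variables (P Q : gmodType gT) (t : ghom I (homZ P Q)) (t' : ghom (homZ I Z) (homZ Q P)).
Hypothesis tP : upshift t t'.
Let z := tate_map t (aug_class gT).
Let z' := tate_map t' (coef_class gT).

Lemma upshift_inverse : inverse_classes z z'.
Proof.
have [e e'] : 1 + -1 = 0 :> int /\ -1 + 1 = 0 :> int by [].
exists e, e'; split.
  rewrite /gcomp (pcup_mapl (m' := map_pairing (comp_pairing _ _ _) t' (ghom_id _))) //.
  rewrite (pcup_mapr (m' := map_pairing (comp_pairing _ _ _) t' t)) //.
  rewrite cup_coef_aug -[RHS]opprK -cls0_sum_coef_diff -cls0N; last first.
    by apply: invariant_idZ_sum.
  congr cls0; rewrite -sumrN; apply: eq_bigr => u _.
  by rewrite -tP.1 (aug_diffN u 1%g) pairNr.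
rewrite /gcomp (pcup_mapl (m' := map_pairing (comp_pairing _ _ _) t (ghom_id _))) //.
rewrite (pcup_mapr (m' := map_pairing (comp_pairing _ _ _) t t')) //.
by rewrite cup_aug_coef; congr cls0; exact: tP.2.
Qed.

(** In swapped order the contraction is the sum of the [coef u (aug_diff 1 u)], that is |G| - 1,
    whose class is -1 and not 1; hence the sign on z'. *)
Lemma upshift_inverse_op (e : 1 + -1 = 0) (e' : -1 + 1 = 0) :
  gcomp_op e z (- z') = idc P /\ gcomp_op e' (- z') z = idc Q.
Proof.
rewrite /gcomp_op pcupNr pcupNl; split.
  rewrite (pcup_mapl (m' := map_pairing (swap_pairing (comp_pairing _ _ _)) t (ghom_id _))) //.
  rewrite (pcup_mapr (m' := map_pairing (swap_pairing (comp_pairing _ _ _)) t t')) //.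
  rewrite cup_aug_coef -[RHS]opprK -cls0_sum_coef_diff; congr (- cls0 _).
  by apply: eq_bigr => u _; rewrite -tP.1.
rewrite (pcup_mapl (m' := map_pairing (swap_pairing (comp_pairing _ _ _)) t' (ghom_id _))) //.
rewrite (pcup_mapr (m' := map_pairing (swap_pairing (comp_pairing _ _ _)) t' t)) //.
rewrite cup_coef_aug -[RHS]opprK; congr (- _).
rewrite /idc -cls0N; last exact: invariant_idZ.
congr cls0; rewrite -tP.2 -sumrN; apply: eq_bigr => u _.
by rewrite (aug_diffN u 1%g) pairNr.
Qed.
End Up.

Section Down.
Variables (P Q : gmodType gT) (t : ghom (homZ I Z) (homZ P Q)) (t' : ghom I (homZ Q P)).
Hypothesis tP : downshift t t'.
Let z := tate_map t (coef_class gT).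
Let z' := tate_map t' (aug_class gT).

Lemma downshift_inverse : inverse_classes z (- z').
Proof.
have [e e'] : 1 + -1 = 0 :> int /\ -1 + 1 = 0 :> int by [].
exists e', e; rewrite /gcomp pcupNr pcupNl; split.
  rewrite (pcup_mapl (m' := map_pairing (comp_pairing _ _ _) t' (ghom_id _))) //.
  rewrite (pcup_mapr (m' := map_pairing (comp_pairing _ _ _) t' t)) //.
  rewrite cup_aug_coef -[RHS]opprK -cls0_sum_coef_diff; congr (- cls0 _).
  by apply: eq_bigr => u _; rewrite -tP.1.
rewrite (pcup_mapl (m' := map_pairing (comp_pairing _ _ _) t (ghom_id _))) //.
rewrite (pcup_mapr (m' := map_pairing (comp_pairing _ _ _) t t')) //.
rewrite cup_coef_aug -[RHS]opprK; congr (- _).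
rewrite /idc -cls0N; last exact: invariant_idZ.
congr cls0; rewrite -tP.2 -sumrN; apply: eq_bigr => u _.
by rewrite (aug_diffN u 1%g) pairNr.
Qed.

Lemma downshift_inverse_op (e : 1 + -1 = 0) (e' : -1 + 1 = 0) :
  gcomp_op e' z z' = idc P /\ gcomp_op e z' z = idc Q.
Proof.
rewrite /gcomp_op; split.
  rewrite (pcup_mapl (m' := map_pairing (swap_pairing (comp_pairing _ _ _)) t (ghom_id _))) //.
  rewrite (pcup_mapr (m' := map_pairing (swap_pairing (comp_pairing _ _ _)) t t')) //.
  rewrite cup_coef_aug -[RHS]opprK -cls0_sum_coef_diff -cls0N; last first.
    by apply: invariant_idZ_sum.
  congr cls0; rewrite -sumrN; apply: eq_bigr => u _.
  by rewrite -tP.1 (aug_diffN u 1%g) pairNr.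
rewrite (pcup_mapl (m' := map_pairing (swap_pairing (comp_pairing _ _ _)) t' (ghom_id _))) //.
rewrite (pcup_mapr (m' := map_pairing (swap_pairing (comp_pairing _ _ _)) t' t)) //.
by rewrite cup_aug_coef; congr cls0; exact: tP.2.
Qed.
End Down.

End Graded.

(** * Degree shifts by tensor powers of the augmentation ideal and by their duals *)

Section ShiftData.
Variable gT : finGroupType.
Local Notation I := (augIdeal gT).
Local Notation Z := (trivZ gT).
Implicit Types (A B C D M P Q X : gmodType gT) (n p q r : int).

Definition post_pairing A B C C' (k : ghom C C') (m : pairing A B C) : pairing A B C'.
Proof.
exists (fun a b => k (m a b)).
- by split=> [b a a'|a b b']; rewrite (pairBl, pairBr) raddfB.
- by move=> g a b; rewrite pairJ ghomJ.
Defined.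

Definition contr A : pairing (homZ I Z) (tensor I A) A :=
  post_pairing (pair_ghom (scal_pairing A)) (eval_pairing I Z A).

Lemma contrE A f b a : contr A f (tpure b a) = a *~ f b.
Proof. by rewrite /contr /= hevalE; exact: (pair_ghomE (scal_pairing A)). Qed.

Definition up A : ghom I (homZ A (tensor I A)) := curry (tensor_pairing I A).
Definition up' A : ghom (homZ I Z) (homZ (tensor I A) A) := curry (contr A).

Lemma upshift_up A : upshift (up A) (up' A).
Proof.
split=> [f b|]; apply: homZ_ext; first by move=> x; rewrite homZMzE; exact: contrE.
have B : zmod_morphism (\sum_u hcomp (up A (aug_diff 1 u)) (up' A (coef u))).
  exact: homZ_is_zmod_morphism.
apply: tensor_ext => // b a; rewrite homZ_sumE.
rewrite -[RHS]/(tpure b a) -[b in RHS]aug_expand tpure_suml; apply: eq_bigr => u _.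
rewrite -[LHS]/(tensor_pairing I A (aug_diff 1 u) (contr A (coef u) (tpure b a))).
rewrite contrE -[RHS]/(tensor_pairing I A (aug_diff 1 u *~ _) a).
by rewrite pairMzl pairMzr.
Qed.

(** Uncurried, it takes f, a and b to f(b) a; its partner [down'] evaluates at b. *)
Definition down A : ghom (homZ I Z) (homZ A (homZ I A)) :=
  curry (swap_pairing (map_pairing (comp_pairing I Z A)
    (curry (swap_pairing (scal_pairing A))) (ghom_id (homZ I Z)))).
Definition down' A : ghom I (homZ (homZ I A) A) := curry (swap_pairing (homZ_eval I A)).

Lemma downshift_down A : downshift (down A) (down' A).
Proof.
split=> [f b|]; apply: homZ_ext; first by move=> x; rewrite homZMzE.
move=> k; rewrite homZ_sumE; apply: homZ_ext => b; rewrite homZ_sumE.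
rewrite -[RHS]/(k b) -[in RHS](aug_expand b) raddf_sum; apply: eq_bigr => u _.
by rewrite raddfMz.
Qed.

Definition homZ_tens X A B : ghom (homZ A B) (homZ (tensor X A) (tensor X B)) :=
  curry (swap_pairing (hom_tens X A B)).
Definition homZ_pre A B C : ghom (homZ A B) (homZ (homZ B C) (homZ A C)) :=
  curry (swap_pairing (comp_pairing A B C)).

Lemma homZ_tens_comp X A B C (f : homZ B C) (h : homZ A B) :
  hcomp (homZ_tens X B C f) (homZ_tens X A B h) = homZ_tens X A C (hcomp f h).
Proof. by apply: homZ_ext => t; exact: hom_tens_comp. Qed.
Lemma homZ_tens_id X A : homZ_tens X A A (idZ A) = idZ (tensor X A).
Proof. by apply: homZ_ext => t; exact: hom_tens_id. Qed.
Lemma homZ_pre_comp A B C D (f : homZ B C) (h : homZ A B) :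
  hcomp (homZ_pre A B D h) (homZ_pre B C D f) = homZ_pre A C D (hcomp f h).
Proof. by apply: homZ_ext => k; exact: homZ_ext. Qed.
Lemma homZ_pre_id A D : homZ_pre A A D (idZ A) = idZ (homZ A D).
Proof. by apply: homZ_ext => k; exact: homZ_ext. Qed.

Lemma upshift_tens X P Q (t : ghom I (homZ P Q)) (t' : ghom (homZ I Z) (homZ Q P)) :
  upshift t t' ->
  upshift (ghom_comp (homZ_tens X P Q) t) (ghom_comp (homZ_tens X Q P) t').
Proof.
case=> H1 H2; split=> [f b|].
  by rewrite [LHS]homZ_tens_comp H1 raddfMz /= -homZ_tens_id.
rewrite -homZ_tens_id -H2 raddf_sum; apply: eq_bigr => u _.
exact: homZ_tens_comp.
Qed.

Lemma downshift_tens X P Q (t : ghom (homZ I Z) (homZ P Q)) (t' : ghom I (homZ Q P)) :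
  downshift t t' ->
  downshift (ghom_comp (homZ_tens X P Q) t) (ghom_comp (homZ_tens X Q P) t').
Proof.
case=> H1 H2; split=> [f b|].
  by rewrite [LHS]homZ_tens_comp H1 raddfMz /= -homZ_tens_id.
rewrite -homZ_tens_id -H2 raddf_sum; apply: eq_bigr => u _.
exact: homZ_tens_comp.
Qed.

(** Hom(-, D) reverses composition, so t and t' exchange their roles and a shift by 1 becomes a
    shift by -1. *)
Lemma downshift_pre D P Q (t : ghom I (homZ P Q)) (t' : ghom (homZ I Z) (homZ Q P)) :
  upshift t t' ->
  downshift (ghom_comp (homZ_pre Q P D) t') (ghom_comp (homZ_pre P Q D) t).
Proof.
case=> H1 H2; split=> [f b|].
  by rewrite [LHS]homZ_pre_comp H1 raddfMz /= -homZ_pre_id.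
rewrite -homZ_pre_id -H2 raddf_sum; apply: eq_bigr => u _.
exact: homZ_pre_comp.
Qed.

Lemma shift_iso_up P Q (t : ghom I (homZ P Q)) (t' : ghom (homZ I Z) (homZ Q P)) :
  upshift t t' -> shift_iso 1 P Q.
Proof. by move=> /upshift_inverse H; do 3 eexists; exact: H. Qed.

Lemma shift_iso_down P Q (t : ghom (homZ I Z) (homZ P Q)) (t' : ghom I (homZ Q P)) :
  downshift t t' -> shift_iso (-1) P Q.
Proof. by move=> /downshift_inverse H; do 3 eexists; exact: H. Qed.

Lemma shift_iso_refl A : shift_iso 0 A A.
Proof. exact: (@shift_iso_ghom _ A A (ghom_id A) (ghom_id A)). Qed.

Lemma shift_iso_exists r A : exists B, shift_iso r A B.
Proof.
move: r; apply: (@int_step_ind _ 0) => [|n [B AB]|n [B AB]].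
- by exists A; exact: shift_iso_refl.
- exists (tensor I B : gmodType gT); apply: shift_iso_trans AB _ => //.
  exact: shift_iso_up (upshift_up B).
- exists (homZ I B : gmodType gT); apply: shift_iso_trans AB _ => //.
  exact: shift_iso_down (downshift_down B).
Qed.

Lemma shift_iso_tensZ X : shift_iso 0 X (tensor X Z : gmodType gT).
Proof.
pose k := swap_pairing (scal_pairing X).
have one_inv g : gact g (1 : Z) = 1 by [].
have @l : ghom X (tensor X Z).
  exists (fun x => tpure x (1 : Z)) => [x y|g x]; first exact: tpureBl.
  by rewrite gact_tpure one_inv.
apply: (@shift_iso_ghom _ X (tensor X Z : gmodType gT) l (pair_ghom k)) => [x|].
  by rewrite (pair_ghomE k) /= mulr1z.
have kB := ghomB (ghom_comp l (pair_ghom k)).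
apply: (tensor_ext (f := ghom_comp l (pair_ghom k)) (h := id)) => // x n.
rewrite -[LHS]/(l (pair_ghom k (tpure x n))) (pair_ghomE k).
rewrite -[LHS]/(tensor_pairing X Z (x *~ n) 1) pairMzl -pairMzr.
by rewrite -[in RHS](intz n).
Qed.

Lemma shift_iso_pow X (n : nat) :
  shift_iso n X (tensor X (tensor_pow I n) : gmodType gT).
Proof.
elim: n => [|n IH]; first exact: shift_iso_tensZ.
apply: shift_iso_trans IH (shift_iso_up (upshift_tens X (upshift_up _))).
by rewrite -PoszD addn1.
Qed.

(** Base case of [shift_iso_negpow]: the dual of the zeroth power is Hom(Z, Z) and not Z itself. *)
Lemma shift_iso_homZ X : shift_iso 0 X (tensor X (homZ Z Z) : gmodType gT).
Proof.
have one_inv g : gact g (1 : Z) = 1 by [].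
have @ev1 : ghom (homZ Z Z) Z.
  by exists (fun f : homZ Z Z => f (1 : Z)) => [f h|g f].
pose k := map_pairing (swap_pairing (scal_pairing X)) (ghom_id X) ev1.
have @l : ghom X (tensor X (homZ Z Z)).
  exists (fun x => tpure x (idZ Z)) => [x y|g x]; first exact: tpureBl.
  by rewrite gact_tpure (invariant_idZ _ g).
apply: (@shift_iso_ghom _ X _ l (pair_ghom k)) => [x|].
  by rewrite (pair_ghomE k) /= mulr1z.
have kB := ghomB (ghom_comp l (pair_ghom k)).
apply: (tensor_ext (f := ghom_comp l (pair_ghom k)) (h := id)) => // x f.
rewrite -[LHS]/(l (pair_ghom k (tpure x f))) (pair_ghomE k).
rewrite -[LHS]/(tensor_pairing X (homZ Z Z) (x *~ ev1 f) (idZ Z)) pairMzl -pairMzr.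
congr (tpure x _); apply: homZ_ext => n; rewrite homZMzE.
have E (i j : int) : i *~ j = j *~ i by rewrite !mulrzz mulrC.
transitivity (f (1 : Z) *~ n); first exact: E.
by rewrite -(raddfMz f); congr (f _); exact: intz.
Qed.

(** The shift from one tensor power of I_G to the next is dualized as a whole, so the dual of a
    power is never compared with a power of the dual. *)
Lemma shift_iso_negpow X (n : nat) :
  shift_iso (- n%:Z) X (tensor X (homZ (tensor_pow I n) Z) : gmodType gT).
Proof.
elim: n => [|n IH]; first exact: shift_iso_homZ.
apply: shift_iso_trans IH
  (shift_iso_down (downshift_tens X (downshift_pre Z (upshift_up _)))).
lia.
Qed.

End ShiftData.

(** * Natural isomorphisms and degree shifts *)

Section RightFunctors.
Variable gT : finGroupType.
Local Notation I := (augIdeal gT).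
Local Notation Z := (trivZ gT).
Implicit Types (A B C D M P Q X : gmodType gT) (n p q r : int).

(* Common features of Hom(X, -) and X (x) -: additive maps A -> B act on the
   right, compatibly with the action of G. *)
Record right_functor := RightFunctor {
  robj :> gmodType gT -> gmodType gT;
  ract : forall A B, pairing (robj A) (homZ A B) (robj B);
  ract_comp : forall A B C t (f : homZ A B) (h : homZ B C),
    ract B C (ract A B t f) h = ract A C t (hcomp h f);
  ract_id : forall A t, ract A A t (idZ A) = t
}.

Definition homR X : right_functor.
Proof.
exists (fun A => homZ X A) (fun A B => swap_pairing (comp_pairing X A B)).
- by move=> *; exact: homZ_ext.
- by move=> *; exact: homZ_ext.
Defined.

Definition tensR X : right_functor :=
  @RightFunctor (fun A => tensor X A) (hom_tens X) (@hom_tens_comp gT X) (@hom_tens_id gT X).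

Section RMap.
Variables (T : right_functor) (A B : gmodType gT) (k : ghom A B).
Definition rmap_fun (t : T A) : T B := ract T A B t (ghom_homZ k).
Fact rmapB : zmod_morphism rmap_fun.
Proof. by move=> t u; exact: pairBl. Qed.
Fact rmapJ g t : rmap_fun (gact g t) = gact g (rmap_fun t).
Proof. by rewrite /rmap_fun -pairJ ghom_homZ_inv. Qed.
Definition rmap : ghom (T A) (T B) := GHom rmapB rmapJ.
End RMap.

Definition cup_act (T : right_functor) A B p q n (e : p + q = n)
    (y : tateH p (T A)) (z : tateH q (homZ A B)) : tateH n (T B) :=
  pcup (ract T A B) e y z.

Lemma cup_actA (T : right_functor) A B C p q r pq qr n (e1 : p + q = pq)
    (e2 : pq + r = n) (e3 : q + r = qr) (e4 : p + qr = n) y z z' :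
  @cup_act T B C pq r n e2 (@cup_act T A B p q pq e1 y z) z' =
  cup_act e4 y (gcomp_op e3 z z').
Proof. by apply: pcupA => a b c; exact: ract_comp. Qed.

Lemma cup_act1 (T : right_functor) A p (e : p + 0 = p) (y : tateH p (T A)) :
  cup_act e y (idc A) = y.
Proof.
rewrite /cup_act (pcup_cls0r _ (k := ghom_id (T A))) ?tate_map_id //.
  exact: invariant_idZ.
by move=> a; exact: ract_id.
Qed.

Lemma cup_actK (T : right_functor) A B r r' (z : tateH r (homZ A B))
    (z' : tateH r' (homZ B A)) p q (e1 : p + r = q) (e2 : q + r' = p) (e3 : r + r' = 0) :
  gcomp_op e3 z z' = idc A -> forall y : tateH p (T A), cup_act e2 (cup_act e1 y z) z' = y.
Proof.
move=> H y; have e4 : p + 0 = p by lia.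
by rewrite (cup_actA _ _ e3 e4) H cup_act1.
Qed.

Definition nat_iso_between (T T' : right_functor) i j : Prop :=
  exists phi : forall A, tateH i (T A) -> tateH j (T' A),
  [/\ forall A, zmod_morphism (phi A), forall A, bijective (phi A) &
   forall A B (k : ghom A B) x,
     phi B (tate_map (rmap T k) x) = tate_map (rmap T' k) (phi A x)].

(** The component at A is that of phi at S A, conjugated by the invertible class z. Since z acts on
    the variable and not on the functors, T and T' stay the same; naturality of the new family only
    asks that z commute with the maps induced by k. *)
Lemma nat_iso_between_shift (d d' : int) (S : gmodType gT -> gmodType gT)
    (Smap : forall A B, ghom A B -> ghom (S A) (S B))
    (z : forall A, tateH d (homZ A (S A))) (z' : forall A, tateH d' (homZ (S A) A))
    (e : d + d' = 0) (e' : d' + d = 0) :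
  (forall A, gcomp_op e (z A) (z' A) = idc A /\ gcomp_op e' (z' A) (z A) = idc (S A)) ->
  (forall (T : right_functor) A B (k : ghom A B) n m (en : n + d = m) (y : tateH n (T A)),
     tate_map (rmap T (Smap A B k)) (cup_act en y (z A)) =
     cup_act en (tate_map (rmap T k) y) (z B)) ->
  forall (T T' : right_functor) i j,
  nat_iso_between T T' (i + d) (j + d) -> nat_iso_between T T' i j.
Proof.
move=> zz zN T T' i j [phi [phiB phi_bij phiN]].
have [ei ej] : i + d + d' = i /\ j + d + d' = j by lia.
have K (F : right_functor) n (en : n + d + d' = n) A (y : tateH n (F A)) :
    cup_act en (cup_act erefl y (z A)) (z' A) = y.
  exact: cup_actK (zz A).1 y.
have K' (F : right_functor) n (en : n + d + d' = n) A (y : tateH (n + d) (F (S A))) :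
    cup_act erefl (cup_act en y (z' A)) (z A) = y.
  exact: cup_actK (zz A).2 y.
exists (fun A y => cup_act ej (phi (S A) (cup_act erefl y (z A))) (z' A)); split.
- by move=> A x y; rewrite /cup_act pcupBl phiB pcupBl.
- move=> A; have [psi phiK psiK] := phi_bij (S A).
  exists (fun y => cup_act ei (psi (cup_act erefl y (z A))) (z' A)) => y.
    by rewrite K' phiK K.
  by rewrite K' psiK K.
- move=> A B k y; rewrite -zN phiN; set u := phi _ _.
  by rewrite -{1}(K' _ _ ej _ u) zN K.
Qed.

Lemma rmap_act (T : right_functor) A B A' B' (f : homZ A B) (k : ghom B B')
    (h : ghom A A') (f' : homZ A' B') t :
  hcomp (ghom_homZ k) f = hcomp f' (ghom_homZ h) ->
  rmap T k (ract T A B t f) = ract T A' B' (rmap T h t) f'.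
Proof. by move=> E; rewrite [LHS]ract_comp E -ract_comp. Qed.

Lemma nat_iso_between_up (T T' : right_functor) i j :
  nat_iso_between T T' (i + 1) (j + 1) -> nat_iso_between T T' i j.
Proof.
have [e e'] : 1 + -1 = 0 :> int /\ -1 + 1 = 0 :> int by [].
apply: (nat_iso_between_shift (S := fun A => tensor I A)
  (Smap := fun A B k => tensor_map I k)
  (z := fun A => tate_map (up A) (aug_class gT))
  (z' := fun A => - tate_map (up' A) (coef_class gT)) (e := e) (e' := e')).
  by move=> A; exact: upshift_inverse_op (upshift_up A) e e'.
move=> {}T A B k n m en y; rewrite /cup_act.
rewrite (pcup_mapr (m' := map_pairing (ract T _ _) (ghom_id _) (up A))) //.
rewrite (pcup_mapr (m' := map_pairing (ract T _ _) (ghom_id _) (up B))) //.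
rewrite (pcup_map (m' := map_pairing (ract T _ _) (ghom_id _) (up B))
  (a := rmap T k) (b := ghom_id _)); first by rewrite tate_map_id.
move=> t b; apply: rmap_act; apply: homZ_ext => a.
by rewrite /= tmapE //; exact: ghomB.
Qed.

Lemma nat_iso_between_down (T T' : right_functor) i j :
  nat_iso_between T T' (i - 1) (j - 1) -> nat_iso_between T T' i j.
Proof.
have [e e'] : 1 + -1 = 0 :> int /\ -1 + 1 = 0 :> int by [].
apply: (nat_iso_between_shift (S := fun A => homZ I A)
  (Smap := fun A B k => homZ_map I k)
  (z := fun A => tate_map (down A) (coef_class gT))
  (z' := fun A => tate_map (down' A) (aug_class gT)) (e := e') (e' := e)).
  by move=> A; exact: downshift_inverse_op (downshift_down A) e e'.
move=> {}T A B k n m en y; rewrite /cup_act.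
rewrite (pcup_mapr (m' := map_pairing (ract T _ _) (ghom_id _) (down A))) //.
rewrite (pcup_mapr (m' := map_pairing (ract T _ _) (ghom_id _) (down B))) //.
rewrite (pcup_map (m' := map_pairing (ract T _ _) (ghom_id _) (down B))
  (a := rmap T k) (b := ghom_id _)); first by rewrite tate_map_id.
move=> t f; apply: rmap_act; apply: homZ_ext => a; apply: homZ_ext => b.
by rewrite /= raddfMz.
Qed.

(** It lets (a) and (e), which provide a single degree, be used in degrees 0 and -1, where the
    cohomology is explicit. *)
Lemma nat_iso_between_all (T T' : right_functor) r i :
  nat_iso_between T T' i (i + r) -> forall n, nat_iso_between T T' n (n + r).
Proof.
move=> H; apply: (@int_step_ind (fun n => nat_iso_between T T' n (n + r)) i H) => n Hn.
  apply: nat_iso_between_down.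
  by have [-> ->] : n + 1 - 1 = n /\ n + 1 + r - 1 = n + r by lia.
apply: nat_iso_between_up.
by have [-> ->] : n - 1 + 1 = n /\ n - 1 + r + 1 = n + r by lia.
Qed.

Lemma encoding_pairE r X X' :
  encoding_pair r X X' <-> exists i, nat_iso_between (homR X) (homR X') i (i + r).
Proof.
have E n Y A B (k : ghom A B) : tate_map (n := n) (homZ_map Y k) =1 tate_map (rmap (homR Y) k).
  by apply: eq_tate_map => f; exact: homZ_ext.
split=> -[i [phi [phiB phi_bij phiN]]]; exists i, phi; split=> // A B k x.
  by rewrite -!E; exact: phiN.
by rewrite /= !E; exact: phiN.
Qed.

Lemma tensor_nat_isoE r X X' :
  (exists i (phi : forall A, tensorTate i X' A -> tensorTate (i + r) X A), is_nat_iso phi)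
  <-> exists i, nat_iso_between (tensR X') (tensR X) i (i + r).
Proof.
have E n Y A B (k : ghom A B) : tate_map (n := n) (tensor_map Y k) =1 tate_map (rmap (tensR Y) k).
  by apply: eq_tate_map => f.
split=> -[i [phi [phiB phi_bij phiN]]]; exists i, phi; split=> // A B k x.
  by rewrite -!E; exact: phiN.
by rewrite /= !E; exact: phiN.
Qed.

End RightFunctors.

(** * Conditions (a) to (d) *)

Section Encoding.
Variable gT : finGroupType.
Local Notation I := (augIdeal gT).
Local Notation Z := (trivZ gT).
Implicit Types (A B C D M P Q X : gmodType gT) (n p q r : int).

Fact inv_ghom_subproof X A (f : homZ X A) (fI : invariant f) g x :
  f (gact g x) = gact g (f x).
Proof. by rewrite -[in LHS](fI g) /= gactK. Qed.
Definition inv_ghom X A (f : homZ X A) (fI : invariant f) : ghom X A :=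
  GHom (homZ_is_zmod_morphism f) (inv_ghom_subproof fI).

Lemma homZ_cls0P X A (y : tateH 0 (homZ X A)) :
  exists k : ghom X A, y = cls0 (ghom_homZ k).
Proof.
have [f fI ->] := cls0P y; exists (inv_ghom fI); congr cls0.
exact: homZ_ext.
Qed.

Lemma gcomp_ghom_class X Y A (k : ghom X A) q (e : 0 + q = q) (x : tateH q (homZ Y X)) :
  gcomp e (cls0 (ghom_homZ k)) x = tate_map (homZ_map Y k) x.
Proof.
apply: pcup_cls0l; first exact: invariant_ghom_homZ.
by move=> b; exact: homZ_ext.
Qed.

Lemma gcomp_idc_map X A (k : ghom X A) :
  tate_map (homZ_map X k) (idc X) = cls0 (ghom_homZ k).
Proof.
rewrite tate_map_cls0; last exact: invariant_idZ.
by congr cls0; exact: homZ_ext.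
Qed.

Section Yoneda.
Variables (X X' : gmodType gT) (r : int) (x : tateH r (homZ X' X)).

Definition cup_bijective n : Prop :=
  forall A m (e : n + r = m),
    bijective (fun y : tateH n (homZ X A) => gcomp e y x).

(** Left multiplication by an invertible class from A to B changes the degree by d and, by
    associativity, commutes with right multiplication by x. *)
Lemma cup_bijective_shift d n : cup_bijective (n + d) -> cup_bijective n.
Proof.
move=> H A m e; have [B /shift_isoP[z [z' [e1 [e2 [z'z zz']]]]]] := shift_iso_exists d A.
have [e3 e4 e5] : [/\ d + n = n + d, d + m = m + d & n + d + r = m + d].
  by split; lia.
have [e6 e7] : - d + (n + d) = n /\ - d + (m + d) = m by lia.
have [f fK Kf] := H B _ e5.
have K p (a : - d + (p + d) = p) (b : d + p = p + d) Y (y : tateH p (homZ Y A)) :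
    gcomp a z' (gcomp b z y) = y.
  have p0 : 0 + p = p by lia.
  by rewrite -(gcompA e2 p0) z'z gcomp1l.
have K' p (a : - d + (p + d) = p) (b : d + p = p + d) Y (y : tateH (p + d) (homZ Y B)) :
    gcomp b z (gcomp a z' y) = y.
  have p0 : 0 + (p + d) = p + d by lia.
  by rewrite -(gcompA e1 p0) zz' gcomp1l.
exists (fun y => gcomp e6 z' (f (gcomp e4 z y))) => y.
  by rewrite -(gcompA e3 e5 e e4) fK K.
by rewrite (gcompA _ _ e5 e7) Kf K.
Qed.

(** Surjectivity at A = X' provides x' with x' x = id. Then (x x') x = x = id x, and injectivity at
    A = X gives x x' = id. *)
Lemma cup_bijective_inverse : (forall n, cup_bijective n) -> shift_iso r X' X.
Proof.
move=> H; have [e e'] : r + - r = 0 /\ - r + r = 0 by lia.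
have [f _ fK] := H (- r) X' 0 e'; pose x' := f (idc X').
exists (- r), x, x', e, e'; split; first exact: fK.
have e0 : 0 + r = r by lia.
have /bij_inj inj := H 0 X _ e0; apply: inj.
by rewrite (gcompA e e0 e' (addr0 r)) fK gcomp1r gcomp1l.
Qed.
End Yoneda.

Lemma shift_iso_nat_iso r X X' (x : tateH r (homZ X' X)) r' (x' : tateH r' (homZ X X')) i :
  inverse_classes x x' ->
  @is_nat_iso gT (homTate i X) (homTate (i + r) X') (fun A y => cup_comp y x).
Proof.
move=> [e [e' [H1 H2]]]; split.
- by move=> A y y'; exact: (pcupBl (comp_pairing X' X A) erefl x y y').
- move=> A; have ei : i + r + r' = i by lia.
  have i0 : i + 0 = i by lia.
  have ir0 : i + r + 0 = i + r by lia.
  exists (fun y => gcomp ei y x') => y.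
    by rewrite -[LHS]/(gcomp ei (gcomp erefl y x) x') (gcompA _ _ e i0) H2 gcomp1r.
  by rewrite -[LHS]/(gcomp erefl (gcomp ei y x') x) (gcompA _ _ e' ir0) H1 gcomp1r.
- move=> A B k y.
  rewrite -[RHS]/(tate_map (homZ_map X' k) (gcomp erefl y x)) /gcomp.
  rewrite (pcup_map (m' := comp_pairing X' X B) (a := homZ_map X k) (b := ghom_id _)).
    by rewrite tate_map_id.
  by move=> f h; exact: homZ_ext.
Qed.

Lemma encoding_pairP r X X' : encoding_pair r X X' <-> shift_iso r X' X.
Proof.
split=> [|[r' [x [x' H]]]]; last first.
  exists 0, (fun A y => cup_comp y x); exact: shift_iso_nat_iso H.
case/encoding_pairE=> i /nat_iso_between_all/(_ 0).
rewrite add0r => -[phi [phiB phi_bij phiN]].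
apply: (@cup_bijective_inverse _ _ _ (phi X (idc X))) => n.
suff H : cup_bijective (phi X (idc X)) 0.
  by apply: (@cup_bijective_shift _ _ _ _ (- n)); rewrite subrr.
move=> A m e; have em : m = r by lia.
move: e; rewrite {}em => e.
refine (@eq_bij _ _ _ (phi_bij A) (fun y => gcomp e y (phi X (idc X))) _) => y.
(* Yoneda: in degree 0 every class is the image of [idc X] under a homomorphism k, so naturality of
   phi determines it from its value at [idc X]. *)
have [k ->] := homZ_cls0P y; rewrite gcomp_ghom_class -gcomp_idc_map.
have Ek Y j : tate_map (n := j) (homZ_map Y k) =1 tate_map (rmap (homR Y) k).
  by apply: eq_tate_map => f; exact: homZ_ext.
by rewrite !Ek phiN.
Qed.

Lemma shift_iso_cat r X X' :
  (exists (x : tateH r (homZ X' X)) (x' : tateH (- r) (homZ X X')),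
     tate_cast (addNr r) (cup_comp x' x) = ghom_class (ghom_id X')
     /\ tate_cast (subrr r) (cup_comp x x') = ghom_class (ghom_id X))
  <-> shift_iso r X' X.
Proof.
rewrite shift_isoP !ghom_classE.
split=> -[x [x' H]]; exists x, x'; first by exists (subrr r), (addNr r).
have [e [e' [H1 H2]]] := H.
rewrite -[LHS]/(gcomp (addNr r) x' x) -[X in _ /\ X = _]/(gcomp (subrr r) x x').
by rewrite (eq_irrelevance (addNr r) e') (eq_irrelevance (subrr r) e).
Qed.

(** The twisted module is itself isomorphic to X' in degree r; composing with that isomorphism
    trades degree 0 for degree r. *)
Lemma shift_iso_tensor_powP r X X' :
  ((0 <= r -> cohom_equiv X (tensor X' (tensor_pow I `|r|%N)))
   /\ (r < 0 -> cohom_equiv X (tensor X' (homZ (tensor_pow I `|r|%N) Z))))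
  <-> shift_iso r X' X.
Proof.
have twist Y : shift_iso r X' Y -> (encoding_pair 0 X Y <-> shift_iso r X' X).
  move=> X'Y; rewrite encoding_pairP; split=> H.
    by apply: shift_iso_trans X'Y H; rewrite addr0.
  by apply: shift_iso_trans (shift_iso_sym X'Y) H; rewrite addNr.
have pos : 0 <= r -> shift_iso r X' (tensor X' (tensor_pow I `|r|%N)).
  by move=> r0; have := shift_iso_pow X' `|r|%N; rewrite ssrint.gez0_abs.
have neg : r < 0 -> shift_iso r X' (tensor X' (homZ (tensor_pow I `|r|%N) Z)).
  by move=> r0; have := shift_iso_negpow X' `|r|%N; rewrite ssrint.ltz0_abs // opprK.
split=> [[H1 H2]|H].
  by have [r0|r0] := Num.Theory.lerP 0 r;
    [apply/(twist _ (pos r0))/H1|apply/(twist _ (neg r0))/H2].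
by split=> r0; [apply/(twist _ (pos r0))|apply/(twist _ (neg r0))].
Qed.

Theorem encoding_tfae r X X' :
  [<-> encoding_pair r X X';
       (0 <= r -> cohom_equiv X (tensor X' (tensor_pow I `|r|%N)))
       /\ (r < 0 -> cohom_equiv X (tensor X' (homZ (tensor_pow I `|r|%N) Z)));
       exists x : tateH r (homZ X' X), forall i : int,
         @is_nat_iso gT (homTate i X) (homTate (i + r) X')
           (fun A y => cup_comp y x);
       exists (x : tateH r (homZ X' X)) (x' : tateH (- r) (homZ X X')),
         tate_cast (addNr r) (cup_comp x' x) = ghom_class (ghom_id X')
         /\ tate_cast (subrr r) (cup_comp x x') = ghom_class (ghom_id X)].
Proof.
tfae.
- by rewrite encoding_pairP shift_iso_tensor_powP.
- rewrite shift_iso_tensor_powP => -[r' [x [x' H]]]; exists x => i.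
  exact: shift_iso_nat_iso H.
- by case=> x H; apply/shift_iso_cat/encoding_pairP; exists 0, (fun A y => cup_comp y x); exact: H.
- by rewrite shift_iso_cat encoding_pairP.
Qed.

End Encoding.

(** * Cohomology in degree -1 *)

Section DegreeMinusOne.
Variable gT : finGroupType.
Implicit Types (A B C M N : gmodType gT).

(** The subgroup I_G M. By finiteness of G, terms with the same u can be collected, so one element
    for each u suffices. *)
Definition in_aug M (v : M) : Prop :=
  exists c : gT -> M, v = \sum_(u : gT) (gact u (c u) - c u).

Lemma in_aug0 M : in_aug (0 : M).
Proof. by exists (fun=> 0); rewrite big1 // => u _; rewrite raddf0 subr0. Qed.

Lemma in_augB M (v w : M) : in_aug v -> in_aug w -> in_aug (v - w).
Proof.
move=> [c ->] [d ->]; exists (fun u => c u - d u).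
rewrite -sumrB; apply: eq_bigr => u _.
by rewrite !opprD !opprK addrACA -raddfB.
Qed.

Lemma in_augN M (v : M) : in_aug v -> in_aug (- v).
Proof. by move=> vI; rewrite -sub0r; apply: in_augB => //; exact: in_aug0. Qed.

Lemma in_augD M (v w : M) : in_aug v -> in_aug w -> in_aug (v + w).
Proof. by move=> vI wI; rewrite -[w]opprK; apply/in_augB/in_augN. Qed.

Lemma in_aug_sum M (I : Type) (r : seq I) (F : I -> M) :
  (forall i, in_aug (F i)) -> in_aug (\sum_(i <- r) F i).
Proof.
move=> FI; elim/big_ind: _ => [|x y|//]; [exact: in_aug0|exact: in_augD].
Qed.

Lemma in_augMz M (v : M) k : in_aug v -> in_aug (v *~ k).
Proof.
case=> c ->; exists (fun u => c u *~ k); rewrite mulrz_suml.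
by apply: eq_bigr => u _; rewrite raddfMz mulrzBl.
Qed.

Lemma in_aug_gact M g (v : M) : in_aug (gact g v - v).
Proof.
exists (fun u => if u == g then v else 0); rewrite (bigD1 g) //= eqxx big1 ?addr0 //.
by move=> u /negPf ->; rewrite raddf0 subr0.
Qed.

(** With [tensor_ker_span], this is how the vanishing of a class over a quotient is brought back to
    the module above it. *)
Lemma in_aug_lift M N (k : ghom M N) (v : N) :
  (forall y, exists x, k x = y) -> in_aug v -> exists2 w, in_aug w & k w = v.
Proof.
move=> k_surj [c ->]; pose d u := projT1 (cid (k_surj (c u))).
exists (\sum_u (gact u (d u) - d u)); first by exists d.
rewrite raddf_sum; apply: eq_bigr => u _.
by rewrite raddfB /= ghomJ /d; case: cid => x ->.
Qed.

Lemma coinvariant_in_aug M (C : zmodType) (f : {additive M -> C}) v :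
  (forall g x, f (gact g x) = f x) -> in_aug v -> f v = 0.
Proof.
move=> fJ [c ->]; rewrite raddf_sum big1 // => u _.
by rewrite raddfB /= fJ subrr.
Qed.

Definition norm M (v : M) : M := \sum_(g : gT) gact g v.

Lemma normB M : zmod_morphism (@norm M).
Proof. by move=> v w; rewrite /norm -sumrB; apply: eq_bigr => g _; rewrite raddfB. Qed.
HB.instance Definition _ M := GRing.isZmodMorphism.Build M M (@norm M) (@normB M).

Lemma norm_gact M g (v : M) : norm (gact g v) = norm v.
Proof.
rewrite /norm [RHS](reindex_inj (mulIg g)) /=.
by apply: eq_bigr => h _; rewrite gactM.
Qed.

Lemma norm_in_aug M (v : M) : in_aug v -> norm v = 0.
Proof. by apply: (coinvariant_in_aug (f := @norm M)) => g x; exact: norm_gact. Qed.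

Lemma norm_ghom M N (k : ghom M N) v : norm (k v) = k (norm v).
Proof. by rewrite /norm raddf_sum; apply: eq_bigr => g _ /=; rewrite ghomJ. Qed.

Definition orbit_cochain M (v : M) (s : seq gT) : M := if s is [:: x] then gact x v else 0.

Lemma orbit_cochainP M (v : M) : norm v = 0 -> is_cocycle (-1) (orbit_cochain v).
Proof.
move=> v0; split; first split.
- by case=> // x [].
- by move=> g [|x []] /=; rewrite ?raddf0 ?gactM.
by apply/funext => s; rewrite /tdiff; case: ifP => //; case: s => // x [].
Qed.

(* The class of an element of norm 0; of junk value 0 on other elements. *)
Definition clsN1 M (v : M) : tateH (-1) M :=
  tclass (insubd (0 : tate_cocycle (-1) M) (orbit_cochain v)).

Lemma clsN1E M (v : M) (z : tate_cocycle (-1) M) :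
  norm v = 0 -> (z : seq gT -> M) = orbit_cochain v -> clsN1 v = tclass z.
Proof.
move=> v0 zE; congr tclass; apply: val_inj.
have vP : orbit_cochain v \in @cocycle gT (-1) M by exact/asboolP/orbit_cochainP.
by rewrite val_insubd vP -zE.
Qed.

Lemma clsN1Ex M (v : M) : norm v = 0 ->
  exists2 z : tate_cocycle (-1) M, (z : seq gT -> M) = orbit_cochain v &
    clsN1 v = tclass z.
Proof.
by move=> v0; exists (mk_cocycle (orbit_cochainP v0)) => //; exact: clsN1E.
Qed.

Lemma clsN1P M (x : tateH (-1) M) : exists2 v, norm v = 0 & x = clsN1 v.
Proof.
have [z ->] := tateP x; have [[z0 zJ] dz] := tate_cocycleP z.
have zE : (z : seq gT -> M) = orbit_cochain (z [:: 1%g]).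
  apply/funext => -[|y [|y' s]]; [by rewrite z0| |by rewrite z0].
  by rewrite /= -zJ /= mulg1.
have v0 : norm (z [:: 1%g]) = 0.
  rewrite -[RHS]/((0 : seq gT -> M) [:: 1%g]) -dz /tdiff /norm /=.
  by apply: eq_bigr => g _; rewrite -zJ /= mulg1.
by exists (z [:: 1%g]) => //; apply/esym/clsN1E.
Qed.

Lemma clsN1B M (v w : M) : norm v = 0 -> norm w = 0 -> clsN1 (v - w) = clsN1 v - clsN1 w.
Proof.
move=> v0 w0; have [z zE ->] := clsN1Ex v0; have [y yE ->] := clsN1Ex w0.
rewrite -raddfB; apply: clsN1E; first by rewrite raddfB /= v0 w0 subr0.
rewrite [LHS](_ : _ = (z : seq gT -> M) - (y : seq gT -> M)) // zE yE.
by apply/funext => -[|a []] *; rewrite !fctE /= ?subr0 ?raddfB.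
Qed.

Lemma tate_map_clsN1 M N (k : ghom M N) v : norm v = 0 ->
  tate_map k (clsN1 v) = clsN1 (k v).
Proof.
move=> v0; have [z zE ->] := clsN1Ex v0; rewrite tate_mapE; apply/esym/clsN1E.
  by rewrite norm_ghom v0 raddf0.
by apply/funext => -[|a []] *; rewrite /= zE /= ?raddf0 ?ghomJ.
Qed.

Lemma clsN1_eq0 M (v : M) : norm v = 0 -> (clsN1 v = 0 <-> in_aug v).
Proof.
move=> v0; have [z zE ->] := clsN1Ex v0.
have -> : (0 : tateH (-1) M) = tclass 0 by rewrite raddf0.
have dE (f : seq gT -> M) x :
    tdiff (-1 - 1) f [:: x] = \sum_(u : gT) (f [:: u; x] - f [:: x; u]).
  by rewrite /tdiff /= diff_ins_cons diff_ins_nil sumrB.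
split.
  case/tclass_eq => h [h0 hJ] /(congr1 (fun k => k [:: 1%g])).
  (* By equivariance h [:: u; 1] is u applied to h [:: 1; u^-1], and the other sum is reindexed by
     inversion, which gives the witness. *)
  rewrite dE zE !fctE /= subr0 gact1 => ->; exists (fun u => h [:: 1%g; u^-1%g]).
  rewrite !sumrB; congr (_ - _); last by rewrite [LHS](reindex_inj invg_inj).
  by apply: eq_bigr => u _; rewrite -hJ /= mulg1 mulgV.
case=> c vE; apply: tclass_cohomologous.
(* The equivariant cochain whose value at (u, 1) is u c(u) and whose value at (1, u) is c(u^-1). *)
pose h (s : seq gT) := if s is [:: a; b] then gact a (c (b^-1 * a)%g) else 0.
have hC : cochain (-1 - 1) h.
  split; first by case=> // x [|y []].
  move=> g [|x [|y []]] //=; rewrite ?raddf0 // gactM invMg -mulgA mulKg //.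
exists h => //; rewrite zE subr0; have [dh0 dhJ] := cochain_tdiff hC.
apply/funext => -[|x [|y s]]; [by rewrite dh0| |by rewrite dh0].
rewrite /= vE; have := dhJ x [:: 1%g]; rewrite /= mulg1 => ->; congr (gact x _); rewrite dE /=.
rewrite !sumrB; congr (_ - _); first by apply: eq_bigr => u _; rewrite invg1 mul1g.
rewrite [LHS](reindex_inj invg_inj); apply: eq_bigr => u _.
by rewrite gact1 mulg1.
Qed.

Lemma clsN1_0 M : clsN1 (0 : M) = 0.
Proof. by apply/clsN1_eq0; [exact: raddf0|exact: in_aug0]. Qed.

Lemma clsN1_eq M (v w : M) : norm v = 0 -> in_aug (v - w) -> norm w = 0 /\ clsN1 v = clsN1 w.
Proof.
move=> v0 vw; have w0 : norm w = 0.
  by have := norm_in_aug vw; rewrite raddfB /= v0 => /eqP; rewrite sub0r oppr_eq0 => /eqP.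
split=> //; apply/eqP; rewrite -subr_eq0 -clsN1B //; apply/eqP/clsN1_eq0 => //.
by rewrite raddfB /= v0 w0 subr0.
Qed.

End DegreeMinusOne.

(** * Generated subgroups and finite generation *)

Section Span.
Variable V : zmodType.

Inductive zspan (P : V -> Prop) : V -> Prop :=
  | ZSpan0 : zspan P 0
  | ZSpanB u v of zspan P u & zspan P v : zspan P (u - v)
  | ZSpanMem v of P v : zspan P v.

Lemma zspan_min (P Q : V -> Prop) : Q 0 -> (forall u v, Q u -> Q v -> Q (u - v)) ->
  (forall v, P v -> Q v) -> forall v, zspan P v -> Q v.
Proof. by move=> Q0 QB PQ v; elim=> // *; auto. Qed.

Lemma zspanN P u : zspan P u -> zspan P (- u).
Proof. by rewrite -sub0r => Pu; apply: ZSpanB => //; exact: ZSpan0. Qed.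

Lemma zspanD P u v : zspan P u -> zspan P v -> zspan P (u + v).
Proof. by move=> Pu Pv; rewrite -[v]opprK; apply/ZSpanB/zspanN. Qed.

Lemma zspanMz P u k : zspan P u -> zspan P (u *~ k).
Proof.
move=> Pu; have N (n : nat) : zspan P (u *~ n).
  elim: n => [|n IH]; first exact: ZSpan0.
  by rewrite intS mulrzDr; exact: zspanD.
by case: k => n; rewrite ?NegzE ?mulrNz; [|apply: zspanN]; exact: N.
Qed.

End Span.

(* Subgroups of a free abelian group of finite rank are finitely generated:
   split off one coordinate at a time. *)
Lemma subgroup_fin_gen (T : finType) (K : {ffun T -> int} -> Prop) :
  K 0 -> (forall p q, K p -> K q -> K (p - q)) ->
  exists cs : seq {ffun T -> int}, (forall c, c \in cs -> K c) /\
    forall p, K p -> zspan (fun c => c \in cs) p.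
Proof.
move=> K0 KB; suff /(_ (enum T) K K0 KB) H : forall (L : seq T)
    (K : {ffun T -> int} -> Prop),
    K 0 -> (forall p q, K p -> K q -> K (p - q)) ->
    (forall p i, K p -> i \notin L -> p i = 0) ->
    exists cs : seq {ffun T -> int}, (forall c, c \in cs -> K c) /\
      forall p, K p -> zspan (fun c => c \in cs) p.
  by apply: H => p i _; rewrite mem_enum.
elim=> [|i L IH] {K0 KB}K K0 KB Ksupp.
  exists [::]; split=> // p /Ksupp p0; rewrite (_ : p = 0); first exact: ZSpan0.
  by apply/ffunP => i; rewrite ffunE p0.
pose K' p := K p /\ p i = 0.
have [|p q [Kp pi] [Kq qi]|p j [Kp pi] jL|cs [csK csP]] := IH K'.
- by split; rewrite ?ffunE.
- by split; [exact: KB|rewrite !ffunE pi qi].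
- have [->//|ji] := eqVneq j i.
  by apply: Ksupp Kp _; rewrite inE negb_or ji.
have [[e Ke ei]|H] := pselect (exists2 e, K e & e i != 0); last first.
  exists cs; split=> [c /csK[]//|p Kp]; apply: csP; split=> //.
  by apply: contrapT => /eqP pi; apply: H; exists p.
(* Minimizing d makes |e i| the least positive absolute value of an i-th coordinate on K; the
   successor excludes the value 0. *)
pose D d := `[< exists2 e, K e & d.+1 = absz (e i) >].
have exD : exists d, D d.
  by exists (absz (e i)).-1; apply/asboolP; exists e => //; rewrite prednK // absz_gt0.
case: (ex_minnP exD) => d /asboolP[{Ke ei}e Ke ei] dmin.
have KM p (k : int) : K p -> K (p *~ k).
  move=> Kp; have KN q : K q -> K (- q) by rewrite -sub0r; exact: KB.
  have N (n : nat) : K (p *~ n).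
    elim: n => [|n IHn]; first exact: K0.
    by rewrite intS mulrzDr -[p *~ n]opprK; apply/KB/KN.
  by case: k => n; rewrite ?NegzE ?mulrNz; [|apply: KN]; exact: N.
have Mi (p : {ffun T -> int}) (k : int) : (p *~ k) i = p i * k.
  have eB : zmod_morphism (fun p : {ffun T -> int} => p i).
    by move=> q q'; rewrite !ffunE.
  pose ev : {additive {ffun T -> int} -> int} :=
    HB.pack (fun p : {ffun T -> int} => p i) (GRing.isZmodMorphism.Build _ _ _ eB).
  by rewrite -[LHS]/(ev _) raddfMz /= mulrzz.
have ei0 : e i != 0 by rewrite -absz_eq0 -ei.
exists (e :: cs); split=> [c|p Kp].
  by rewrite inE => /predU1P[->//|/csK[]].
(* Division with remainder: after subtracting the multiple of e, the i-th coordinate is smaller than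
   |e i|, hence 0, and the induction hypothesis for K' applies. *)
rewrite -[p](subrK (e *~ (p i %/ e i)%Z)).
apply: zspanD; last by apply/zspanMz/ZSpanMem; rewrite inE eqxx.
have Kr : K (p - e *~ (p i %/ e i)%Z) by apply/KB/KM.
have ri : (p - e *~ (p i %/ e i)%Z) i = (p i %% e i)%Z.
  by rewrite !ffunE Mi mulrC /modz.
apply: (zspan_min (P := fun c => c \in cs)); [exact: ZSpan0|exact: ZSpanB| |].
  by move=> c cC; apply: ZSpanMem; rewrite inE cC orbT.
apply: csP; split=> //; rewrite ri; apply/eqP; rewrite -absz_eq0.
apply/negPn/negP => rn0.
have /dmin : D (absz (p i %% e i)%Z).-1.
  by apply/asboolP; eexists; [exact: Kr|rewrite ri prednK // lt0n].
rewrite leqNgt => /negP[]; rewrite -ltnS prednK ?lt0n // ei.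
have := ltz_mod (p i) ei0; have := modz_ge0 (p i) ei0; lia.
Qed.

(** * Quotients, tensor products and free modules *)

Section GHomTheory.
Variables (gT : finGroupType) (A B : gmodType gT) (k : ghom A B).
(* The generic lemmas on additive maps, in a form that leaves ghom_fun folded. *)
Lemma ghom_raddf0 : k 0 = 0. Proof. exact: raddf0. Qed.
Lemma ghom_raddfB x y : k (x - y) = k x - k y. Proof. exact: raddfB. Qed.
Lemma ghom_raddfMz x n : k (x *~ n) = k x *~ n. Proof. exact: raddfMz. Qed.
Lemma ghom_raddf_sum (I : Type) (r : seq I) (P : pred I) (F : I -> A) :
  k (\sum_(i <- r | P i) F i) = \sum_(i <- r | P i) k (F i).
Proof. exact: raddf_sum. Qed.
End GHomTheory.

Record gsubgroup (gT : finGroupType) (A : gmodType gT) := GSubgroup {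
  gsub :> A -> Prop;
  gsub0 : gsub 0;
  gsubB : forall x y, gsub x -> gsub y -> gsub (x - y);
  gsubJ : forall g x, gsub x -> gsub (gact g x)
}.

Definition span_gsubgroup (gT : finGroupType) (A : gmodType gT) (P : A -> Prop)
    (PJ : forall g x, P x -> P (gact g x)) : gsubgroup A.
Proof.
exists (zspan P); [exact: ZSpan0|exact: ZSpanB|move=> g].
by move=> x; elim=> *; rewrite ?raddf0 ?raddfB /=;
  [exact: ZSpan0|exact: ZSpanB|apply/ZSpanMem/PJ].
Defined.

Section Quotient.
Local Open Scope quotient_scope.
Variables (gT : finGroupType) (A : gmodType gT) (S : gsubgroup A).

Definition gsub_pred : {pred A} := fun x => `[< S x >].
Fact gsub_closed : zmod_closed gsub_pred.
Proof.
split=> [|x y /asboolP Sx /asboolP Sy]; apply/asboolP; first exact: gsub0.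
exact: gsubB.
Qed.
HB.instance Definition _ := GRing.isZmodClosed.Build A gsub_pred gsub_closed.

Definition gquot : Type := Quotient.quot gsub_pred.
HB.instance Definition _ := GRing.Zmodule.on gquot.

Definition gproj_fun (x : A) : gquot := \pi_(Quotient.quot gsub_pred) x.
Definition grepr (q : gquot) : A := repr (q : Quotient.quot gsub_pred).

Fact gproj_funB : zmod_morphism gproj_fun.
Proof. by move=> x y; rewrite /gproj_fun raddfB. Qed.

Lemma gproj_fun_eq x y : gproj_fun x = gproj_fun y <-> S (x - y).
Proof.
split=> [/eqP|Sxy]; last apply/eqP; rewrite -Quotient.idealrBE.
  by move=> /asboolP.
exact/asboolP.
Qed.

Lemma greprK : cancel grepr gproj_fun.
Proof. exact: reprK. Qed.

Definition gquot_act g (q : gquot) : gquot := gproj_fun (gact g (grepr q)).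
Lemma gquot_actE g x : gquot_act g (gproj_fun x) = gproj_fun (gact g x).
Proof.
apply/gproj_fun_eq; rewrite -raddfB; apply: gsubJ.
by apply/gproj_fun_eq; rewrite greprK.
Qed.

Fact gquot_act1 q : gquot_act 1%g q = q.
Proof. by rewrite -[q]greprK gquot_actE gact1. Qed.
Fact gquot_actM g h q : gquot_act (g * h)%g q = gquot_act g (gquot_act h q).
Proof. by rewrite -[q]greprK !gquot_actE gactM. Qed.
Fact gquot_actB g : zmod_morphism (gquot_act g).
Proof.
move=> p q; rewrite -[p]greprK -[q]greprK -gproj_funB !gquot_actE raddfB.
exact: gproj_funB.
Qed.
HB.instance Definition _ :=
  Zmodule_isGModule.Build gT gquot gquot_act1 gquot_actM gquot_actB.

Definition gproj : ghom A gquot :=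
  @GHom gT A gquot gproj_fun gproj_funB (fun g x => esym (gquot_actE g x)).

Lemma gproj_eq0 x : gproj x = 0 <-> S x.
Proof. by rewrite -(raddf0 gproj) (gproj_fun_eq x 0) subr0. Qed.

Lemma gproj_surj q : exists x, gproj x = q.
Proof. by exists (grepr q); exact: greprK. Qed.

Section Factor.
Variables (B : gmodType gT) (k : ghom A B).
Hypothesis kS : forall x, S x -> k x = 0.

Definition gfactor_fun (q : gquot) : B := k (grepr q).
Lemma gfactor_funE x : gfactor_fun (gproj_fun x) = k x.
Proof.
apply/eqP; rewrite -subr_eq0 -raddfB; apply/eqP/kS.
by apply/gproj_fun_eq; rewrite greprK.
Qed.
Fact gfactorB : zmod_morphism gfactor_fun.
Proof.
move=> p q; rewrite -[p]greprK -[q]greprK -gproj_funB !gfactor_funE.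
exact: raddfB.
Qed.
Fact gfactorJ g q : gfactor_fun (gact g q) = gact g (gfactor_fun q).
Proof.
by rewrite -[q]greprK [gact g _]gquot_actE !gfactor_funE ghomJ.
Qed.
Definition gfactor : ghom gquot B := GHom gfactorB gfactorJ.
Lemma gfactorE x : gfactor (gproj x) = k x.
Proof. exact: gfactor_funE. Qed.
End Factor.
End Quotient.

Section TensorKernel.
Variables (gT : finGroupType) (B B' A A' : gmodType gT).
Variables (p : ghom B B') (q : ghom A A').
Hypotheses (p_surj : forall y, exists x, p x = y) (q_surj : forall y, exists x, q x = y).

Definition tensor_ker_gen (t : tensor B A) : Prop :=
  exists b a, (p b = 0 \/ q a = 0) /\ t = tpure b a.

Fact tensor_ker_genJ g t : tensor_ker_gen t -> tensor_ker_gen (gact g t).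
Proof.
case=> b [a [ba ->]]; exists (gact g b), (gact g a); rewrite gact_tpure; split=> //.
by case: ba => H; [left|right]; rewrite ghomJ H raddf0.
Qed.

(** Right exactness. An inverse of the map from the quotient by these generators to B' (x) A' is
    built from set-theoretic sections of p and q; modulo the generators the choices do not matter,
    so it is biadditive. *)
Lemma tensor_ker_span t : tmap p q t = 0 -> zspan tensor_ker_gen t.
Proof.
pose S := span_gsubgroup tensor_ker_genJ; move=> t0; apply/(gproj_eq0 S).
pose s y := projT1 (cid (p_surj y)); pose r y := projT1 (cid (q_surj y)).
have sK y : p (s y) = y by rewrite /s; case: cid.
have rK y : q (r y) = y by rewrite /r; case: cid.
have [pB qB] := (ghomB p, ghomB q).
have El b b' a : p b = p b' -> gproj S (tpure b a) = gproj S (tpure b' a).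
  move=> bb; apply/eqP; rewrite -subr_eq0 -raddfB -tpureBl; apply/eqP/gproj_eq0.
  by apply: ZSpanMem; exists (b - b'), a; split=> //; left; rewrite raddfB /= bb subrr.
have Er b a a' : q a = q a' -> gproj S (tpure b a) = gproj S (tpure b a').
  move=> aa; apply/eqP; rewrite -subr_eq0 -raddfB -tpureBr; apply/eqP/gproj_eq0.
  by apply: ZSpanMem; exists b, (a - a'); split=> //; right; rewrite raddfB /= aa subrr.
pose f y x := gproj S (tpure (s y) (r x)).
have fP : biadditive f.
  split=> [x y y'|y x x']; rewrite /f -raddfB.
    by rewrite -tpureBl; apply: El; rewrite raddfB /= !sK.
  by rewrite -tpureBr; apply: Er; rewrite raddfB /= !rK.
suff <- : tlift f (tmap p q t) = gproj S t.
  by rewrite t0; have := tliftB fP 0 0; rewrite !subrr.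
move: t {t0}; apply: tensor_ext => [u v|u v|b a].
- by rewrite tmapB // tliftB.
- exact: raddfB.
- rewrite tmapE // tliftE // /f (El _ b) ?sK //.
  by apply: Er; rewrite rK.
Qed.
End TensorKernel.

Section FreeModule.
Variables (gT : finGroupType) (T : finType).

(** Z[G]^T, written on the basis T x G so that it is visibly free abelian of finite rank and
    [subgroup_fin_gen] applies to the relations of X. *)
Definition free_gmod : Type := {ffun (T * gT) -> int}.
HB.instance Definition _ := GRing.Zmodule.on free_gmod.

Definition free_act g (c : free_gmod) : free_gmod := [ffun i => c (i.1, (g^-1 * i.2)%g)].
Fact free_act1 c : free_act 1%g c = c.
Proof. by apply/ffunP => -[i h]; rewrite ffunE /= invg1 mul1g. Qed.
Fact free_actM g h c : free_act (g * h)%g c = free_act g (free_act h c).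
Proof. by apply/ffunP => -[i k]; rewrite !ffunE /= invMg mulgA. Qed.
Fact free_actB g : zmod_morphism (free_act g).
Proof. by move=> c d; apply/ffunP => k; rewrite !ffunE. Qed.
HB.instance Definition _ :=
  Zmodule_isGModule.Build gT free_gmod free_act1 free_actM free_actB.

Definition free_gen (i : T) (g : gT) : free_gmod := [ffun j => (j == (i, g))%:Z].

Lemma gact_free_gen g i h : gact g (free_gen i h) = free_gen i (g * h)%g.
Proof.
apply/ffunP => -[j k]; rewrite !ffunE !xpair_eqE /=.
by rewrite -(inj_eq (mulgI g)) mulKVg.
Qed.

Lemma free_gact_coef g (c : free_gmod) i h : (gact g c) (i, h) = c (i, (g^-1 * h)%g).
Proof. by rewrite ffunE. Qed.

Definition free_coef (j : T * gT) (c : free_gmod) : int := c j.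
Fact free_coefB j : zmod_morphism (free_coef j).
Proof. by move=> c d; rewrite /free_coef !ffunE. Qed.
HB.instance Definition _ j :=
  GRing.isZmodMorphism.Build free_gmod int (free_coef j) (free_coefB j).

Lemma free_genE i g j : (free_gen i g : free_gmod) j = (j == (i, g))%:Z.
Proof. by rewrite ffunE. Qed.

Section Lift.
Variables (A : zmodType) (a : T * gT -> A).
Definition free_sum (c : free_gmod) : A := \sum_(j : T * gT) a j *~ free_coef j c.
Fact free_sumB : zmod_morphism free_sum.
Proof.
move=> c d; rewrite /free_sum -sumrB; apply: eq_bigr => j _.
by rewrite raddfB /= mulrzBr.
Qed.
HB.instance Definition _ := GRing.isZmodMorphism.Build free_gmod A free_sum free_sumB.
Lemma free_sum_gen i g : free_sum (free_gen i g) = a (i, g).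
Proof.
rewrite /free_sum (bigD1 (i, g)) //= /free_coef free_genE eqxx mulr1z big1 ?addr0 //.
by move=> j /negPf ji; rewrite free_genE ji mulr0z.
Qed.
End Lift.

Variables (A : gmodType gT) (a : T -> A).
Definition free_lift_fun := free_sum (fun j : T * gT => gact j.2 (a j.1)).
Fact free_liftB : zmod_morphism free_lift_fun.
Proof. exact: free_sumB. Qed.
Fact free_liftJ g c : free_lift_fun (gact g c) = gact g (free_lift_fun c).
Proof.
rewrite /free_lift_fun /free_sum raddf_sum.
rewrite (reindex (fun j : T * gT => (j.1, (g * j.2)%g))) /=; last first.
  by exists (fun j => (j.1, (g^-1 * j.2)%g)) => -[i h] _ /=; rewrite (mulKg, mulKVg).
apply: eq_bigr => -[i h] _ /=.
by rewrite raddfMz gactM /free_coef free_gact_coef mulKg.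
Qed.
Definition free_lift : ghom free_gmod A := GHom free_liftB free_liftJ.

Lemma free_lift_gen i g : free_lift (free_gen i g) = gact g (a i).
Proof. exact: free_sum_gen. Qed.

Lemma free_liftE c :
  free_lift c = \sum_(j : T * gT) gact j.2 (a j.1) *~ c j.
Proof. by []. Qed.
End FreeModule.

(** * Natural transformations between tensor functors *)

Section Universal.
Variables (gT : finGroupType) (X : gmodType gT) (n : nat) (x : 'I_n -> X).
Hypothesis x_gen : forall y, exists c : free_gmod gT 'I_n, free_lift x c = y.
Variable cs : seq (free_gmod gT 'I_n).
Hypotheses (csK : forall c, c \in cs -> free_lift x c = 0)
  (csP : forall c, free_lift x c = 0 -> zspan (fun c => c \in cs) c).
Implicit Types (A B : gmodType gT).
Local Notation m := (size cs).
Local Notation F := (free_gmod gT 'I_n : gmodType gT).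
Local Notation P := (free_gmod gT 'I_m : gmodType gT).

Let c (k : 'I_m) : F := cs`_k.

Lemma csE d : d \in cs -> exists k, d = c k.
Proof. by case/(nthP 0) => k km <-; exists (Ordinal km). Qed.

Lemma c_rel k : free_lift x (c k) = 0.
Proof. by apply: csK; apply: mem_nth. Qed.

(** By right exactness, the sum of the g x_j (x) w_(j, g) vanishes iff w_(j, g) = sum_k c_k(j, g)
    b_k for some b_k. For a norm, w_(j, g) = g a_j: the b_k serve as generators, g = 1 defines a_j,
    and the condition at g, multiplied by g^-1, is this relation. *)
Definition rel_gen g (j : 'I_n) : P :=
  \sum_k free_gen k g^-1%g *~ c k (j, g) - \sum_k free_gen k 1%g *~ c k (j, 1%g).

Definition is_rel (p : P) : Prop := exists h g j, p = gact h (rel_gen g j).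

Fact is_relJ g p : is_rel p -> is_rel (gact g p).
Proof. by case=> h [g' [j ->]]; exists (g * h)%g, g', j; rewrite gactM. Qed.

(* The universal module A with elements a_j such that \sum_j x_j (x) a_j has
   norm 0 in X (x) A. *)
Definition univ : gmodType gT := gquot (span_gsubgroup is_relJ).
Definition univ_proj : ghom P univ := gproj (span_gsubgroup is_relJ).
Definition univ_pre (j : 'I_n) : P := \sum_k free_gen k 1%g *~ c k (j, 1%g).
Definition univ_gen j : univ := univ_proj (univ_pre j).

Lemma gact_univ_gen g j :
  gact g (univ_gen j) = \sum_k univ_proj (free_gen k 1%g) *~ c k (j, g).
Proof.
have H : univ_proj (gact g (rel_gen g j)) = 0.
  by apply/gproj_eq0/ZSpanMem; exists g, g, j.
rewrite -ghomJ; apply/eqP; rewrite eq_sym -subr_eq0 -[X in _ == X]H; apply/eqP.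
rewrite /rel_gen raddfB [in RHS]ghom_raddfB; congr (_ - _).
rewrite raddf_sum [in RHS]ghom_raddf_sum; apply: eq_bigr => k _.
by rewrite raddfMz ghom_raddfMz /= gact_free_gen mulgV.
Qed.

Definition gens_sum A (v : 'I_n -> A) : tensor X A := \sum_j tpure (x j) (v j).

Lemma norm_gens_sum A (v : 'I_n -> A) : norm (gens_sum v) =
  \sum_(i : 'I_n * gT) tpure (gact i.2 (x i.1)) (gact i.2 (v i.1)).
Proof.
rewrite /norm -(pair_bigA _ (fun j g => tpure (gact g (x j)) (gact g (v j)))) /=.
rewrite exchange_big; apply: eq_bigr => g _; rewrite raddf_sum.
by apply: eq_bigr => j _; exact: gact_tpure.
Qed.

Lemma norm_univ : norm (gens_sum univ_gen) = 0.
Proof.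
rewrite norm_gens_sum.
transitivity (\sum_(k < m) tpure (free_lift x (c k)) (univ_proj (free_gen k 1%g))).
  transitivity (\sum_(i : 'I_n * gT) \sum_(k < m)
      tpure (gact i.2 (x i.1) *~ c k i) (univ_proj (free_gen k 1%g))).
    apply: eq_bigr => -[j g] _ /=; rewrite gact_univ_gen raddf_sum; apply: eq_bigr => k _.
    by rewrite -[RHS]/(tensor_pairing _ _ _ _) pairMzl -pairMzr.
  rewrite exchange_big; apply: eq_bigr => k _.
  by rewrite free_liftE tpure_suml.
by rewrite big1 // => k _; rewrite c_rel tpure0l.
Qed.

(** Modulo I_G, g x_j (x) a equals x_j (x) g^-1 a, so the translates of the generators can be
    dispensed with. *)
Lemma tensor_gens A (t : tensor X A) : exists v : 'I_n -> A, in_aug (t - gens_sum v).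
Proof.
move: t; apply: tensor_ind => [|t u [v tv] [w uw]|y a].
- exists (fun=> 0); rewrite /gens_sum big1 ?subr0; first exact: in_aug0.
  by move=> j _; rewrite raddf0.
- exists (fun j => v j - w j).
  have -> : gens_sum (fun j => v j - w j) = gens_sum v - gens_sum w.
    by rewrite /gens_sum -sumrB; apply: eq_bigr => j _; exact: raddfB.
  rewrite (_ : _ - _ = (t - gens_sum v) - (u - gens_sum w)); first exact: in_augB.
  by rewrite !opprD !opprK addrACA.
have [d <-] := x_gen y.
exists (fun j => \sum_g gact g^-1%g a *~ d (j, g)).
rewrite free_liftE tpure_suml /gens_sum.
have -> : \sum_j tpure (x j) (\sum_g gact g^-1%g a *~ d (j, g)) =
    \sum_(i : 'I_n * gT) tpure (x i.1) (gact i.2^-1%g a) *~ d i.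
  rewrite [RHS](eq_bigr (fun i => tpure (x i.1) (gact i.2^-1%g a) *~ d (i.1, i.2)));
    last by case.
  rewrite -(pair_bigA _ (fun j g => tpure (x j) (gact g^-1%g a) *~ d (j, g))) /=.
  apply: eq_bigr => j _; rewrite raddf_sum; apply: eq_bigr => g _; exact: raddfMz.
rewrite -sumrB; apply: in_aug_sum => -[j g] /=.
rewrite -[tpure (_ *~ _) _]/(tensor_pairing _ _ _ _) pairMzl -mulrzBl.
apply: in_augMz; have := in_aug_gact g (tpure (x j) (gact g^-1%g a) : tensor X A).
by rewrite gact_tpure gactVK.
Qed.

Fact coef_biadd A (i : 'I_n * gT) : biadditive (fun (d : F) (a : A) => a *~ free_coef i d).
Proof. by split=> [a d d'|d a a']; [rewrite raddfB mulrzBr|rewrite mulrzBl]. Qed.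

Lemma univ_extend A (v : 'I_n -> A) : norm (gens_sum v) = 0 ->
  exists f : ghom univ A, forall j, f (univ_gen j) = v j.
Proof.
move=> v0.
(* A lift of the norm to F (x) A, where the coefficient at (j, g) is well defined and equals g
   v_j. *)
pose th : tensor F A := \sum_(i : 'I_n * gT) tpure (free_gen i.1 i.2) (gact i.2 (v i.1)).
have idS (a : A) : exists b, ghom_id A b = a by exists a.
have idB : zmod_morphism (@id A) by [].
have xB := ghomB (free_lift x).
have th0 : tmap (free_lift x) (ghom_id A) th = 0.
  have tB := tmapB xB idB.
  pose tm : {additive tensor F A -> tensor X A} :=
    HB.pack (tmap (free_lift x) id : tensor F A -> tensor X A)
      (GRing.isZmodMorphism.Build _ _ _ tB).
  rewrite -[LHS]/(tm th) raddf_sum /= -[RHS]v0 norm_gens_sum.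
  by apply: eq_bigr => i _; rewrite tmapE //; congr tpure; exact: free_lift_gen.
have cP i := tliftB (coef_biadd A i).
(* The kernel of F (x) A -> X (x) A is spanned by the c_k (x) a; b_k collects the total coefficient
   of c_k in th and will be the image of the k-th generator. *)
have [b bP] : exists b : 'I_m -> A, forall i : 'I_n * gT,
    tlift (fun (d : F) (a : A) => a *~ free_coef i d) th = \sum_k b k *~ c k i.
  elim: {th0 v0} (tensor_ker_span x_gen idS th0) => [|t u _ [b tb] _ [b' ub]|t].
  - exists (fun=> 0) => i; rewrite big1 => [|k _]; last by rewrite mul0rz.
    by have := cP i 0 0; rewrite !subrr.
  - exists (fun k => b k - b' k) => i; rewrite cP tb ub -sumrB.
    by apply: eq_bigr => k _; rewrite mulrzBl.
  case=> d [a [[d0|/= ->] ->]]; last first.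
    exists (fun=> 0) => i; rewrite big1 => [|k _]; last by rewrite mul0rz.
    by rewrite raddf0; have := cP i 0 0; rewrite !subrr.
  elim: {d0} (csP d0) => [|d1 d2 _ [b b1] _ [b' b2]|d1 /csE[k ->]].
  - exists (fun=> 0) => i; rewrite big1 => [|k _]; last by rewrite mul0rz.
    by rewrite tpure0l; have := cP i 0 0; rewrite !subrr.
  - exists (fun k => b k - b' k) => i; rewrite tpureBl cP b1 b2 -sumrB.
    by apply: eq_bigr => k _; rewrite mulrzBl.
  - exists (fun l => if l == k then a else 0) => i.
    rewrite tliftE; last exact: coef_biadd.
    rewrite (bigD1 k) //= eqxx big1 ?addr0 // => l /negPf ->.
    by rewrite mul0rz.
have vE j g : gact g (v j) = \sum_k b k *~ c k (j, g).
  rewrite -bP; pose e := tlift (fun (d : F) (a : A) => a *~ free_coef (j, g) d).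
  pose ea : {additive tensor F A -> A} :=
    HB.pack e (GRing.isZmodMorphism.Build _ _ _ (cP (j, g))).
  rewrite -[RHS]/(ea th) raddf_sum (bigD1 (j, g)) //= /e tliftE; last exact: coef_biadd.
  rewrite /free_coef free_genE eqxx mulr1z big1 ?addr0 // => i ij.
  rewrite tliftE; last exact: coef_biadd.
  by rewrite /free_coef free_genE -surjective_pairing eq_sym (negPf ij) mulr0z.
have fR p : span_gsubgroup is_relJ p -> free_lift b p = 0.
  elim=> [|u u' _ u0 _ u0'|{}p [h [g [j ->]]]]; first exact: ghom_raddf0.
    by rewrite ghom_raddfB u0 u0' subrr.
  rewrite ghomJ /rel_gen ghom_raddfB !ghom_raddf_sum.
  under eq_bigr do rewrite ghom_raddfMz free_lift_gen -raddfMz.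
  under [X in _ - X]eq_bigr do rewrite ghom_raddfMz free_lift_gen gact1.
  by rewrite -raddf_sum -!vE /= gactK gact1 subrr raddf0.
exists (gfactor fR) => j; rewrite [LHS]gfactorE ghom_raddf_sum -[RHS]gact1 vE.
by apply: eq_bigr => k _; rewrite ghom_raddfMz free_lift_gen gact1.
Qed.

End Universal.

Section LeftMaps.
Variable gT : finGroupType.

Section Inv.
Variables (A B C : gmodType gT) (m : pairing A B C) (a : A) (aI : invariant a).
Fact pair_invJ g b : m a (gact g b) = gact g (m a b).
Proof. by rewrite -pairJ aI. Qed.
Definition pair_inv : ghom B C := GHom ((pair_biadd m).2 a) pair_invJ.
End Inv.

Definition tmapl (X B : gmodType gT) (f : ghom X B) (A : gmodType gT) : ghom (tensor X A) (tensor B A) :=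
  pair_inv (eval_pairing X B A) (invariant_ghom_homZ f).

Lemma tmaplE (X B : gmodType gT) (f : ghom X B) (A : gmodType gT) x a : tmapl f A (tpure x a) = tpure (f x) a.
Proof. exact: hevalE. Qed.

Lemma tensor_map_pure (X A B : gmodType gT) (k : ghom A B) x a :
  tensor_map X k (tpure x a) = tpure x (k a).
Proof. by apply: tmapE => //; exact: ghomB. Qed.
End LeftMaps.

Section Yoneda.
Variables (gT : finGroupType) (X B : gmodType gT) (n : nat) (x : 'I_n -> X).
Hypothesis x_gen : forall y, exists c : free_gmod gT 'I_n, free_lift x c = y.
Variable cs : seq (free_gmod gT 'I_n).
Hypotheses (csK : forall c, c \in cs -> free_lift x c = 0)
  (csP : forall c, free_lift x c = 0 -> zspan (fun c => c \in cs) c).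
Local Notation m := (size cs).
Local Notation F := (free_gmod gT 'I_n : gmodType gT).
Local Notation P := (free_gmod gT 'I_m : gmodType gT).
Local Notation U := (univ cs).
Local Notation u := (univ_gen cs).

Lemma tensor_map_gens (A A' : gmodType gT) (k : ghom A A') (v : 'I_n -> A) :
  tensor_map X k (gens_sum x v) = gens_sum x (fun j => k (v j)).
Proof.
by rewrite /gens_sum ghom_raddf_sum; apply: eq_bigr => j _; rewrite tensor_map_pure.
Qed.

Section Natural.
Variable psi : forall A : gmodType gT, tateH (-1) (tensor X A) -> tateH (-1) (tensor B A).
Hypothesis psiB : forall A, zmod_morphism (@psi A).
Hypothesis psiN : forall (A A' : gmodType gT) (k : ghom A A') y,
  psi (tate_map (tensor_map X k) y) = tate_map (tensor_map B k) (psi y).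

Lemma psi0 A : @psi A 0 = 0.
Proof. by have := psiB (0 : tateH (-1) (tensor X A)) 0; rewrite !subrr. Qed.

Definition gen_orbit (a : U) : Prop := exists g j, a = gact g (u j).
Fact gen_orbitJ g a : gen_orbit a -> gen_orbit (gact g a).
Proof. by case=> h [j ->]; exists (g * h)%g, j; rewrite gactM. Qed.

(* Over the quotient of U by its generators the class vanishes; right
   exactness of the tensor product then brings psi into the standard form. *)
Lemma psi_univ : exists beta : 'I_n -> B,
  norm (\sum_j tpure (beta j) (u j)) = 0 /\
  psi (clsN1 (gens_sum x u)) = clsN1 (\sum_j tpure (beta j) (u j)).
Proof.
have y0 : norm (gens_sum x u) = 0 := norm_univ csK.
have [t t0 tE] := clsN1P (psi (clsN1 (gens_sum x u))).
pose q := gproj (span_gsubgroup gen_orbitJ).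
have qu j : q (u j) = 0.
  by apply/gproj_eq0/ZSpanMem; exists 1%g, j; rewrite gact1.
have /clsN1_eq0 : clsN1 (tensor_map B q t) = 0.
  rewrite -tate_map_clsN1 // -tE -psiN tate_map_clsN1 // tensor_map_gens.
  have -> : gens_sum x (fun j => q (u j)) = 0.
    by rewrite /gens_sum big1 // => j _; rewrite qu raddf0.
  by rewrite clsN1_0 psi0.
rewrite norm_ghom t0 ghom_raddf0 => /(_ erefl) qt.
have idS (b : B) : exists b', ghom_id B b' = b by exists b.
have q_surj a : exists a', q a' = a by exact: gproj_surj.
have qB_surj s : exists s', tensor_map B q s' = s.
  move: s; apply: tensor_ind => [|s s' [v <-] [v' <-]|b a].
  - by exists 0; rewrite ghom_raddf0.
  - by exists (v - v'); rewrite ghom_raddfB.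
  - by have [a' <-] := q_surj a; exists (tpure b a'); rewrite tensor_map_pure.
have [w wI wE] := in_aug_lift qB_surj qt.
have /(tensor_ker_span idS q_surj) H : tmap (ghom_id B) q (t - w) = 0.
  by rewrite -[LHS]/(tensor_map B q (t - w)) ghom_raddfB wE subrr.
have [beta bP] : exists beta : 'I_n -> B, in_aug (t - w - \sum_j tpure (beta j) (u j)).
  elim: H => [|s s' _ [b sb] _ [b' sb']|s [b [a [ba ->]]]].
  - exists (fun=> 0); rewrite big1 ?subr0; first exact: in_aug0.
    by move=> j _; rewrite tpure0l.
  - exists (fun j => b j - b' j); under eq_bigr do rewrite tpureBl.
    rewrite sumrB (_ : _ - _ - _ = (s - \sum_j tpure (b j) (u j)) - (s' - \sum_j tpure (b' j) (u j))).
      exact: in_augB.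
    by rewrite !opprD !opprK addrACA.
  - case: ba => [/= ->|/gproj_eq0].
      exists (fun=> 0); rewrite tpure0l big1 ?subr0; first exact: in_aug0.
      by move=> j _; rewrite tpure0l.
    elim=> [|a1 a2 _ [b1 b1P] _ [b2 b2P]|_ [g [j ->]]].
    + exists (fun=> 0); rewrite raddf0 big1 ?subr0; first exact: in_aug0.
      by move=> j _; rewrite tpure0l.
    + exists (fun j => b1 j - b2 j); under eq_bigr do rewrite tpureBl.
      rewrite sumrB tpureBr (_ : _ - _ - _ = (tpure b a1 - \sum_j tpure (b1 j) (u j)) -
        (tpure b a2 - \sum_j tpure (b2 j) (u j))).
        exact: in_augB.
      by rewrite !opprD !opprK addrACA.
    (* Modulo I_G, b (x) g u_j equals g^-1 b (x) u_j. *)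
    + exists (fun i => if i == j then gact g^-1%g b else 0).
      rewrite (bigD1 j) //= eqxx big1 ?addr0; last by move=> i /negPf ->; rewrite tpure0l.
      have := in_aug_gact g (tpure (gact g^-1%g b) (u j) : tensor B U).
      by rewrite gact_tpure gactVK.
exists beta.
have tb : in_aug (t - \sum_j tpure (beta j) (u j)).
  rewrite -[t](subrK w) addrAC; exact: in_augD.
by have [b0 bE] := clsN1_eq t0 tb; rewrite tE bE.
Qed.
End Natural.
End Yoneda.

Lemma homZ_factor (gT : finGroupType) (A B C : gmodType gT) (p : ghom A B) (k : homZ A C) :
  (forall y, exists x, p x = y) -> (forall a, p a = 0 -> k a = 0) ->
  exists f : homZ B C, forall a, f (p a) = k a.
Proof.
move=> p_surj pk; pose s y := projT1 (cid (p_surj y)).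
have sK y : p (s y) = y by rewrite /s; case: cid.
have E a b : p a = p b -> k a = k b.
  move=> ab; apply/eqP; rewrite -subr_eq0 -raddfB; apply/eqP/pk.
  by rewrite ghom_raddfB ab subrr.
have fP : (fun y => k (s y)) \in @additive_pred gT B C.
  apply/asboolP => y y' /=; rewrite -raddfB; apply: E.
  by rewrite ghom_raddfB !sK.
by exists (HomZ fP) => a; apply: E; rewrite sK.
Qed.

Lemma ghom_factor (gT : finGroupType) (A B C : gmodType gT) (p : ghom A B) (k : ghom A C) :
  (forall y, exists x, p x = y) -> (forall a, p a = 0 -> k a = 0) ->
  exists f : ghom B C, forall a, f (p a) = k a.
Proof.
move=> p_surj pk; have [f fE] := homZ_factor (k := ghom_homZ k) p_surj pk.
have fJ g y : f (gact g y) = gact g (f y).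
  by have [a <-] := p_surj y; rewrite -ghomJ !fE; exact: ghomJ.
by exists (GHom (homZ_is_zmod_morphism f) fJ) => a; exact: fE.
Qed.

Section Contraction.
Variables (gT : finGroupType) (T : finType) (B : gmodType gT).
Local Notation P := (free_gmod gT T : gmodType gT).

(** The k-th coordinate of the isomorphism from the coinvariants of B (x) Z[G]^T to B^T; it sends b
    (x) h e_k to h^-1 b and kills I_G (B (x) Z[G]^T). *)
Definition contract_fun (k : T) (b : B) (p : P) : B :=
  \sum_(h : gT) gact h^-1%g b *~ p (k, h).
Fact contract_biadd k : biadditive (contract_fun k).
Proof.
split=> [p b b'|b p p']; rewrite /contract_fun -sumrB; apply: eq_bigr => h _.
  by rewrite raddfB mulrzBl.
by rewrite !ffunE mulrzBr.
Qed.
Definition contract k : tensor B P -> B := tlift (contract_fun k).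
HB.instance Definition _ k :=
  GRing.isZmodMorphism.Build (tensor B P) B (contract k) (tliftB (contract_biadd k)).

Lemma contract_gact k g t : contract k (gact g t) = contract k t.
Proof.
move: t; apply: tensor_ext => [s t|s t|b p].
- by rewrite !raddfB.
- exact: raddfB.
rewrite gact_tpure /contract !tliftE; try exact: contract_biadd.
rewrite /contract_fun (reindex_inj (mulgI g)) /=; apply: eq_bigr => h _.
by rewrite free_gact_coef mulKg invMg gactM gactK.
Qed.

Lemma contract_gen k b i h :
  contract k (tpure b (free_gen i h)) = if k == i then gact h^-1%g b else 0.
Proof.
rewrite /contract tliftE; last exact: contract_biadd.
rewrite /contract_fun (bigD1 h) //= free_genE xpair_eqE eqxx andbT.
rewrite big1 ?addr0 => [|l /negPf lh]; first by case: eqP.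
by rewrite free_genE xpair_eqE lh andbF.
Qed.
End Contraction.

Section Yoneda.
Variables (gT : finGroupType) (X B : gmodType gT) (n : nat) (x : 'I_n -> X).
Hypothesis x_gen : forall y, exists c : free_gmod gT 'I_n, free_lift x c = y.
Variable cs : seq (free_gmod gT 'I_n).
Hypotheses (csK : forall c, c \in cs -> free_lift x c = 0)
  (csP : forall c, free_lift x c = 0 -> zspan (fun c => c \in cs) c).
Local Notation m := (size cs).
Local Notation F := (free_gmod gT 'I_n : gmodType gT).
Local Notation P := (free_gmod gT 'I_m : gmodType gT).
Local Notation U := (univ cs).
Local Notation u := (univ_gen cs).

Section Natural.
Variable psi : forall A : gmodType gT, tateH (-1) (tensor X A) -> tateH (-1) (tensor B A).
Hypothesis psiB : forall A, zmod_morphism (@psi A).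
Hypothesis psiN : forall (A A' : gmodType gT) (k : ghom A A') y,
  psi (tate_map (tensor_map X k) y) = tate_map (tensor_map B k) (psi y).

(* Testing psi on A = Z[G] shows that the x_j |-> beta_j respect the relations. *)
Lemma natural_tmapl : exists f : ghom X B,
  forall (A : gmodType gT) (y : tateH (-1) (tensor X A)), psi y = tate_map (tmapl f A) y.
Proof.
have [beta [b0 bE]] := psi_univ csK psiB psiN.
have psi_gens (A : gmodType gT) (v : 'I_n -> A) : norm (gens_sum x v) = 0 ->
    norm (\sum_j tpure (beta j) (v j)) = 0 /\
    psi (clsN1 (gens_sum x v)) = clsN1 (\sum_j tpure (beta j) (v j)).
  move=> v0; have [f fv] := univ_extend x_gen csP v0.
  have fE (Y : gmodType gT) (z : 'I_n -> Y) :
      tensor_map Y f (\sum_j tpure (z j) (u j)) = \sum_j tpure (z j) (v j).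
    by rewrite ghom_raddf_sum; apply: eq_bigr => j _; rewrite tensor_map_pure fv.
  split; first by rewrite -fE norm_ghom b0 ghom_raddf0.
  rewrite -fE -tate_map_clsN1 // -bE -psiN tate_map_clsN1; last exact: norm_univ.
  by rewrite /gens_sum fE.
have ker d : free_lift x d = 0 -> free_lift beta d = 0.
  move=> xd.
  pose T := 'I_1; pose e h : free_gmod gT T := free_gen ord0 h.
  (* Chosen so that the sum of the x_j (x) v_j is, modulo I_G, [free_lift x d] (x) 1 = 0, while
     contracting the sum of the beta_j (x) v_j returns [free_lift beta d]. *)
  pose v j := \sum_g e g^-1%g *~ d (j, g).
  have sumE (Y : gmodType gT) (z : 'I_n -> Y) : \sum_j tpure (z j) (v j) =
      \sum_(i : 'I_n * gT) tpure (z i.1) (e i.2^-1%g) *~ d i.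
    rewrite [RHS](eq_bigr (fun i => tpure (z i.1) (e i.2^-1%g) *~ d (i.1, i.2)));
      last by case.
    rewrite -(pair_bigA _ (fun j g => tpure (z j) (e g^-1%g) *~ d (j, g))) /=.
    apply: eq_bigr => j _; rewrite raddf_sum; apply: eq_bigr => g _; exact: raddfMz.
  have vI : in_aug (gens_sum x v).
    rewrite -[gens_sum x v]subr0 -(tpure0l X (e 1%g)) -xd free_liftE tpure_suml.
    rewrite /gens_sum sumE -sumrB; apply: in_aug_sum => -[j g] /=.
    rewrite -[tpure (_ *~ _) _]/(tensor_pairing _ _ _ _) pairMzl -mulrzBl -opprB mulNrz.
    apply/in_augN/in_augMz.
    have := in_aug_gact g (tpure (x j) (e g^-1%g) : tensor X (free_gmod gT T)).
    by rewrite gact_tpure gact_free_gen mulgV.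
  have [bv0 bvE] := psi_gens _ v (norm_in_aug vI).
  have : clsN1 (\sum_j tpure (beta j) (v j)) = 0.
    rewrite -bvE (_ : clsN1 _ = 0) ?psi0 //.
    by apply/clsN1_eq0 => //; exact: norm_in_aug.
  move/(clsN1_eq0 bv0) => H.
  have := coinvariant_in_aug (f := contract (ord0 : T)) (contract_gact _) H.
  rewrite sumE raddf_sum => <-; rewrite free_liftE; apply: eq_bigr => -[j g] _ /=.
  by rewrite raddfMz /= contract_gen invgK.
have [f fE] := ghom_factor x_gen ker.
have fx j : f (x j) = beta j.
  by have := fE (free_gen j 1%g); rewrite !free_lift_gen !gact1.
exists f => A y; have [t t0 ->] := clsN1P y.
have [v tv] := tensor_gens x_gen t; have [v0 ->] := clsN1_eq t0 tv.
rewrite (psi_gens _ v v0).2 tate_map_clsN1 //; congr clsN1.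
by rewrite /gens_sum ghom_raddf_sum; apply: eq_bigr => j _; rewrite tmaplE fx.
Qed.
End Natural.

Lemma homZ_gens_ext (f h : homZ X B) :
  (forall j g, f (gact g (x j)) = h (gact g (x j))) -> f = h.
Proof.
move=> fh; apply: homZ_ext => y; have [d <-] := x_gen y.
rewrite free_liftE !raddf_sum; apply: eq_bigr => -[j g] _.
by rewrite !raddfMz /= fh.
Qed.

(* With sum_j f(x_j) (x) a_j in I_G (B (x) U) written through elements b_(j, g),
   f is the norm of the map sending g x_j to
   [g = 1] (f(x_j) + sum_h b_(j, h)) - g b_(j, g). *)
Lemma tmapl_faithful (f : ghom X B) :
  tate_map (tmapl f U) (clsN1 (gens_sum x u)) = 0 -> cls0 (ghom_homZ f) = 0.
Proof.
have y0 : norm (gens_sum x u) = 0 := norm_univ csK.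
rewrite tate_map_clsN1 // => /clsN1_eq0; rewrite norm_ghom y0 ghom_raddf0.
move=> /(_ erefl).
have -> : tmapl f U (gens_sum x u) = \sum_j tpure (f (x j)) (u j).
  by rewrite /gens_sum ghom_raddf_sum; apply: eq_bigr => j _; rewrite tmaplE.
move=> fI.
have q_surj a : exists p, univ_proj cs p = a by exact: gproj_surj.
have qB_surj s : exists s', tensor_map B (univ_proj cs) s' = s.
  move: s; apply: tensor_ind => [|s s' [v <-] [v' <-]|b a].
  - by exists 0; rewrite ghom_raddf0.
  - by exists (v - v'); rewrite ghom_raddfB.
  - by have [a' <-] := q_surj a; exists (tpure b a'); rewrite tensor_map_pure.
have idS (b : B) : exists b', ghom_id B b' = b by exists b.
have [w wI wE] := in_aug_lift qB_surj fI.
pose t : tensor B P := \sum_j tpure (f (x j)) (univ_pre cs j) - w.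
have /(tensor_ker_span idS q_surj) tS : tmap (ghom_id B) (univ_proj cs) t = 0.
  rewrite -[LHS]/(tensor_map B (univ_proj cs) t) ghom_raddfB wE ghom_raddf_sum.
  by apply/eqP; rewrite subr_eq0; apply/eqP/eq_bigr => j _; rewrite tensor_map_pure.
(* t comes from the relations of U. With b' = h^-1 b, contracting b (x) h ([rel_gen g j]) gives g b'
   c_k(j, g) - b' c_k(j, 1), and [bb] collects these b'. *)
have [bb bbP] : exists bb : 'I_n * gT -> B, forall k : 'I_m, contract k t =
    \sum_(i : 'I_n * gT) (gact i.2 (bb i) *~ (cs`_k) i - bb i *~ (cs`_k) (i.1, 1%g)).
  have D0 k : \sum_(i : 'I_n * gT)
      (gact i.2 (0 : B) *~ (cs`_k) i - (0 : B) *~ (cs`_k) (i.1, 1%g)) = 0.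
    by rewrite big1 // => i _; rewrite raddf0 !mul0rz subrr.
  have DB (b1 b2 : 'I_n * gT -> B) k : \sum_(i : 'I_n * gT)
      (gact i.2 (b1 i - b2 i) *~ (cs`_k) i - (b1 i - b2 i) *~ (cs`_k) (i.1, 1%g)) =
      \sum_(i : 'I_n * gT) (gact i.2 (b1 i) *~ (cs`_k) i - b1 i *~ (cs`_k) (i.1, 1%g))
      - \sum_(i : 'I_n * gT) (gact i.2 (b2 i) *~ (cs`_k) i - b2 i *~ (cs`_k) (i.1, 1%g)).
    rewrite -sumrB; apply: eq_bigr => i _.
    by rewrite raddfB !mulrzBl !opprD !opprK addrACA.
  elim: tS => [|s s' _ [b sb] _ [b' sb']|s [b [p [bp ->]]]].
  - by exists (fun=> 0) => k; rewrite raddf0 D0.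
  - by exists (fun i => b i - b' i) => k; rewrite raddfB /= sb sb' DB.
  - case: bp => [/= ->|/gproj_eq0].
      by exists (fun=> 0) => k; rewrite tpure0l raddf0 D0.
    elim=> [|p1 p2 _ [b1 b1P] _ [b2 b2P]|_ [h [g [j ->]]]].
    + by exists (fun=> 0) => k; rewrite !raddf0 D0.
    + by exists (fun i => b1 i - b2 i) => k; rewrite tpureBr raddfB /= b1P b2P DB.
    + exists (fun i => if i == (j, g) then gact h^-1%g b else 0) => k.
      rewrite (bigD1 (j, g)) //= eqxx big1 ?addr0; last first.
        by move=> i /negPf ->; rewrite raddf0 !mul0rz subrr.
      have := contract_gact k h (tpure (gact h^-1%g b) (rel_gen cs g j)).
      rewrite gact_tpure gactVK => ->; rewrite /rel_gen tpureBr raddfB /=.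
      congr (_ - _).
        rewrite tpure_sumr raddf_sum (bigD1 k) //= raddfMz raddfMz /= contract_gen eqxx invgK.
        rewrite big1 ?addr0 // => l /negPf lk.
        by rewrite !raddfMz /= contract_gen eq_sym lk mul0rz.
      rewrite tpure_sumr raddf_sum (bigD1 k) //= raddfMz raddfMz /= contract_gen eqxx invg1 gact1.
      rewrite big1 ?addr0 // => l /negPf lk.
      by rewrite !raddfMz /= contract_gen eq_sym lk mul0rz.
(* The same contraction computed from the definition of t, to which w contributes nothing, being in
   I_G (B (x) P). *)
have tE (k : 'I_m) : contract k t = \sum_j f (x j) *~ (cs`_k) (j, 1%g).
  rewrite /t raddfB /= (coinvariant_in_aug (contract_gact k) wI) subr0 raddf_sum.
  apply: eq_bigr => j _ /=; rewrite /univ_pre tpure_sumr raddf_sum (bigD1 k) //=.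
  rewrite !raddfMz /= contract_gen eqxx invg1 gact1 big1 ?addr0 // => l /negPf lk.
  by rewrite !raddfMz /= contract_gen eq_sym lk mul0rz.
pose a (i : 'I_n * gT) : B :=
  (if i.2 == 1%g then f (x i.1) + \sum_h bb (i.1, h) else 0) - gact i.2 (bb i).
have kP : (free_sum a : F -> B) \in @additive_pred gT F B by apply/asboolP/free_sumB.
pose k : homZ F B := HomZ kP.
have sum1 (d : F) (z : 'I_n -> B) :
    \sum_(i : 'I_n * gT) (if i.2 == 1%g then z i.1 else 0) *~ d i =
    \sum_j z j *~ d (j, 1%g).
  rewrite (eq_bigr (fun i => (if i.2 == 1%g then z i.1 else 0) *~ d (i.1, i.2)));
    last by case.
  rewrite -(pair_bigA _ (fun j g => (if g == 1%g then z j else 0) *~ d (j, g))) /=.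
  apply: eq_bigr => j _; rewrite (bigD1 1%g) //= eqxx big1 ?addr0 // => g /negPf ->.
  by rewrite mul0rz.
(* Equality of the two values [tE] and [bbP] of the contraction is exactly the vanishing of k at
   this relation. *)
have kc (l : 'I_m) : k (cs`_l : F) = 0.
  rewrite -[LHS]/(\sum_i a i *~ (cs`_l) i).
  under eq_bigr do rewrite mulrzBl.
  rewrite sumrB (sum1 _ (fun j => f (x j) + \sum_h bb (j, h))).
  under eq_bigr do rewrite mulrzDl.
  rewrite big_split /= -tE bbP sumrB.
  have -> : \sum_j (\sum_h bb (j, h)) *~ (cs`_l) (j, 1%g) =
      \sum_(i : 'I_n * gT) bb i *~ (cs`_l) (i.1, 1%g).
    rewrite [RHS](eq_bigr (fun i => bb (i.1, i.2) *~ (cs`_l) (i.1, 1%g))); last by case.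
    rewrite -(pair_bigA _ (fun j g => bb (j, g) *~ (cs`_l) (j, 1%g))) /=.
    by apply: eq_bigr => j _; rewrite mulrz_suml.
  by rewrite subrK subrr.
have kK d : free_lift x d = 0 -> k d = 0.
  move=> /csP; elim=> [|d1 d2 _ k1 _ k2|{}d /csE[l ->]]; first exact: raddf0.
    by have -> : k (d1 - d2) = k d1 - k d2; [exact: raddfB|rewrite k1 k2 subrr].
  exact: kc.
have [k' k'E] := homZ_factor x_gen kK.
apply/cls0_eq0; first exact: invariant_ghom_homZ.
exists k'; apply: homZ_gens_ext => j h; rewrite homZ_sumE.
have k'g i g : k' (gact g (x i)) = a (i, g).
  by rewrite -free_lift_gen k'E; exact: free_sum_gen.
rewrite [LHS]/= ghomJ.
transitivity (\sum_g gact g (a (j, g^-1 * h)%g)); last first.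
  by apply: eq_bigr => g _; rewrite -k'g gactM.
(* In the first part only g = h contributes, with h f(x_j) plus h applied to the sum of the b_(j,
   l); the second part cancels the latter. *)
rewrite /a /=; under eq_bigr do rewrite raddfB.
rewrite sumrB.
have -> : \sum_g gact g (gact (g^-1 * h)%g (bb (j, g^-1 * h)%g)) =
    gact h (\sum_l bb (j, l)).
  rewrite raddf_sum [RHS](reindex_inj (mulIg h)) [RHS](reindex_inj invg_inj) /=.
  by apply: eq_bigr => g _; rewrite -gactM mulKVg.
have if_sum (z : B) : \sum_g gact g (if (g^-1 * h)%g == 1%g then z else 0) = gact h z.
  rewrite (bigD1 h) //= mulVg eqxx big1 ?addr0 // => g gh.
  rewrite ifF ?raddf0 //; apply/negP => /eqP E.
  by case/eqP: gh; rewrite -[h](mulKVg g) E mulg1.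
by rewrite if_sum raddfD addrK.
Qed.

End Yoneda.

(** * Conditions (e) and (f) *)

Section TensorEncoding.
Variable gT : finGroupType.
Implicit Types (A B C X Y : gmodType gT) (n p q r : int).

Lemma fin_gen_presentation X : fin_gen X ->
  exists (n : nat) (x : 'I_n -> X) (cs : seq (free_gmod gT 'I_n)),
  [/\ forall y, exists c : free_gmod gT 'I_n, free_lift x c = y,
      forall c, c \in cs -> free_lift x c = 0 &
      forall c, free_lift x c = 0 -> zspan (fun c => c \in cs) c].
Proof.
case=> s sP; pose x (j : 'I_(size s)) := s`_j.
have [||cs [csK csP]] := @subgroup_fin_gen _ (fun c : free_gmod gT 'I_(size s) => free_lift x c = 0).
- exact: ghom_raddf0.
- by move=> c d c0 d0; rewrite [LHS]ghom_raddfB c0 d0 subrr.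
exists (size s), x, cs; split=> // y; have [c ->] := sP y.
exists [ffun i : 'I_(size s) * gT => c i.1 i.2].
rewrite free_liftE.
rewrite (eq_bigr (fun i : 'I_(size s) * gT => gact i.2 (x i.1) *~ c i.1 i.2)).
  by rewrite -(pair_bigA _ (fun (j : 'I_(size s)) g => gact g (x j) *~ c j g)).
by move=> i _; rewrite ffunE.
Qed.

Definition lact X Y A p q n (e : p + q = n) (x : tateH p (homZ X Y))
    (y : tateH q (tensor X A)) : tateH n (tensor Y A) :=
  pcup (eval_pairing X Y A) e x y.

Lemma eval_comp X Y W A (f : homZ Y W) (h : homZ X Y) t :
  eval_pairing X W A (hcomp f h) t = eval_pairing Y W A f (eval_pairing X Y A h t).
Proof.
move: t; apply: tensor_ext => [u v|u v|x a]; rewrite ?pairBr //.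
by rewrite /= !hevalE.
Qed.

Lemma eval_hom_tens X Y A B (f : homZ X Y) t (h : homZ A B) :
  hom_tens Y A B (eval_pairing X Y A f t) h = eval_pairing X Y B f (hom_tens X A B t h).
Proof.
move: t; apply: tensor_ext => [u v|u v|x a]; rewrite ?pairBr ?pairBl ?pairBr //.
by rewrite /= hevalE !hom_tensE hevalE.
Qed.

Lemma eval_id X A t : eval_pairing X X A (idZ X) t = t.
Proof.
move: t; apply: tensor_ext => [u v|u v|x a]; rewrite ?pairBr //.
by rewrite /= hevalE.
Qed.

Lemma lactA X Y W A p q r pq qr n (e1 : p + q = pq) (e2 : pq + r = n)
    (e3 : q + r = qr) (e4 : p + qr = n) x y z :
  @lact X W A _ _ _ e2 (@gcomp gT X Y W _ _ _ e1 x y) z = lact e4 x (lact e3 y z).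
Proof. by apply: pcupA => *; exact: eval_comp. Qed.

Lemma lact_idc X A q (e : 0 + q = q) (y : tateH q (tensor X A)) : lact e (idc X) y = y.
Proof.
rewrite /lact (pcup_cls0l _ (k := ghom_id _)) ?tate_map_id //.
  exact: invariant_idZ.
by move=> t; exact: eval_id.
Qed.

Lemma lact_ghom X Y A (f : ghom X Y) q (e : 0 + q = q) (y : tateH q (tensor X A)) :
  lact e (cls0 (ghom_homZ f)) y = tate_map (tmapl f A) y.
Proof. by apply: pcup_cls0l => //; exact: invariant_ghom_homZ. Qed.

Lemma lact_map X Y A B (k : ghom A B) p q n (e : p + q = n) (x : tateH p (homZ X Y)) y :
  tate_map (tensor_map Y k) (lact e x y) = lact e x (tate_map (tensor_map X k) y).
Proof.
rewrite /lact (pcup_map (m' := eval_pairing X Y B) (a := ghom_id _) (b := tensor_map X k)).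
  by rewrite tate_map_id.
by move=> f t; exact: (eval_hom_tens f t (ghom_homZ k)).
Qed.

Lemma lactK X Y A p p' (x : tateH p (homZ X Y)) (x' : tateH p' (homZ Y X))
    q n (e1 : p + q = n) (e2 : p' + n = q) (e : p' + p = 0) :
  gcomp e x' x = idc X -> cancel (@lact X Y A _ _ _ e1 x) (lact e2 x').
Proof.
move=> H y; have e0 : 0 + q = q by lia.
by rewrite -(lactA e e0) H lact_idc.
Qed.

Section Representability.
Variables (X Y : gmodType gT) (r s : int) (e : r + -1 = s).
Variable psi : forall A : gmodType gT, tateH (-1) (tensor X A) -> tateH s (tensor Y A).
Hypothesis psiB : forall A, zmod_morphism (@psi A).
Hypothesis psiN : forall (A A' : gmodType gT) (k : ghom A A') y,
  psi (tate_map (tensor_map X k) y) = tate_map (tensor_map Y k) (psi y).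

(** Y is isomorphic in degree r to some B; multiplying by the inverse v' brings psi to degree -1 on
    both sides, where it is induced by a homomorphism f, and x = v [f]. *)
Lemma tensor_natural_cup : fin_gen X -> exists x : tateH r (homZ X Y),
  forall (A : gmodType gT) (y : tateH (-1) (tensor X A)), psi y = lact e x y.
Proof.
move=> /fin_gen_presentation[n [g [cs [g_gen csK csP]]]].
have [B /shift_iso_sym] := shift_iso_exists (- r) Y.
rewrite opprK => /shift_isoP[v [v' [e1 [e2 [vv v'v]]]]].
have e3 : - r + s = -1 by lia.
have phiB A : zmod_morphism (fun y => @lact Y B A _ _ _ e3 v' (psi y)).
  by move=> y y'; rewrite psiB; exact: pcupBr.
have [A A' k y|f fE] := natural_tmapl g_gen csK csP phiB.
  by rewrite psiN lact_map.
exists (gcomp (addr0 r) v (cls0 (ghom_homZ f))) => A y.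
have e4 : 0 + -1 = -1 :> int by [].
rewrite (lactA (addr0 r) e e4 e) lact_ghom -fE.
by rewrite (lactK e3 e v'v).
Qed.
End Representability.

(** Uniqueness in the representability: c is the class of a homomorphism, and its value on the
    universal element already decides whether it vanishes. *)
Lemma lact_faithful X Y (e : 0 + -1 = -1) (c : tateH 0 (homZ X Y)) : fin_gen X ->
  (forall A (y : tateH (-1) (tensor X A)), lact e c y = 0) -> c = 0.
Proof.
move=> /fin_gen_presentation[n [g [cs [g_gen csK csP]]]] H.
have [f fE] := homZ_cls0P c; rewrite fE; apply: (tmapl_faithful g_gen csK csP).
by rewrite -(lact_ghom f e) -fE.
Qed.

(** Kept apart from [shift_iso]: for the swapped product the inverses of the basic shifts have the
    opposite sign. *)
Definition op_invertible d A := exists B d' (z : tateH d (homZ A B)) (z' : tateH d' (homZ B A))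
  (e : d + d' = 0) (e' : d' + d = 0), gcomp_op e z z' = idc A /\ gcomp_op e' z' z = idc B.

Lemma op_invertible_up A : op_invertible 1 A.
Proof.
have [e e'] : 1 + -1 = 0 :> int /\ -1 + 1 = 0 :> int by [].
by do 4 eexists; exists e, e'; exact: upshift_inverse_op (upshift_up A) e e'.
Qed.

Lemma op_invertible_down A : op_invertible (-1) A.
Proof.
have [e e'] : 1 + -1 = 0 :> int /\ -1 + 1 = 0 :> int by [].
by do 4 eexists; exists e', e; exact: downshift_inverse_op (downshift_down A) e e'.
Qed.

Section Bijectivity.
Variables (X Y : gmodType gT) (r : int) (x : tateH r (homZ X Y)).

Definition lact_bijective n : Prop :=
  forall A m (e : r + n = m), bijective (@lact X Y A r n m e x).

(** The class z acts on the variable A from the right, hence commutes with x, which acts from the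
    left. *)
Lemma lact_bijective_shift d n : (forall A, op_invertible d A) ->
  lact_bijective (n + d) -> lact_bijective n.
Proof.
move=> Hd H A m e; have [B [d' [z [z' [e1 [e2 [zz z'z]]]]]]] := Hd A.
have [e3 e4 e5] : [/\ n + d + d' = n, m + d + d' = m & r + (n + d) = m + d] by split; lia.
have [f fK Kf] := H B _ e5.
have C (y : tateH n (tensor X A)) :
    cup_act (T := tensR Y) erefl (lact e x y) z =
    lact e5 x (cup_act (T := tensR X) erefl y z).
  by apply: pcupA => *; exact: eval_hom_tens.
exists (fun y => cup_act (T := tensR X) e3 (f (cup_act (T := tensR Y) erefl y z)) z') => y.
  by rewrite C fK (cup_actK _ _ zz).
have K' p (e6 : p + d + d' = p) W (v : tateH (p + d) (tensor W B)) :
    cup_act (T := tensR W) erefl (cup_act (T := tensR W) e6 v z') z = v.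
  exact: (cup_actK (T := tensR W)) z'z v.
have K p (e6 : p + d + d' = p) W (v : tateH p (tensor W A)) :
    cup_act (T := tensR W) e6 (cup_act (T := tensR W) erefl v z) z' = v.
  exact: (cup_actK (T := tensR W)) zz v.
by rewrite -[LHS](K _ e4) C K' Kf K.
Qed.

Lemma lact_bijective_all i : lact_bijective i -> forall n, lact_bijective n.
Proof.
move=> H; apply: (int_step_ind H) => n Hn.
  apply: (lact_bijective_shift op_invertible_down); by rewrite addrK.
by apply: (lact_bijective_shift op_invertible_up); rewrite subrK.
Qed.
End Bijectivity.

Lemma tensor_nat_iso_shift_iso r i X X' : fin_gen X -> fin_gen X' ->
  nat_iso_between (tensR X') (tensR X) i (i + r) -> shift_iso r X' X.
Proof.
move=> Xfg X'fg /nat_iso_between_all/(_ (-1)).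
rewrite addrC => -[psi [psiB psi_bij psiN]].
pose e := erefl (r + -1).
have rmapE W A B (k : ghom A B) n :
    tate_map (n := n) (tensor_map W k) =1 tate_map (rmap (tensR W) k).
  exact: eq_tate_map.
have psiN' A A' (k : ghom A A') y :
    psi A' (tate_map (tensor_map X' k) y) = tate_map (tensor_map X k) (psi A y).
  by rewrite !rmapE.
have [x xE] := tensor_natural_cup e psiB psiN' X'fg.
have xbij : forall n, lact_bijective x n.
  apply: (lact_bijective_all (i := -1)) => A m em; case: m / em.
  exact: (@eq_bij _ _ _ (psi_bij A) (fun y => lact e x y) (xE A)).
have e1 : r + (- r + -1) = -1 by lia.
(* To be represented in turn, the inverse must start in degree -1 of X and end in degree - r - 1 of
   X'; it comes from bijectivity of x in that degree and not from psi itself. *)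
have inv A : exists f, cancel (@lact X' X A _ _ _ e1 x) f /\ cancel f (lact e1 x).
  by have [f fK Kf] := xbij _ A _ e1; exists f.
pose th A := projT1 (cid (inv A)).
have thK A : cancel (@lact X' X A _ _ _ e1 x) (th A) by rewrite /th; case: cid => f [].
have Kth A : cancel (th A) (@lact X' X A _ _ _ e1 x) by rewrite /th; case: cid => f [].
have thB A : zmod_morphism (th A).
  move=> y y'; apply: (can_inj (thK A)); rewrite [RHS]pcupBr.
  by rewrite -!/(lact _ _ _) !Kth.
have thN A A' (k : ghom A A') y :
    th A' (tate_map (tensor_map X k) y) = tate_map (tensor_map X' k) (th A y).
  by apply: (can_inj (thK A')); rewrite Kth -lact_map Kth.
pose e2 := erefl (- r + -1).
have [x' x'E] := tensor_natural_cup e2 thB thN Xfg.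
have [e3 e3' e4] : [/\ r + - r = 0, - r + r = 0 & 0 + -1 = -1 :> int] by split; lia.
have id_of W (c : tateH 0 (homZ W W)) : fin_gen W ->
    (forall A (y : tateH (-1) (tensor W A)), lact e4 c y = y) -> c = idc W.
  move=> Wfg H; apply/eqP; rewrite -subr_eq0; apply/eqP/(lact_faithful (e := e4)) => // A y.
  by rewrite [LHS]pcupBl -!/(lact _ _ _) H lact_idc subrr.
have xx' : gcomp e3 x x' = idc X.
  apply: id_of => // A y.
  by rewrite (lactA e3 e4 e2 e1) -x'E Kth.
exists (- r), x, x', e3, e3'; split=> //; apply: id_of => // A y.
have /bij_inj inj := xbij _ A _ e; apply: inj.
have e5 : - r + (r + -1) = -1 by lia.
by rewrite (lactA e3' e4 e e5) (lactK e5 e xx').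
Qed.

Lemma shift_iso_tensor_nat_iso r X X' i (x : tateH r (homZ X' X)) r'
    (x' : tateH r' (homZ X X')) : inverse_classes x x' ->
  @is_nat_iso gT (tensorTate i X') (tensorTate (i + r) X)
    (fun A y => tate_cast (addrC r i) (cup_eval x y)).
Proof.
move=> [e [e' [H1 H2]]].
have E A (y : tateH i (tensor X' A)) :
  tate_cast (addrC r i) (cup_eval x y) = lact (addrC r i) x y by [].
split.
- by move=> A; exact: (pcupBr (eval_pairing X' X A) (addrC r i) x).
- move=> A; have ei : r' + (i + r) = i by lia.
  exists (lact ei x'); first exact: lactK H1.
  exact: lactK H2.
- by move=> A B k y; rewrite /= E -lact_map.
Qed.

Theorem encoding_tensor r X X' : fin_gen X -> fin_gen X' ->
  (encoding_pair r X X' <->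
     exists (i : int) (phi : forall A, tensorTate i X' A -> tensorTate (i + r) X A),
       is_nat_iso phi)
  /\ (encoding_pair r X X' <->
     exists x : tateH r (homZ X' X), forall i : int,
       @is_nat_iso gT (tensorTate i X') (tensorTate (i + r) X)
         (fun A y => tate_cast (addrC r i) (cup_eval x y))).
Proof.
move=> Xfg X'fg.
have ef : (exists x : tateH r (homZ X' X), forall i : int,
       @is_nat_iso gT (tensorTate i X') (tensorTate (i + r) X)
         (fun A y => tate_cast (addrC r i) (cup_eval x y))) ->
    exists (i : int) (phi : forall A, tensorTate i X' A -> tensorTate (i + r) X A),
       is_nat_iso phi.
  by case=> x /(_ 0) H; exists 0; eexists; exact: H.
have ea : (exists (i : int) (phi : forall A, tensorTate i X' A -> tensorTate (i + r) X A),
       is_nat_iso phi) -> encoding_pair r X X'.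
  case/tensor_nat_isoE=> i H; apply/encoding_pairP.
  exact: tensor_nat_iso_shift_iso H.
have af : encoding_pair r X X' -> exists x : tateH r (homZ X' X), forall i : int,
       @is_nat_iso gT (tensorTate i X') (tensorTate (i + r) X)
         (fun A y => tate_cast (addrC r i) (cup_eval x y)).
  case/encoding_pairP=> r' [x [x' H]]; exists x => i.
  exact: shift_iso_tensor_nat_iso H.
by split; split=> H; auto.
Qed.

End TensorEncoding.

(** * Characters of abelian groups *)

Section Divisible.
Variable V : zmodType.

(* The graph, lifted from Q/Z to Q, of a homomorphism from a subgroup of V to Q/Z. *)
Definition partial_char (S : V -> rat -> Prop) : Prop :=
  [/\ S 0 0, forall v q v' q', S v q -> S v' q' -> S (v - v') (q - q') &
      forall q, S 0 q -> exists n : int, q = n%:~R].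

Section PartialChar.
Variable S : V -> rat -> Prop.
Hypothesis SP : partial_char S.

Lemma partial_charN v q : S v q -> S (- v) (- q).
Proof. by case: SP => S0 SB _ Sv; rewrite -(sub0r v) -(sub0r q); exact: SB. Qed.

Lemma partial_charD v q v' q' : S v q -> S v' q' -> S (v + v') (q + q').
Proof.
case: SP => _ SB _ Sv Sv'; rewrite -[v']opprK -[q']opprK.
exact/SB/partial_charN.
Qed.

Lemma partial_charMz v q (n : int) : S v q -> S (v *~ n) (q *~ n).
Proof.
move=> Sv; have N (k : nat) : S (v *~ k) (q *~ k).
  elim: k => [|k IH]; first by case: SP.
  by rewrite intS !mulrzDr; exact: partial_charD.
by case: n => n; rewrite ?NegzE ?mulrNz; [|apply: partial_charN]; exact: N.
Qed.

(* Adjoining v: divisibility of Q provides a value q0 compatible with the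
   multiples of v at which S is already defined. *)
Lemma partial_char_adjoin v : exists S', [/\ partial_char S',
  forall w q, S w q -> S' w q & exists q, S' v q].
Proof.
case: (SP) => S0 SB Sint.
have [q0 q0P] : exists q0, forall n q, S (v *~ n) q -> exists k : int, q - q0 *~ n = k%:~R.
  (* If no positive multiple of v lies in the domain, only n = 0 imposes a condition, and q0 = 0
     satisfies it. *)
  have [[d d0 [p Sp]]|H] := pselect (exists2 d : nat, (0 < d)%N & exists p, S (v *~ d) p);
    last first.
    exists 0 => n q Sn; have n0 : n = 0.
      apply: contrapT => /eqP n0; apply: H; exists (absz n); first by rewrite absz_gt0.
      have E : (absz n)%:Z = n * sgz n by rewrite abszEsg mulrC.
      by exists (q *~ sgz n); rewrite E mulrzA; exact: partial_charMz.
    by move: Sn; rewrite n0 mulr0z => /Sint[k ->]; exists k; rewrite mulr0z subr0.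
  pose D (d : nat) := (0 < d)%N && `[< exists p, S (v *~ d) p >].
  have exD : exists d, D d by exists d; rewrite /D d0; apply/asboolP; exists p.
  case: (ex_minnP exD) => {d0 Sp p exD}d /andP[d0 /asboolP[p Sp]] dmin.
  have dQ : d%:~R != 0 :> rat by rewrite intr_eq0; case: d d0 {Sp dmin}.
  (* By minimality of d, n v lies in the domain only if d divides n, so compatibility at d v is
     enough. *)
  exists (p / d%:~R) => n q Sn.
  have Sr : S (v *~ (n %% d)%Z) (q - p *~ (n %/ d)%Z).
    have := SB _ _ _ _ Sn (partial_charMz (n %/ d)%Z Sp).
    by rewrite -mulrzA mulrC -mulrzBr /modz.
  have r0 : (n %% d)%Z = 0.
    apply: contrapT => /eqP r0.
    have rge0 : 0 <= (n %% d)%Z by apply: modz_ge0; lia.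
    have rlt : (n %% d)%Z < d by apply: ltz_pmod; lia.
    have /dmin : D (absz (n %% d)%Z).
      rewrite /D absz_gt0 r0; apply/asboolP; exists (q - p *~ (n %/ d)%Z).
      by rewrite ssrint.gez0_abs.
    by lia.
  move: Sr; rewrite r0 mulr0z => /Sint[k kE]; exists k; rewrite -kE; congr (_ - _).
  have pd : (p / d%:~R) *~ d = p by rewrite -mulrzr divfK.
  transitivity ((p / d%:~R) *~ (d%:Z * (n %/ d)%Z)); last by rewrite mulrzA pd.
  by congr (_ *~ _); rewrite {1}(divz_eq n d) r0 addr0 mulrC.
exists (fun w q => exists n : int, S (w - v *~ n) (q - q0 *~ n)); split.
- split.
  + by exists 0; rewrite !mulr0z !subr0.
  + move=> w q w' q' [n Sn] [n' Sn']; exists (n - n').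
    have H := SB _ _ _ _ Sn Sn'; rewrite !mulrzBr !opprD !opprK in H *.
    by rewrite (addrACA w) (addrACA q).
  + move=> q [n]; rewrite sub0r => /partial_charN; rewrite opprK => /q0P[k].
    by rewrite opprB addrAC subrr sub0r => E; exists (- k); rewrite rmorphN /= -E opprK.
- by move=> w q Sw; exists 0; rewrite !mulr0z !subr0.
- by exists q0, 1; rewrite !mulr1z !subrr.
Qed.
End PartialChar.

(** Zorn's lemma: a maximal extension is total, as [partial_char_adjoin] would enlarge it at any
    missing v. *)
Lemma partial_char_extend S0 : partial_char S0 -> exists S,
  [/\ partial_char S, forall v q, S0 v q -> S v q & forall v, exists q, S v q].
Proof.
move=> S0P; pose good S := partial_char S /\ forall v q, S0 v q -> S v q.
pose T := {S | good S}.
pose R (s t : T) : bool := `[< forall v q, sval s v q -> sval t v q >].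
have t0 : T by exists S0.
have [||A AR|t tmax] := @classical_sets.ZL_preorder T t0 R.
- by move=> t; apply/asboolP.
- by move=> r s t /asboolP rs /asboolP st; apply/asboolP => v q /rs/st.
- have [[s0 As0]|A0] := pselect (exists s, A s); last first.
    by exists t0 => s As; case: A0; exists s.
  pose U v q := exists2 s, A s & sval s v q.
  have UP : good U.
    split; last by move=> v q Sv; exists s0 => //; case: s0 As0 => s [sP sS0] _; exact: sS0.
    split.
    + by exists s0 => //; case: s0 As0 => s [[]].
    + move=> v q v' q' [s As Ss] [s' As' Ss'].
      have [/asboolP ss|/asboolP ss] := AR _ _ As As'; [exists s'|exists s] => //.
        by case: s' As' Ss' ss => s' [[_ sB _] _] /= _ Ss' ss; apply: sB => //; exact: ss.
      by case: s As Ss ss => s [[_ sB _] _] /= _ Ss ss; apply: sB => //; exact: ss.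
    + by move=> q [[s [[_ _ sZ] _]]] /= _ /sZ.
  by exists (exist _ U UP) => s As; apply/asboolP => v q Ss; exists s.
case: t tmax => S [SP S0S] Smax; exists S; split=> // v.
have [S' [S'P SS' [q Sq]]] := partial_char_adjoin SP v.
have S'good : good S' by split=> // w p /S0S/SS'.
have /asboolP/= H := Smax (exist _ S' S'good) (introT (asboolP _) SS').
by exists q; exact: H.
Qed.

(* Homomorphisms to Q/Z, given by graphs lifted to Q, lift to Q. *)
Definition char_liftable : Prop := forall S : V -> rat -> Prop,
  S 0 0 -> (forall v q v' q', S v q -> S v' q' -> S (v - v') (q - q')) ->
  (forall v, exists q, S v q) ->
  exists2 l : V -> rat, zmod_morphism l & forall v, S v (l v).

End Divisible.

Lemma Zfree_char_liftable (V : zmodType) : Zfree V -> char_liftable V.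
Proof.
case=> I [phi phiB [psi phiK psiK]] S S0 SB Stot.
have phi_mor := GRing.isZmodMorphism.Build _ _ _ phiB.
pose ph : {additive {freeg I / int} -> V} := HB.pack phi phi_mor.
have SN v q : S v q -> S (- v) (- q) by move=> Sv; rewrite -(sub0r v) -(sub0r q); exact: SB.
have SD v q v' q' : S v q -> S v' q' -> S (v + v') (q + q').
  by move=> Sv Sv'; rewrite -[v']opprK -[q']opprK; exact/SB/SN.
have SMz v q (n : int) : S v q -> S (v *~ n) (q *~ n).
  move=> Sv; have N (k : nat) : S (v *~ k) (q *~ k).
    by elim: k => [|k IH] //; rewrite intS !mulrzDr; exact: SD.
  by case: n => n; rewrite ?NegzE ?mulrNz; [|apply: SN]; exact: N.
pose q i := projT1 (cid (Stot (phi << i >>))).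
have qP i : S (phi << i >>) (q i) by rewrite /q; case: cid.
pose l u : rat := fglift (fun i => q i : zmodule rat) u.
have lB : zmod_morphism l := lift_is_additive (fun i => q i : zmodule rat).
have lU i : l << i >> = q i by rewrite /l liftU scale1r.
pose la : {additive {freeg I / int} -> rat} :=
  HB.pack l (GRing.isZmodMorphism.Build _ _ _ lB).
have lS u : S (phi u) (l u).
  rewrite -(freeg_sumE u) -[phi _]/(ph _) -[l _]/(la _) !raddf_sum.
  elim: (dom u) => [|i r IH]; first by rewrite !big_nil.
  rewrite !big_cons; apply: SD => //.
  rewrite -[X in << X *g _ >>]intz -freegU_mulz !raddfMz.
  by apply: SMz; rewrite [la _]lU; exact: qP.
exists (l \o psi) => [x y|v] /=; last by rewrite -[v in S v](psiK v); exact: lS.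
by rewrite -lB -{1}(psiK x) -{1}(psiK y) -phiB phiK.
Qed.

(** * Lifting of characters under degree shifts *)

Section Liftable.
Variable gT : finGroupType.
Local Notation I := (augIdeal gT).
Local Notation Z := (trivZ gT).
Implicit Types (A B X Y : gmodType gT).

Lemma sum_down Y (k : homZ I Y) : k = \sum_u down Y (coef u) (k (aug_diff 1 u)).
Proof.
have [_ H] := downshift_down Y.
have := congr1 (fun f : homZ (homZ I Y) (homZ I Y) => f k) H.
by rewrite homZ_sumE => E; exact: (esym E).
Qed.

(** By [sum_down], Hom(I_G, Y) is a retract of a finite power of Y through k |-> (k(u - 1))_u, so it
    suffices to lift on each copy of Y. Transporting freeness would instead require bases. *)
Lemma homZ_char_liftable Y : char_liftable Y -> char_liftable (homZ I Y : gmodType gT).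
Proof.
move=> YL S S0 SB Stot.
have Lu u : exists2 l : Y -> rat, zmod_morphism l & forall y, S (down Y (coef u) y) (l y).
  apply: (YL (fun y q => S (down Y (coef u) y) q)) => [|v q v' q' Sv Sv'|v].
  - by rewrite raddf0.
  - by rewrite raddfB; exact: SB.
  - exact: Stot.
pose l u := projT1 (cid2 (Lu u)).
have lB u : zmod_morphism (l u) by rewrite /l; case: cid2.
have lS u y : S (down Y (coef u) y) (l u y) by rewrite /l; case: cid2.
have SD v q v' q' : S v q -> S v' q' -> S (v + v') (q + q').
  move=> Sv Sv'; rewrite -[v']opprK -[q']opprK; apply: (SB) => //.
  by rewrite -(sub0r v') -(sub0r q'); exact: SB.
exists (fun k : homZ I Y => \sum_u l u (k (aug_diff 1 u))) => [k k'|k].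
  by rewrite -sumrB; apply: eq_bigr => u _; rewrite -lB.
rewrite [k in S k](sum_down k).
by apply: (big_ind2 S) => [|v q v' q'|u _]; [exact: S0|exact: SD|exact: lS].
Qed.

(** Likewise [aug_expand] makes I_G (x) Y a retract of a finite power of Y. *)
Lemma tensor_char_liftable Y : char_liftable Y -> char_liftable (tensor I Y : gmodType gT).
Proof.
move=> YL S S0 SB Stot.
have Lu u : exists2 l : Y -> rat, zmod_morphism l & forall y, S (tpure (aug_diff 1 u) y) (l y).
  apply: (YL (fun y q => S (tpure (aug_diff 1 u) y) q)) => [|v q v' q' Sv Sv'|v].
  - by rewrite raddf0.
  - by rewrite raddfB; exact: SB.
  - exact: Stot.
pose l u := projT1 (cid2 (Lu u)).
have lB u : zmod_morphism (l u) by rewrite /l; case: cid2.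
have lS u y : S (tpure (aug_diff 1 u) y) (l u y) by rewrite /l; case: cid2.
have SN v q : S v q -> S (- v) (- q) by move=> Sv; rewrite -(sub0r v) -(sub0r q); exact: SB.
have SD v q v' q' : S v q -> S v' q' -> S (v + v') (q + q').
  by move=> Sv Sv'; rewrite -[v']opprK -[q']opprK; exact/SB/SN.
have SMz v q (n : int) : S v q -> S (v *~ n) (q *~ n).
  move=> Sv; have N (k : nat) : S (v *~ k) (q *~ k).
    by elim: k => [|k IH] //; rewrite intS !mulrzDr; exact: SD.
  by case: n => n; rewrite ?NegzE ?mulrNz; [|apply: SN]; exact: N.
pose f (b : I) (y : Y) : rat := \sum_u l u y *~ (coef u b).
have fP : biadditive f.
  split=> [y b b'|b y y']; rewrite /f -sumrB; apply: eq_bigr => u _.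
    by rewrite raddfB mulrzBr.
  by rewrite lB mulrzBl.
exists (tlift f); first exact: tliftB.
apply: tensor_ind => [|t t' St St'|b y].
- by have := tliftB fP 0 0; rewrite !subrr => ->.
- by rewrite tliftB //; exact: SB.
rewrite tliftE // -[in tpure b y](aug_expand b) tpure_suml /f.
apply: (big_ind2 S) => [|v q v' q'|u _]; [exact: S0|exact: SD|].
by rewrite -[tpure _ _]/(tensor_pairing I Y _ y) pairMzl; apply: SMz; exact: lS.
Qed.

Lemma shift_iso_liftable r X : char_liftable X ->
  exists2 Y, shift_iso r X Y & char_liftable Y.
Proof.
move=> XL; move: r; apply: (@int_step_ind _ 0) => [|n [B AB BL]|n [B AB BL]].
- by exists X => //; exact: shift_iso_refl.
- exists (tensor I B : gmodType gT); last exact: tensor_char_liftable.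
  by apply: shift_iso_trans AB (shift_iso_up (upshift_up B)).
- exists (homZ I B : gmodType gT); last exact: homZ_char_liftable.
  by apply: shift_iso_trans AB (shift_iso_down (downshift_down B)).
Qed.

(* If the class of a generates H^0(Y) and has order |G|, then the character
   a |-> 1/|G| of Y^G / N_G Y extends to Y and lifts to l : Y -> Q, and
   y |-> l (N_G y) is integral. *)
Lemma invariant_functional Y (a : Y) : char_liftable Y -> invariant a ->
  (forall b, invariant b -> exists n : int, cls0 b = cls0 a *~ n) ->
  (forall n : int, cls0 a *~ n = 0 -> (#|gT|%:Z %| n)%Z) ->
  exists (f : ghom Y Z) (k : int), f a = 1 + k * #|gT|%:Z.
Proof.
move=> YL aI agen aord.
have G0 : #|gT|%:R != 0 :> rat by rewrite Num.Theory.pnatr_eq0 -lt0n; apply/card_gt0P; exists 1%g.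
(* The character sending the class n [a] to n/|G| modulo Z; [aord] makes it well defined. *)
pose S0 (b : Y) (q : rat) := invariant b /\
  exists2 n : int, q *~ #|gT|%:Z = n%:~R & cls0 b = cls0 a *~ n.
have S0P : partial_char S0.
  split.
  - split; first by move=> g; exact: raddf0.
    by exists 0; rewrite ?mul0rz // mulr0z cls0_0.
  - move=> v q v' q' [vI [n qn vn]] [v'I [n' qn' vn']]; split; first exact: invariantB.
    exists (n - n'); first by rewrite mulrzBl qn qn' mulrzBr.
    by rewrite cls0B // vn vn' mulrzBr.
  - move=> q [_ [n qn]]; rewrite cls0_0 => /esym/aord/dvdzP[k nk]; exists k.
    apply: (mulIf G0); rewrite -[in LHS]mulrzr in qn *.
    by rewrite qn nk intrM.
have [S [[S00 SB Sint] S0S Stot]] := partial_char_extend S0P.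
have [l lB lS] := YL S S00 SB Stot.
pose la : {additive Y -> rat} := HB.pack l (GRing.isZmodMorphism.Build _ _ _ lB).
have lint y : exists n : int, l (norm y) = n%:~R.
  apply: Sint; rewrite -(subrr (norm y)) -[l _]subr0; apply: SB; first exact: lS.
  apply: S0S; split; first exact: invariant_norm.
  by exists 0; [rewrite mul0rz|rewrite mulr0z; exact: cls0_norm].
pose f y : Z := projT1 (cid (lint y)).
have fE y : (f y : int)%:~R = l (norm y) by rewrite /f; case: cid.
have fB : zmod_morphism f.
  move=> y y'; apply: (@intr_inj rat); rewrite fE raddfB lB -!fE.
  by rewrite -rmorphB.
have fJ g y : f (gact g y) = gact g (f y).
  by apply: (@intr_inj rat); rewrite [LHS]fE norm_gact -fE.
exists (GHom fB fJ).
(* Both l a and 1/|G| are values at a, so they differ by an integer k; the norm of a is |G| a,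
   whence f a = |G| l a = 1 + k |G|. *)
have Sa : S 0 (l a - #|gT|%:R^-1).
  rewrite -(subrr a); apply: SB; first exact: lS.
  apply: S0S; split=> //; exists 1; last by rewrite mulr1z.
  by rewrite -mulrzr mulVf.
have [k kE] := Sint _ Sa; exists k.
apply: (@intr_inj rat); rewrite [LHS]fE.
have -> : norm a = a *~ #|gT|%:Z.
  by rewrite /norm; under eq_bigr do rewrite aI; rewrite sumr_const -pmulrn.
rewrite -[l _]/(la _) raddfMz /= -mulrzr rmorphD rmorphM /= -kE mulrBl mulVf //.
by rewrite addrC subrK.
Qed.

End Liftable.

(** * The trivial module *)

Definition cyclic_of_order (V : zmodType) (e : nat) (c : V) : Prop :=
  (forall v, exists n : int, v = c *~ n) /\
  (forall n : int, c *~ n = 0 <-> (e %| n)%Z).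

Section CyclicGroups.
Variable e : nat.
Hypothesis e_gt0 : (0 < e)%N.

Let g1 : Zmod e := inZp 1.

Lemma Zmod_gen (a : Zmod e) : a = g1 *~ (val a)%:Z.
Proof.
rewrite -pmulrn Zp_mulrn; apply: val_inj => /=.
by rewrite modnMml mul1n modn_small.
Qed.

Lemma Zmod_order (n : int) : g1 *~ n = 0 <-> (e %| n)%Z.
Proof.
have N (k : nat) : g1 *~ k = 0 <-> (e %| k)%N.
  rewrite -pmulrn Zp_mulrn; split=> [/(congr1 val)/=|ek].
    by rewrite modnMml mul1n prednK // => /eqP.
  by apply: val_inj => /=; rewrite modnMml mul1n prednK //; apply/eqP.
case: n => n; first exact: N.
rewrite NegzE mulrNz rpredN; split=> [/eqP|H].
  by rewrite oppr_eq0 => /eqP/N.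
by apply/eqP; rewrite oppr_eq0; apply/eqP/N.
Qed.

Lemma zmod_iso_cyclic (V : zmodType) :
  zmod_iso V (Zmod e) <-> exists c : V, cyclic_of_order e c.
Proof.
split=> [[phi phiB [psi phiK psiK]]|[c [cgen cord]]].
  pose ph : {additive V -> Zmod e} :=
    HB.pack phi (GRing.isZmodMorphism.Build _ _ _ phiB).
  exists (psi g1); split=> [v|n].
    exists (val (phi v)); apply: (can_inj phiK).
    by rewrite -[RHS]/(ph _) raddfMz /= psiK -Zmod_gen.
  rewrite -Zmod_order -{2}(psiK g1) -[phi _]/(ph _) -raddfMz /=.
  split=> [->|H]; first exact: (raddf0 ph).
  by apply: (can_inj phiK); rewrite H; exact: esym (raddf0 ph).
pose k v := projT1 (cid (cgen v)).
have kP v : v = c *~ k v by rewrite /k; case: cid.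
have eq_g1 n n' : c *~ n = c *~ n' -> g1 *~ n = g1 *~ n'.
  move=> E; apply/eqP; rewrite -subr_eq0 -mulrzBr; apply/eqP/Zmod_order/cord.
  by rewrite mulrzBr E subrr.
exists (fun v => g1 *~ k v).
  by move=> v w; rewrite -mulrzBr; apply: eq_g1; rewrite mulrzBr -!kP.
exists (fun a : Zmod e => c *~ (val a)%:Z) => [v|a].
  rewrite [RHS]kP; apply/eqP; rewrite -subr_eq0 -mulrzBr; apply/eqP/cord/Zmod_order.
  by rewrite mulrzBr -Zmod_gen subrr.
by rewrite [RHS]Zmod_gen; apply: eq_g1; rewrite -kP.
Qed.
End CyclicGroups.

Section TrivialModule.
Variable gT : finGroupType.
Local Notation Z := (trivZ gT).
Implicit Types (A B X Y : gmodType gT) (n r : int).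

(** x is the product of the class of 1 in H^0(G, Z) with x, and |G| times that class is the class of
    a norm. *)
Lemma tateH_card A n (x : tateH n A) : x *~ #|gT|%:Z = 0.
Proof.
have i1 : invariant (1 : Z) by [].
have e : 0 + n = n by lia.
have E : pcup (scal_pairing A) e (cls0 (1 : Z)) x = x.
  by rewrite (pcup_cls0l _ (k := ghom_id A)) ?tate_map_id // => a; exact: mulr1z.
by rewrite -E -pcupMzl -cls0Mz // cls0_card // pcup0l.
Qed.

(** Turns the groups H^r(G, X) of (g) into morphisms from Z in the graded category. *)
Definition from_unit X : ghom X (homZ Z X) := curry (swap_pairing (scal_pairing X)).
Fact at_unitB X : zmod_morphism (fun f : homZ Z X => f (1 : Z)).
Proof. by []. Qed.
Fact at_unitJ X g (f : homZ Z X) : (gact g f) (1 : Z) = gact g (f (1 : Z)).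
Proof. by []. Qed.
Definition at_unit X : ghom (homZ Z X) X := GHom (@at_unitB X) (@at_unitJ X).

Lemma from_unitK X (x : X) : at_unit X (from_unit X x) = x.
Proof. exact: mulr1z. Qed.
Lemma at_unitK X (f : homZ Z X) : from_unit X (at_unit X f) = f.
Proof.
apply: homZ_ext => n; rewrite -[LHS]/(f (1 : Z) *~ n) -(raddfMz f); congr (f _).
exact: intz.
Qed.

Lemma tate_from_unitK X n (x : tateH n X) : tate_map (at_unit X) (tate_map (from_unit X) x) = x.
Proof.
rewrite -[LHS](tate_map_comp (at_unit X) (from_unit X)) -[RHS]tate_map_id.
by apply: eq_tate_map => y; exact: from_unitK.
Qed.
Lemma tate_at_unitK X n (x : tateH n (homZ Z X)) :
  tate_map (from_unit X) (tate_map (at_unit X) x) = x.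
Proof.
rewrite -[LHS](tate_map_comp (from_unit X) (at_unit X)) -[RHS]tate_map_id.
by apply: eq_tate_map => y; exact: at_unitK.
Qed.

Lemma idcMz A n : cls0 (idZ A *~ n) = idc A *~ n.
Proof. by apply: cls0Mz; exact: invariant_idZ. Qed.

Lemma endZ_multiple (y : tateH 0 (homZ Z Z)) : exists n : int, y = idc Z *~ n.
Proof.
have [f fI ->] := cls0P y; exists (f (1 : Z)); rewrite -idcMz; congr cls0.
apply: homZ_ext => k; rewrite homZMzE -[in LHS](intz k).
rewrite -[LHS]/(f ((1 : Z) *~ k)) raddfMz.
by rewrite -[LHS]/((f (1 : Z) : int) *~ k) -[RHS]/((k : int) *~ (f (1 : Z) : int)) !mulrzz mulrC.
Qed.

Lemma endZ_order (n : int) : idc Z *~ n = 0 -> (#|gT|%:Z %| n)%Z.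
Proof.
rewrite -idcMz => /cls0_eq0[|k /(congr1 (fun f : homZ Z Z => f (1 : Z)))].
  exact/invariantMz/invariant_idZ.
rewrite homZMzE homZ_sumE => E; apply/dvdzP; exists (k (1 : Z)).
have <- : (1 : int) *~ n = n by exact: intz.
transitivity (\sum_(g : gT) (k (1 : Z) : int)); first exact: E.
by rewrite sumr_const pmulrn mulrzz.
Qed.

Lemma gcompMzl A B C p q n (e : p + q = n) (x : tateH p (homZ B C)) (y : tateH q (homZ A B)) k :
  gcomp e (x *~ k) y = gcomp e x y *~ k.
Proof. exact: pcupMzl. Qed.
Lemma gcompMzr A B C p q n (e : p + q = n) (x : tateH p (homZ B C)) (y : tateH q (homZ A B)) k :
  gcomp e x (y *~ k) = gcomp e x y *~ k.
Proof. exact: pcupMzr. Qed.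

(** Every y from Z to X is x (x' y), where x' y lies in H^0(G, Hom(Z, Z)), which is generated by the
    identity with order |G|; an endomorphism y of X is treated through y x. *)
Lemma shift_iso_unit_cyclic r X : shift_iso r Z X ->
  zmod_iso (tateH r X) (Zmod #|gT|) /\ cyclic_zmod (tateH 0 (homZ X X)).
Proof.
move=> [r' [x [x' [e [e' [x'x xx']]]]]].
have [r0 r0'] : 0 + r = r /\ r + 0 = r by lia.
have gen (y : tateH r (homZ Z X)) : exists n : int, y = x *~ n.
  have [n nE] := endZ_multiple (gcomp e' x' y); exists n.
  by rewrite -[LHS](gcomp1l r0) -xx' (gcompA _ _ e' r0') nE gcompMzr gcomp1r.
split.
  apply/zmod_iso_cyclic; first by apply/card_gt0P; exists 1%g.
  exists (tate_map (at_unit X) x); split=> [y|n].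
    have [n nE] := gen (tate_map (from_unit X) y); exists n.
    by rewrite -raddfMz /= -nE tate_from_unitK.
  split=> [H|/dvdzP[k ->]]; last by rewrite mulrC mulrzA tateH_card mul0rz.
  apply: endZ_order; rewrite -x'x -gcompMzr -(tate_at_unitK x) -raddfMz /= H.
  by rewrite raddf0; exact: pcup0r.
exists (idc X) => y; have [n nE] := gen (gcomp r0 y x); exists n.
have e0 : 0 + 0 = 0 :> int by [].
by rewrite -[LHS](gcomp1r e0) -xx' -(gcompA r0 e) nE gcompMzl.
Qed.

(** A ring with cyclic additive group is generated by its unit: if id = k c and c c = j c, then c =
    (k c) c = j (k c) = j id. *)
Lemma cyclic_end_multiple X : cyclic_zmod (tateH 0 (homZ X X)) ->
  forall y : tateH 0 (homZ X X), exists n : int, y = idc X *~ n.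
Proof.
case=> c cP; have e0 : 0 + 0 = 0 :> int by [].
have [k kE] := cP (idc X); have [j jE] := cP (gcomp e0 c c).
have cE : c = idc X *~ j.
  rewrite -[LHS](gcomp1l e0) {1}kE gcompMzl jE -!mulrzA kE -mulrzA.
  by congr (_ *~ _); rewrite mulrC.
by move=> y; have [n ->] := cP y; exists (j * n); rewrite mulrzA -cE.
Qed.

Lemma pcup_evalA A B C p q s pq qs n (e1 : p + q = pq) (e2 : pq + s = n)
    (e3 : q + s = qs) (e4 : p + qs = n) (x : tateH p (homZ B C))
    (y : tateH q (homZ A B)) (t : tateH s A) :
  pcup (homZ_eval A C) e2 (gcomp e1 x y) t =
  pcup (homZ_eval B C) e4 x (pcup (homZ_eval A B) e3 y t).
Proof. exact: pcupA. Qed.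

Lemma cyclic_shift_iso_unit r X : char_liftable X ->
  zmod_iso (tateH r X) (Zmod #|gT|) -> cyclic_zmod (tateH 0 (homZ X X)) ->
  shift_iso r Z X.
Proof.
move=> XL /zmod_iso_cyclic; case; first by apply/card_gt0P; exists 1%g.
move=> c [cgen cord] Xcyc.
have [Y XY YL] := shift_iso_liftable (- r) XL.
have := shift_iso_sym XY; rewrite opprK => /shift_isoP[v [v' [e' [e [v'v vv']]]]].
have [er ey] : r + 0 = r /\ - r + r = 0 by lia.
have [y0 yr] : 0 + 0 = 0 :> int /\ 0 + r = r by lia.
have eval1 A n (en : 0 + n = n) (t : tateH n A) :
    pcup (homZ_eval A A) en (idc A) t = t.
  by rewrite (pcup_cls0l _ (k := ghom_id A)) ?tate_map_id //; exact: invariant_idZ.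
have vK (t : tateH r X) : pcup (homZ_eval Y X) er v (pcup (homZ_eval X Y) ey v' t) = t.
  by rewrite -(pcup_evalA e' yr ey er) vv' eval1.
have v'K (t : tateH 0 Y) : pcup (homZ_eval X Y) ey v' (pcup (homZ_eval Y X) er v t) = t.
  by rewrite -(pcup_evalA e y0 er ey) v'v eval1.
have [a aI aE] := cls0P (pcup (homZ_eval X Y) ey v' c).
have agen b : invariant b -> exists n : int, cls0 b = cls0 a *~ n.
  move=> bI; have [n nE] := cgen (pcup (homZ_eval Y X) er v (cls0 b)); exists n.
  by rewrite -aE -[LHS]v'K nE pcupMzr.
have aord n : cls0 a *~ n = 0 -> (#|gT|%:Z %| n)%Z.
  rewrite -aE -pcupMzr => H; apply/cord.
  by rewrite -[LHS]vK H pcup0r.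
have [f [k fa]] := invariant_functional YL aI agen aord.
pose x := tate_map (from_unit X) c.
have e1 : 0 - r = - r by lia.
pose x' := gcomp e1 (cls0 (ghom_homZ f)) v'.
have v'x : gcomp ey v' x = cls0 (from_unit Y a).
  rewrite -tate_map_cls0 // -aE /gcomp /x.
  rewrite (pcup_mapr (m' := post_pairing (from_unit Y) (homZ_eval X Y))).
    by apply/esym/tate_map_pcup.
  move=> h z; apply: homZ_ext => n.
  by rewrite -[LHS]/(h (z *~ n)) raddfMz.
have x'x : gcomp ey x' x = idc Z.
  rewrite (gcompA _ _ ey y0) v'x gcomp_ghom_class tate_map_cls0; last first.
    exact: invariant_ghom.
  have -> : homZ_map Z f (from_unit Y a) = idZ Z *~ (1 + k * #|gT|%:Z).
    apply: homZ_ext => n; rewrite homZMzE -fa.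
    rewrite -[LHS]/(f (a *~ n)) raddfMz.
    by rewrite -[LHS]/((f a : int) *~ n) -[RHS]/((n : int) *~ (f a : int)) !mulrzz mulrC.
  by rewrite idcMz mulrzDr mulr1z mulrzA tateH_card addr0.
have er' : r + - r = 0 by lia.
exists (- r), x, x', er', ey; split=> //.
(* Cyclicity gives x x' = t id, and t x = x x' x = x forces t = 1 modulo |G|, the order of c; then t
   id = id, since |G| kills Tate cohomology. *)
have [t tE] := cyclic_end_multiple Xcyc (gcomp er' x x').
have : x *~ t = x.
  have r0' : r + 0 = r by lia.
  by rewrite -[in LHS](gcomp1l yr x) -gcompMzl -tE (gcompA _ _ ey r0') x'x gcomp1r.
move/(congr1 (tate_map (at_unit X))); rewrite raddfMz /= tate_from_unitK.
move=> /eqP; rewrite -subr_eq0 -{2}(mulr1z c) -mulrzBr => /eqP/cord/dvdzP[j tj].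
rewrite tE -[t](subrK 1) tj mulrzDr mulr1z mulrC mulrzA tateH_card mul0rz add0r.
by [].
Qed.

Theorem encoding_unit r X : Zfree X ->
  (encoding_pair r X Z <->
     zmod_iso (tateH r X) (Zmod #|gT|) /\ cyclic_zmod (tateH 0 (homZ X X))).
Proof.
move=> /Zfree_char_liftable XL; split=> [/encoding_pairP|[H1 H2]].
  exact: shift_iso_unit_cyclic.
exact/encoding_pairP/cyclic_shift_iso_unit.
Qed.

End TrivialModule.

Theorem theorem1p3 (gT : finGroupType) (X X' : gmodType gT) (r : int) :
  [/\ (* (a) - (d) *)
      [<-> encoding_pair r X X';
           (0 <= r ->
              cohom_equiv X (tensor X' (tensor_pow (augIdeal gT) `|r|%N)))
           /\ (r < 0 ->
              cohom_equiv X
                (tensor X' (homZ (tensor_pow (augIdeal gT) `|r|%N) (trivZ gT))));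
           exists x : tateH r (homZ X' X), forall i : int,
             @is_nat_iso gT (homTate i X) (homTate (i + r) X')
               (fun A y => cup_comp y x);
           exists (x : tateH r (homZ X' X)) (x' : tateH (- r) (homZ X X')),
             tate_cast (addNr r) (cup_comp x' x) = ghom_class (ghom_id X')
             /\ tate_cast (subrr r) (cup_comp x x') = ghom_class (ghom_id X)],
      (* (e), (f) *)
      fin_gen X -> fin_gen X' ->
        (encoding_pair r X X' <->
           exists (i : int)
             (phi : forall A, tensorTate i X' A -> tensorTate (i + r) X A),
             is_nat_iso phi)
        /\ (encoding_pair r X X' <->
           exists x : tateH r (homZ X' X), forall i : int,
             @is_nat_iso gT (tensorTate i X') (tensorTate (i + r) X)
               (fun A y => tate_cast (addrC r i) (cup_eval x y)))
    & (* (g) *)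
      Zfree X ->
        (encoding_pair r X (trivZ gT) <->
           zmod_iso (tateH r X) (Zmod #|gT|)
           /\ cyclic_zmod (tateH 0 (homZ X X)))].
Proof.
split; [exact: encoding_tfae|exact: encoding_tensor|exact: encoding_unit].
Qed.
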